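(* Let $\phi\in L^2(0,\infty)\cap\mathcal W$ with $\phi(x)>0$ for all $x\ge 0$, and let $\psi$, $G(\cdot,\cdot)$ and $\mathcal D$ be defined from $\phi$ as in the context. Assume that $G(\cdot,\cdot)$ is the kernel of a bounded operator $G$ on $L^2(0,\infty)$. Then the operator $H=G^{-1}$ is self-adjoint on $\mathcal D=\mathrm{Dom}(H)$ and is given by $$Hg=\phi^{-1}(\phi' g-\phi g')'$$ for all $g\in\mathcal D$. Moreover $\mathrm{Spec}(H)\subseteq[\|G\|^{-1},\infty)$. Every $g\in\mathcal D$ satisfies the boundary condition $g(0)=0$. Moreover $$\langle Hg_1,g_2\rangle=\int_0^\infty(\phi g_1'-\phi' g_1)(\phi\overline{g_2'}-\phi'\overline{g_2})\,\phi^{-2}\,dx=\int_0^\infty\left(\frac{g_1}{\phi}\right)'\left(\frac{\overline{g_2}}{\phi}\right)'\phi^2\,dx$$ for all $g_1,g_2\in\mathcal D$.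
   Context: $\mathcal W=W^{1,2}_{\rm loc}[0,\infty)$ is the set of continuous functions $f$ on $[0,\infty)$ for which there is $g\in L^2_{\rm loc}[0,\infty)$ (that is, $g\in L^2(0,a)$ for every $a>0$) with $f(x)=f(0)+\int_0^x g(s)\,ds$ for all $x\ge0$; such $g$ is unique a.e., is called the weak derivative of $f$, and is written $f'$. Identities involving weak derivatives hold almost everywhere; a statement such as $\phi g'-\phi' g\in\mathcal W$ means that the function agrees a.e. with an element of $\mathcal W$. Given $\phi$, put $$\psi(x)=\phi(x)\int_0^x\frac{ds}{\phi(s)^2},\qquad G(x,y)=\begin{cases}\psi(x)\phi(y)&0\le x\le y<\infty,\\ \phi(x)\psi(y)&0\le y\le x<\infty.\end{cases}$$ That $G(\cdot,\cdot)$ is the kernel of a bounded operator $G$ means that $(Gf)(x)=\int_0^\infty G(x,y)f(y)\,dy$ defines a bounded operator on the complex Hilbert space $L^2(0,\infty)$. It is then known that $G$ is self-adjoint and injective with dense range, so that $H=G^{-1}$ is defined with $\mathrm{Dom}(H)=\mathrm{Ran}(G)$. The inner product is $\langle f,g\rangle=\int_0^\infty f\overline g\,dx$. $\mathcal D$ is the set of functions $g$ on $[0,\infty)$ such that: ($\mathcal D1$) $g\in L^2(0,\infty)\cap\mathcal W$; ($\mathcal D2$) $g(0)=0$; ($\mathcal D3$) $\phi g'-\phi' g\in\mathcal W$; ($\mathcal D4$) $\phi^{-1}(\phi g'-\phi' g)'\in L^2(0,\infty)$; ($\mathcal D5$) $\lim_{x\to\infty}g(x)/\psi(x)=0$. 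*)

(* Defs.v *)
From mathcomp Require Import all_boot all_order all_algebra.
From mathcomp Require Import complex.
From mathcomp Require Import all_classical all_reals all_analysis.
Import Order.TTheory GRing.Theory Num.Theory.
Import numFieldNormedType.Exports.

Set Implicit Arguments.
Unset Strict Implicit.
Unset Printing Implicit Defensive.

Local Open Scope classical_set_scope.
Local Open Scope ring_scope.
Local Open Scope complex_scope.

Section ComplexIntegration.
Context {R : realType}.
Local Notation C := R[i].
Local Notation mu := (@lebesgue_measure R).
Implicit Types (A : set R) (f g : R -> C).

Definition toC (f : R -> R) : R -> C := fun x => (f x)%:C.

Definition cintegrable A f : Prop :=
  mu.-integrable A (fun x => (complex.Re (f x))%:E) /\
  mu.-integrable A (fun x => (complex.Im (f x))%:E).

Definition cintegral A f : C :=
  (\int[mu]_(x in A) complex.Re (f x)) +i* (\int[mu]_(x in A) complex.Im (f x)).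

Definition L2on A f : Prop :=
  [/\ measurable_fun A (fun x => complex.Re (f x)),
      measurable_fun A (fun x => complex.Im (f x)) &
      (\int[mu]_(x in A)
        (complex.Re (f x) ^+ 2 + complex.Im (f x) ^+ 2)%:E < +oo)%E].

Definition half_line : set R := `]0, +oo[%classic.

Definition L2 f : Prop := L2on half_line f.

Definition L2loc f : Prop := forall a : R, 0 < a -> L2on `]0, a[ f.

Definition aeq f g : Prop := ae_eq mu half_line f g.

(* Functions on [0, oo) are represented by functions on R whose values at
   negative arguments are never used.  C^o is C with its norm topology. *)
Definition has_wderiv f g : Prop :=
  L2loc g /\ forall x : R, 0 <= x -> f x = f 0 + cintegral `]0, x[ g.

Definition Wloc : set (R -> C) :=
  [set f | {within `[0, +oo[, continuous (f : R -> C^o)} /\ exists g, has_wderiv f g].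

Definition aeWloc f : Prop := exists2 u, Wloc u & aeq f u.

(* A representative of the weak derivative of the element of Wloc that agrees
   a.e. with f; a junk value (the zero function) unless aeWloc f. *)
Definition wderiv f : R -> C :=
  xget (fun=> 0)
    [set g | exists u, [/\ Wloc u, aeq f u & has_wderiv u g]].

Definition inner f g : C := cintegral half_line (fun x => f x * conjc (g x)).

Definition L2norm f : R := Num.sqrt (complex.Re (inner f f)).

End ComplexIntegration.

(* Elements of the Hilbert space L^2(0, oo) are represented by functions f with
   L2 f, up to the relation aeq.  Everywhere defined operators are represented
   by maps on functions; possibly unbounded operators by their graphs, which are
   saturated for aeq. *)
Section Operators.
Context {R : realType}.
Local Notation C := R[i].
Implicit Types (f g h u v : R -> C) (B : (R -> C) -> (R -> C))
  (T : (R -> C) -> (R -> C) -> Prop).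

Definition bounded_op B : Prop :=
  [/\ forall f, L2 f -> L2 (B f),
      forall (a : C) f g, L2 f -> L2 g ->
        aeq (B (fun x => a * f x + g x)) (fun x => a * B f x + B g x) &
      exists M : R, forall f, L2 f -> L2norm (B f) <= M * L2norm f].

Definition opnorm B : R :=
  sup [set L2norm (B f) | f in [set f | L2 f /\ L2norm f <= 1]].

Definition op_graph B : (R -> C) -> (R -> C) -> Prop :=
  fun f h => [/\ L2 f, L2 h & aeq h (B f)].

Definition op_inverse T : (R -> C) -> (R -> C) -> Prop := fun f h => T h f.

Definition op_shift T (z : C) : (R -> C) -> (R -> C) -> Prop :=
  fun f k => L2 k /\ exists2 h, T f h & aeq k (fun x => h x - z * f x).

Definition op_dom T : set (R -> C) := [set f | exists h, T f h].

Definition linear_operator T : Prop :=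
  [/\ forall f h, T f h -> L2 f /\ L2 h,
      forall f h f' h', T f h -> L2 f' -> L2 h' -> aeq f f' -> aeq h h' ->
        T f' h',
      forall f h h', T f h -> T f h' -> aeq h h',
      T (fun=> 0) (fun=> 0) &
      forall (a : C) f g h k, T f h -> T g k ->
        T (fun x => a * f x + g x) (fun x => a * h x + k x)].

Definition densely_defined T : Prop :=
  forall f, L2 f -> forall e : R, 0 < e ->
    exists2 g, op_dom T g & L2norm (fun x => f x - g x) < e.

Definition op_adjoint T : (R -> C) -> (R -> C) -> Prop :=
  fun u v => [/\ L2 u, L2 v & forall f h, T f h -> inner h u = inner f v].

Definition self_adjoint T : Prop :=
  [/\ linear_operator T, densely_defined T &
      forall u v, op_adjoint T u v <-> T u v].

Definition resolvent_set T : set C :=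
  [set z | exists2 B, bounded_op B &
     forall k f, op_inverse (op_shift T z) k f <-> op_graph B k f].

Definition spectrum T : set C := ~` resolvent_set T.

End Operators.

Section GreenOperator.
Context {R : realType}.
Local Notation C := R[i].
Local Notation mu := (@lebesgue_measure R).

Definition integral_op (K : R -> R -> R) (f : R -> C) : R -> C :=
  fun x => cintegral half_line (fun y => (K x y)%:C * f y).

Definition kernel_of_bounded_op (K : R -> R -> R) : Prop :=
  (forall f, L2 f -> {ae mu, forall x, half_line x ->
     cintegrable half_line (fun y => (K x y)%:C * f y)}) /\
  bounded_op (integral_op K).

Variable phi : R -> R.
Local Notation phiC := (toC phi).

Definition psi (x : R) : R := phi x * \int[mu]_(s in `]0, x[) (phi s ^- 2).

Definition green (x y : R) : R :=
  if x <= y then psi x * phi y else phi x * psi y.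

Definition wronskian (g : R -> C) : R -> C :=
  fun x => phiC x * wderiv g x - wderiv phiC x * g x.

Definition calD : set (R -> C) :=
  [set g | [/\ L2 g /\ Wloc g,
               g 0 = 0,
               aeWloc (wronskian g),
               L2 (fun x => (phiC x)^-1 * wderiv (wronskian g) x) &
               ((fun x => g x / (psi x)%:C) : R -> C^o) @ +oo --> (0 : C^o)]].

Definition Hformula (g : R -> C) : R -> C :=
  fun x => (phiC x)^-1 *
    wderiv (fun y => wderiv phiC y * g y - phiC y * wderiv g y) x.

End GreenOperator.

(* Main.v *)
Require Import Defs.
From mathcomp Require Import all_boot all_order all_algebra.
From mathcomp Require Import complex.
From mathcomp Require Import all_classical all_reals all_analysis.
From mathcomp Require Import measurable_realfun ring lra.
Import Order.TTheory GRing.Theory Num.Theory.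
Import numFieldNormedType.Exports.
Set Implicit Arguments.
Unset Strict Implicit.
Unset Printing Implicit Defensive.
Local Open Scope classical_set_scope.
Local Open Scope ring_scope.
Local Open Scope complex_scope.

(* For f in L^2 put A(x) = int_x^oo phi f and Psi(x) = int_0^x phi^-2.  Then
   G f = phi q with q(0) = 0 and q' = A phi^-2, so A is the Wronskian
   phi (Gf)' - phi' (Gf) and f = - A' / phi.  Conversely, for g in D with
   Wronskian w and f = - w' / phi, the function g - G f is a multiple c psi of
   psi, and (D5) forces c = 0, because Psi -> oo and q = o(Psi).

   Integrating <f1, G f2> by parts gives int A1 conj(A2) phi^-2 without any
   boundary term when f1 has bounded support; for f1 = f2 the boundedness of G
   bounds this energy, and Fatou's lemma and dominated convergence extend the
   identity to L^2.  Hence G is symmetric and nonnegative.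

   If z is not in [1/|G|, oo), the segment from 1 to 1 - z |G|, which contains
   the numerical range of 1 - z G, lies in an open half plane, so 1 - z G is
   invertible by the Lax-Milgram argument (a contraction).  The range of G is
   dense because (1 - r G)^n f tends to an element of the kernel of G. *)

(** * Primitives of locally integrable functions *)

Section RealIntegration.
Context {R : realType}.
Local Notation mu := (@lebesgue_measure R).
Local Notation intg A f := (mu.-integrable A (EFin \o f)).
Implicit Types (A : set R) (f g h : R -> R).

(** Vectors are functions rather than classes, and [wderiv] is a chosen representative. Hence the
    Hilbert space lemmas concern a semi-inner product on the functions that satisfy a predicate [S],
    they conclude [nsq _ = 0] where one expects an equality, and formulas with [wderiv] are reached
    through the uniqueness of weak derivatives, almost everywhere only. The kernel is real, so [G]
    acts separately on real and imaginary parts, and the kernel is analysed on real functions. The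
    delicate point is the energy identity. For general f1 the boundary term A1 q2 has no evident
    limit at infinity, and the integrability of A1 A2 phi^-2 is not given. Both difficulties are
    overcome by the boundedness of G alone, applied to truncations of f. That phi is in L^2 is used
    twice: it makes phi f integrable, so that A exists, and it forces Psi to be unbounded. *)

Lemma aeS (P Q : R -> Prop) : (forall x, P x -> Q x) ->
  {ae mu, forall x, P x} -> {ae mu, forall x, Q x}.
Proof.
move=> PQ; apply: filterS; first exact: (ae_filter_ringOfSetsType mu).
exact: PQ.
Qed.

Lemma aeS2 (P Q S : R -> Prop) : (forall x, P x -> Q x -> S x) ->
  {ae mu, forall x, P x} -> {ae mu, forall x, Q x} -> {ae mu, forall x, S x}.
Proof.
move=> PQ; apply: filterS2; first exact: (ae_filter_ringOfSetsType mu).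
exact: PQ.
Qed.

Lemma intgD A f g : measurable A -> intg A f -> intg A g ->
  intg A (fun x => f x + g x).
Proof. by move=> mA; exact: integrableD. Qed.

Lemma intgN A f : measurable A -> intg A f -> intg A (fun x => - f x).
Proof. by move=> mA; exact: integrableN. Qed.

Lemma intgB A f g : measurable A -> intg A f -> intg A g ->
  intg A (fun x => f x - g x).
Proof. by move=> mA; exact: integrableB. Qed.

Lemma intgZ A k f : measurable A -> intg A f -> intg A (fun x => k * f x).
Proof. by move=> mA; exact: integrableZl. Qed.

Lemma intg_measurable A f : intg A f -> measurable_fun A f.
Proof. by move=> /measurable_int /measurable_EFinP. Qed.

Lemma intg_le A f g : measurable A -> measurable_fun A f ->
  (forall x, A x -> `|f x| <= g x) -> intg A g -> intg A f.
Proof.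
move=> mA mf fg; apply: le_integrable => //; first exact/measurable_EFinP.
move=> x Ax /=; rewrite lee_fin (le_trans (fg x Ax))//.
exact: ler_norm.
Qed.

Lemma intg_bounded_mul A f h K : measurable A -> measurable_fun A h ->
  (forall x, A x -> `|h x| <= K) -> intg A f -> intg A (fun x => f x * h x).
Proof.
move=> mA mh hK fi.
apply: (@intg_le A _ (fun x => K * `|f x|)) => //.
- by apply: measurable_funM => //; exact: intg_measurable.
- move=> x Ax; rewrite normrM mulrC ler_wpM2r//; exact: hK.
- by apply: intgZ => //; exact: integrable_norm.
Qed.

Lemma intgS A B f : measurable A -> measurable B -> B `<=` A ->
  intg A f -> intg B f.
Proof. by move=> mA mB BA; exact: integrableS. Qed.

(** Measurability of [g] is a separate hypothesis here and in every later transfer along [ae_eq]: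
    the sigma-algebra is the Borel one, which is not complete. *)
Lemma intg_ae A f g : measurable A -> measurable_fun A g ->
  ae_eq mu A f g -> intg A f -> intg A g.
Proof.
move=> mA mg fg fi; apply/integrableP; split; first exact/measurable_EFinP.
case/integrableP: (fi) => _; apply: le_lt_trans.
rewrite le_eqVlt; apply/orP; left; apply/eqP/ae_eq_integral => //.
- by apply: measurableT_comp => //; exact/measurable_EFinP.
- by apply: measurableT_comp => //; exact: measurable_int fi.
- by apply: filterS fg => x h Ax /=; rewrite h.
Qed.

Lemma ae_Rintegral A f g : measurable A -> intg A f -> measurable_fun A g ->
  ae_eq mu A f g -> \int[mu]_(x in A) f x = \int[mu]_(x in A) g x.
Proof.
move=> mA fi mg fg; rewrite /Rintegral; congr fine; apply: ae_eq_integral => //.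
- exact: measurable_int fi.
- exact/measurable_EFinP.
- by apply: filterS fg => x h Ax /=; rewrite h.
Qed.

End RealIntegration.

Notation intg A f := ((@lebesgue_measure _).-integrable A (EFin \o f)).

Section Primitives.
Context {R : realType}.
Local Notation mu := (@lebesgue_measure R).
Implicit Types (f g h F G : R -> R).

(** For [a <= 0] the interval is empty, so quantifying over all real [a] spares a sign condition. *)
Definition locint F := forall a : R, intg `]0, a[ F.

Definition prim F (x : R) := \int[mu]_(t in `]0, x[) F t.

(** Continuity relative to [0, oo) with explicit radii, so that values at negative arguments never
    enter. *)
Definition cont0 f := forall x : R, 0 <= x -> forall e : R, 0 < e ->
  exists2 d : R, 0 < d & forall y, 0 <= y -> `|y - x| < d -> `|f y - f x| < e.

Lemma prim0 F : prim F 0 = 0.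
Proof. by rewrite /prim set_itv_ge ?Rintegral_set0// bnd_simp ltxx. Qed.

Lemma eq_prim F G x : (forall t, 0 < t < x -> F t = G t) -> prim F x = prim G x.
Proof.
move=> FG; apply: eq_Rintegral => t; rewrite inE/= in_itv/= => ?; exact: FG.
Qed.

Lemma locintS F a b : locint F -> 0 <= a -> intg `]a, b[ F.
Proof.
move=> Fi a0; apply: intgS (Fi b) => //.
by apply: subset_itvr; rewrite bnd_simp.
Qed.

Lemma primB F x y : locint F -> 0 <= x -> x <= y ->
  prim F y - prim F x = \int[mu]_(t in `]x, y[) F t.
Proof.
move=> Fi x0; rewrite le_eqVlt => /predU1P[<-|xy].
  by rewrite subrr set_itv_ge ?Rintegral_set0// bnd_simp ltxx.
rewrite /prim -(@Rintegral_itvB _ F (BRight 0) (BLeft y) x)//.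
by rewrite (Rintegral_itv_bndo_bndc (Fi x)).
Qed.

Lemma prim_le F x y : locint F -> (forall t, 0 < t -> 0 <= F t) ->
  0 <= x -> x <= y -> prim F x <= prim F y.
Proof.
move=> Fi F0 x0 xy; rewrite -subr_ge0 primB//; apply: Rintegral_ge0 => t /=.
by rewrite in_itv/= => /andP[xt _]; apply: F0; exact: le_lt_trans xt.
Qed.

Lemma locint_abs F : locint F -> locint (fun t => `|F t|).
Proof. by move=> Fi a; exact: integrable_norm. Qed.

Lemma prim_abs F x y : locint F -> 0 <= x -> x <= y ->
  `|prim F y - prim F x| <= prim (fun t => `|F t|) y - prim (fun t => `|F t|) x.
Proof.
move=> Fi x0 xy; rewrite !primB//; last exact: locint_abs.
by apply: le_normr_Rintegral => //; exact: locintS.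
Qed.

Lemma locintD F G : locint F -> locint G -> locint (fun t => F t + G t).
Proof. by move=> Fi Gi a; exact: intgD. Qed.

Lemma locintB F G : locint F -> locint G -> locint (fun t => F t - G t).
Proof. by move=> Fi Gi a; exact: intgB. Qed.

Lemma locintN F : locint F -> locint (fun t => - F t).
Proof. by move=> Fi a; exact: intgN. Qed.

Lemma primD F G x : locint F -> locint G ->
  prim (fun t => F t + G t) x = prim F x + prim G x.
Proof. by move=> Fi Gi; rewrite /prim RintegralD. Qed.

Lemma primMl k F x : locint F -> prim (fun t => k * F t) x = k * prim F x.
Proof. by move=> Fi; rewrite /prim RintegralZl. Qed.

Lemma primN F x : locint F -> prim (fun t => - F t) x = - prim F x.
Proof.
move=> Fi; rewrite -mulN1r -primMl//; apply: eq_prim => t _; by rewrite mulN1r.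
Qed.

Lemma prim_cont F : locint F -> cont0 (prim F).
Proof.
move=> Fi x x0 e e0.
(* Absolute continuity of the integral is available for functions integrable on the whole line;
   cutting at [x + 1] loses nothing because the radius is at most 1. *)
pose F1 := F \_ `]0, x + 1[.
have F1i : mu.-integrable setT (EFin \o F1).
  by rewrite -restrict_EFin; apply/integrable_restrict => //=; rewrite setTI.
have [d [d0 hd]] := integral_normr_continuous F1i e0.
exists (Num.min d 1); first by rewrite lt_min d0 ltr01.
have key a b : 0 <= a -> a <= b -> b < x + 1 -> b - a < d ->
    `|prim F b - prim F a| < e.
  move=> a0 ab bx bad; rewrite primB//.
  apply: (le_lt_trans (le_normr_Rintegral _ _)) => //; first exact: locintS.
  rewrite (_ : Rintegral _ _ _ = \int[mu]_(t in `]a, b[) `|F1 t|).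
    apply: hd => //; rewrite /= lebesgue_measure_itv/= lte_fin.
    by case: ifPn => // _; rewrite -EFinD lte_fin.
  apply: eq_Rintegral => t; rewrite inE/= in_itv/= => /andP[at_ tb].
  rewrite /F1 patchE ifT// inE/= in_itv/= (le_lt_trans a0 at_)/=.
  exact: lt_trans bx.
move=> y y0; rewrite lt_min => /andP[yd y1].
have [xy|yx] := leP x y.
  rewrite ger0_norm ?subr_ge0// in yd y1.
  by apply: key => //; rewrite -ltrBlDl.
rewrite ltr0_norm ?subr_lt0// opprB in yd y1.
rewrite distrC; apply: key => //; first exact: ltW.
by rewrite ltrDl.
Qed.

(** Continuous induction on the set of t in [0, X] where [r] has moved by at most [e * prim m t].
    The two-point estimate around its supremum leads from a point t of the set just below the
    supremum to a point [b] beyond it, unless [b] is already X. Then [e] tends to 0. *)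
Lemma prim_const (r m : R -> R) : locint m -> (forall t, 0 < t -> 0 <= m t) ->
  (forall x, 0 <= x -> forall e, 0 < e -> exists2 d, 0 < d &
     forall a b, 0 <= a -> a <= b -> `|a - x| < d -> `|b - x| < d ->
       `|r b - r a| <= e * (prim m b - prim m a)) ->
  forall x, 0 <= x -> r x = r 0.
Proof.
move=> mi m0 rm X X0.
have key e : 0 < e -> `|r X - r 0| <= e * prim m X.
  move=> e0.
  pose S := [set t | 0 <= t <= X /\ `|r t - r 0| <= e * prim m t].
  have S0 : S 0 by rewrite /S/= lexx X0 subrr normr0 prim0 mulr0.
  have hS : has_sup S by split; [exists 0 | exists X => t [/andP[_ tX] _]].
  have s0 : 0 <= sup S by apply: sup_upper_bound.
  have [d d0 hd] := rm _ s0 _ e0.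
  have [t [/andP[t0 tX] St] st] := sup_adherent d0 hS.
  have ts : t <= sup S by apply: sup_upper_bound => //; rewrite /S/= t0 tX.
  set b := Num.min X (sup S + d / 2).
  have tb : t <= b.
    by rewrite le_min tX (le_trans ts)// lerDl divr_ge0// ltW.
  have sX : sup S <= X by apply: ge_sup; [exists 0|move=> u [/andP[_ uX] _]].
  have sb : sup S <= b by rewrite le_min sX lerDl divr_ge0// ltW.
  have bs : b <= sup S + d / 2 by rewrite ge_min lexx orbT.
  have Sb : S b.
    split; first by rewrite (le_trans t0 tb)/= ge_min lexx.
    have h1 : `|t - sup S| < d.
      by rewrite distrC ger0_norm ?subr_ge0// ltrBlDr -ltrBlDl.
    have h2 : `|b - sup S| < d.
      rewrite ger0_norm ?subr_ge0// ltrBlDl (le_lt_trans bs)// ltrD2l.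
      by rewrite ltr_pdivrMr// ltr_pMr// ltr1n.
    have := hd t b t0 tb h1 h2.
    rewrite mulrBr => h; rewrite -(subrK (r t) (r b)) -addrA.
    by rewrite (le_trans (ler_normD _ _))// -[leRHS](subrK (e * prim m t)) lerD.
  have : b <= sup S by exact: sup_upper_bound.
  rewrite ge_min => /orP[Xs|]; last by rewrite gerDl leNgt divr_gt0.
  by case: Sb; rewrite /b (min_idPl _)// (le_trans Xs)// lerDl divr_ge0// ltW.
apply/eqP; rewrite -subr_eq0 -normr_le0; apply/ler_addgt0Pl => e e0.
rewrite addr0.
have M0 : 0 <= prim m X by rewrite -(prim0 m); apply: prim_le.
(* The [+ 1] covers the case where [prim m X] vanishes. *)
apply: (le_trans (key (e / (prim m X + 1)) _)); first by rewrite divr_gt0// ltr_wpDl.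
rewrite mulrAC ler_pdivrMr ?ltr_wpDl// ler_wpM2l ?lerDl// ltW//.
Qed.

(** The radius is real while [e] lies in the scalar field [K]; one statement then serves real
    functions and, with [K] equal to [R[i]], complex ones. *)
Lemma within_cont0P {K : numFieldType} {V : normedModType K} (f : R -> V) :
  {within `[0, +oo[, continuous f} <->
  (forall x : R, 0 <= x -> forall e : K, 0 < e ->
   exists2 d : R, 0 < d & forall y, 0 <= y -> `|y - x| < d -> `|f y - f x| < e).
Proof.
have E x : `[0, +oo[%classic x = (0 <= x) by rewrite /= in_itv/= andbT.
split.
  move=> /subspace_continuousP fc x x0 e e0.
  have := fc x; rewrite E => /(_ x0) /cvgrPdist_lt /(_ _ e0).
  rewrite near_withinE => /nbhs_ballP[d /= d0 hd]; exists d => // y y0 yx.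
  rewrite distrC; apply: hd; last by rewrite /= in_itv/= y0.
  by rewrite /ball/= distrC.
move=> fc; apply/subspace_continuousP => x; rewrite E => x0.
apply/cvgrPdist_lt => e e0; rewrite near_withinE.
have [d d0 hd] := fc x x0 e e0.
apply/nbhs_ballP; exists d => //= y; rewrite /ball/= => xy; rewrite in_itv/= andbT => y0.
by rewrite distrC; apply: hd => //; rewrite distrC.
Qed.

Lemma cont0P f : cont0 f <-> {within `[0, +oo[, continuous f}.
Proof. by rewrite (within_cont0P f). Qed.

Lemma half_lineE (x : R) : half_line x = (0 < x).
Proof. by rewrite /half_line/= in_itv/= andbT. Qed.

Lemma measurable_half_line : measurable (@half_line R).
Proof. exact: measurable_itv. Qed.
Hint Resolve measurable_half_line : core.

Lemma cont0_measurable f : cont0 f -> measurable_fun (@half_line R) f.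
Proof.
rewrite /half_line; move=> /cont0P fc; apply: subspace_continuous_measurable_fun => //.
apply: continuous_subspaceW fc => x /=; rewrite !in_itv/= !andbT; exact: ltW.
Qed.

Lemma measurable_itv0 f (a : R) : measurable_fun (@half_line R) f -> measurable_fun (`]0, a[%classic : set R) f.
Proof.
by apply: measurable_funS => // x /=; rewrite half_lineE in_itv/= => /andP[].
Qed.

Lemma measurable_half f : (forall a, 0 < a -> measurable_fun (`]0, a[%classic : set R) f) ->
  measurable_fun (@half_line R) f.
Proof.
move=> mf.
have -> : half_line = \bigcup_n (`]0, n.+1%:R[%classic : set R).
  apply/seteqP; split=> [x|x [n _]]; rewrite half_lineE; last by rewrite /= in_itv/= => /andP[].
  move=> x0; exists (Num.bound x) => //=; rewrite in_itv/= x0/=.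
  by rewrite (lt_le_trans (archi_boundP (ltW x0)))// ler_nat.
by apply/measurable_fun_bigcup => // n; exact: mf.
Qed.

Lemma cont0_bounded f (a : R) : cont0 f -> exists2 K, 0 < K &
  forall x, 0 <= x <= a -> `|f x| <= K.
Proof.
move=> fc; have [a0|a0] := leP 0 a; last first.
  by exists 1 => // x /andP[x0 /(le_trans x0)]; rewrite leNgt a0.
have cw : {within `[0, +oo[, continuous (fun x => `|f x|)}.
  apply/within_cont0P => x x0 e e0; have [d d0 hd] := fc x x0 e e0.
  exists d => // y y0 yx; apply: le_lt_trans (hd y y0 yx).
  exact: ler_dist_dist.
have : {within `[0, a], continuous (fun x => `|f x|)}.
  apply: continuous_subspaceW cw => x /=; by rewrite !in_itv/= andbT => /andP[].
move=> /(EVT_max a0)[c _ hc]; exists (`|f c| + 1); first by rewrite ltr_wpDl.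
by move=> x xa; rewrite (le_trans (hc x _)) ?lerDl// in_itv.
Qed.

Lemma cont0_cst k : cont0 (fun=> k).
Proof. by move=> x x0 e e0; exists 1 => // y _ _; rewrite subrr normr0. Qed.

Lemma cont0D f g : cont0 f -> cont0 g -> cont0 (fun x => f x + g x).
Proof. by move=> /cont0P cf /cont0P cg; apply/cont0P => x; apply: cvgD; [exact: cf|exact: cg]. Qed.

Lemma cont0M f g : cont0 f -> cont0 g -> cont0 (fun x => f x * g x).
Proof. by move=> /cont0P cf /cont0P cg; apply/cont0P => x; apply: cvgM; [exact: cf|exact: cg]. Qed.

Lemma cont0N f : cont0 f -> cont0 (fun x => - f x).
Proof. by move=> /cont0P cf; apply/cont0P => x; apply: cvgN; exact: cf. Qed.

Lemma cont0_ext f g : (forall x, 0 <= x -> f x = g x) -> cont0 f -> cont0 g.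
Proof.
move=> fg cf x x0 e e0; have [d d0 hd] := cf x x0 e e0.
by exists d => // y y0 yx; rewrite -!fg//; exact: hd.
Qed.

Lemma cont0V f : cont0 f -> (forall x, 0 <= x -> 0 < f x) -> cont0 (fun x => (f x)^-1).
Proof.
move=> /cont0P cf f0; apply/cont0P/subspace_continuousP => x x0.
apply: cvgV; first by rewrite gt_eqF// f0//; move: x0; rewrite /= in_itv/= andbT.
by move/subspace_continuousP : cf; exact.
Qed.

Lemma locintM F g : locint F -> cont0 g -> locint (fun t => F t * g t).
Proof.
move=> Fi gc a; have [K K0 hK] := cont0_bounded a gc.
apply: (@intg_bounded_mul _ _ _ _ K) => //.
  by apply: measurable_itv0; exact: cont0_measurable.
by move=> x /=; rewrite in_itv/= => /andP[x0 xa]; apply: hK; rewrite !ltW.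
Qed.

Lemma locint_cont0 g : cont0 g -> locint g.
Proof.
move=> gc.
have h1 : locint (fun=> 1).
  move=> a; apply: measurable_bounded_integrable => //.
    by rewrite /= lebesgue_measure_itv/=; case: ifP => // _; rewrite -EFinD ltry.
  by exists 1; split; rewrite ?num_real// => M M1 x _ /=; rewrite normr1 ltW.
have := locintM h1 gc; rewrite (_ : (fun t => 1 * g t) = g)//.
by apply/funext => t; rewrite mul1r.
Qed.

End Primitives.
#[global] Hint Resolve measurable_half_line : core.

Lemma lebesgue_measurable_half_line (R : realType) :
  measurable (half_line : set (measurableTypeR R)).
Proof. exact: measurable_half_line. Qed.
#[global] Hint Resolve lebesgue_measurable_half_line : core.

(** * Absolutely continuous functions *)

Section AbsoluteContinuity.
Context {R : realType}.
Local Notation mu := (@lebesgue_measure R).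
Implicit Types (f g h F G : R -> R).

(** The density [F] is carried as data, and local integrability suffices for the calculus; local
    square integrability is restored in [has_wderivP]. *)
Definition abs_cont f F := locint F /\ forall x, 0 <= x -> f x = f 0 + prim F x.

Lemma AC_cont f F : abs_cont f F -> cont0 f.
Proof.
move=> [Fi fF]; apply: (@cont0_ext _ (fun x => f 0 + prim F x)).
  by move=> x x0; rewrite -fF.
by apply: cont0D; [exact: cont0_cst|exact: prim_cont].
Qed.

Lemma AC_sub f F a b : abs_cont f F -> 0 <= a -> a <= b ->
  f b - f a = \int[mu]_(t in `]a, b[) F t.
Proof.
move=> [Fi fF] a0 ab; rewrite -primB// (fF a)// (fF b) ?(le_trans a0)//.
by rewrite opprD addrACA subrr add0r.
Qed.

Lemma AC_prim F : locint F -> abs_cont (prim F) F.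
Proof. by move=> Fi; split=> // x _; rewrite prim0 add0r. Qed.

Lemma AC_cst k : abs_cont (fun=> k) (fun=> 0).
Proof.
have i0 : locint (fun=> 0 : R) by exact/locint_cont0/cont0_cst.
split=> // x x0; rewrite (_ : prim _ _ = 0) ?addr0//.
rewrite -[RHS](mul0r (prim (fun=> 0) x)) -primMl//.
by apply: eq_prim => t _; rewrite mulr0.
Qed.

Lemma AC_D f F g G : abs_cont f F -> abs_cont g G ->
  abs_cont (fun x => f x + g x) (fun x => F x + G x).
Proof.
move=> [Fi fF] [Gi gG]; split; first exact: locintD.
by move=> x x0; rewrite primD// fF// gG// addrACA.
Qed.

Lemma AC_N f F : abs_cont f F -> abs_cont (fun x => - f x) (fun x => - F x).
Proof.
move=> [Fi fF]; split; first exact: locintN.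
by move=> x x0; rewrite primN// fF// opprD.
Qed.

Lemma AC_B f F g G : abs_cont f F -> abs_cont g G ->
  abs_cont (fun x => f x - g x) (fun x => F x - G x).
Proof. by move=> fF gG; apply: AC_D => //; exact: AC_N. Qed.

Lemma AC_ext f g F : (forall x, 0 <= x -> f x = g x) -> abs_cont f F -> abs_cont g F.
Proof. by move=> fg [Fi fF]; split=> // x x0; rewrite -!fg// fF. Qed.

Lemma AC_ae f F G : (forall a, measurable_fun (`]0, a[%classic : set R) G) ->
  ae_eq mu half_line F G -> abs_cont f F -> abs_cont f G.
Proof.
move=> mG FG [Fi fF].
have FGa a : ae_eq mu (`]0, a[%classic : set R) F G.
  by apply: ae_eq_subset FG => x; rewrite half_lineE /= in_itv/= => /andP[].
split=> [a|x x0]; first exact: intg_ae (Fi a).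
by rewrite fF// /prim (ae_Rintegral _ (Fi x) (mG x)).
Qed.

(* A function whose increments are negligible with respect to those of a
   monotone function is constant; this replaces almost everywhere
   differentiation in the product and quotient rules. *)
Lemma int_const (r m : R -> R) : locint m -> (forall t, 0 < t -> 0 <= m t) ->
  (forall x, 0 <= x -> forall e, 0 < e -> exists2 d, 0 < d &
     forall a b, 0 <= a -> a <= b -> `|a - x| < d -> `|b - x| < d ->
       exists k, [/\ intg `]a, b[ k, r b - r a = \int[mu]_(t in `]a, b[) k t &
         forall t, a < t < b -> `|k t| <= e * m t]) ->
  forall x, 0 <= x -> r x = r 0.
Proof.
move=> mi m0 H; apply: (prim_const mi m0) => x x0 e e0.
have [d d0 hd] := H x x0 e e0; exists d => // a b a0 ab ax bx.
have [k [ki -> km]] := hd a b a0 ab ax bx.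
rewrite primB// -RintegralZl//; last exact: locintS.
apply: (le_trans (le_normr_Rintegral _ ki)) => //; apply: le_Rintegral => //.
- exact: integrable_norm.
- by apply: intgZ => //; exact: locintS.
Qed.

(** On [a, b] the increment of f g is exactly the integral of g(b) F + f(a) G. By continuity this
    integrand differs from F g + f G by at most e (|F| + |G|) near any given point, and [int_const]
    discards such a defect. *)
Lemma AC_M f F g G : abs_cont f F -> abs_cont g G ->
  abs_cont (fun x => f x * g x) (fun x => F x * g x + f x * G x).
Proof.
move=> fF gG; have fc := AC_cont fF; have gc := AC_cont gG.
have [Fi _] := fF; have [Gi _] := gG.
have Hi : locint (fun x => F x * g x + f x * G x).
  apply: locintD; first exact: locintM.
  by under [X in locint X]eq_fun do rewrite mulrC; exact: locintM.
split=> // x x0; apply/eqP; rewrite -subr_eq; apply/eqP.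
rewrite [RHS](_ : _ = f 0 * g 0 - prim (fun x => F x * g x + f x * G x) 0).
  pose r x := f x * g x - prim (fun x => F x * g x + f x * G x) x.
  apply: (@int_const r (fun x => `|F x| + `|G x|)) => //.
  - by apply: locintD; exact: locint_abs.
  move=> {x0}y y0 e e0; have e2 : 0 < e / 2 by exact: divr_gt0.
  have [d1 d10 h1] := fc y y0 _ e2; have [d2 d20 h2] := gc y y0 _ e2.
  exists (Num.min d1 d2); first by rewrite lt_min d10.
  move=> a b a0 ab; rewrite !lt_min => /andP[a1 a2] /andP[b1 b2].
  exists (fun t => (g b * F t + f a * G t) - (F t * g t + f t * G t)).
  have b0 : 0 <= b by exact: le_trans ab.
  have FI : intg `]a, b[ F by exact: locintS.
  have GI : intg `]a, b[ G by exact: locintS.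
  have HI := locintS b Hi a0.
  split.
  + by apply: intgB => //; apply: intgD => //; exact: intgZ.
  + rewrite RintegralB//; last by apply: intgD => //; exact: intgZ.
    rewrite RintegralD//; [|exact: intgZ..].
    rewrite !RintegralZl// -(AC_sub fF)// -(AC_sub gG)// -primB// /r; ring.
  + move=> t /andP[at_ tb]; have t0 : 0 <= t by rewrite (le_trans a0)// ltW.
    have ty c : (`|a - y| < c -> `|b - y| < c -> `|t - y| < c).
      rewrite !ltr_distl => /andP[ac _] /andP[_ bc].
      by rewrite (lt_trans ac at_) (lt_trans tb bc).
    rewrite (_ : _ - _ = F t * (g b - g t) + (f a - f t) * G t); last by ring.
    rewrite [leRHS]mulrDr (le_trans (ler_normD _ _))// !normrM lerD//.
      rewrite mulrC ler_wpM2r// (le_trans (ler_distD (g y) _ _))//.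
      rewrite [leRHS]splitr lerD// ltW//; first exact: h2.
      by rewrite distrC; apply: h2 => //; exact: ty.
    rewrite ler_wpM2r// (le_trans (ler_distD (f y) _ _))//.
    rewrite [leRHS]splitr lerD// ltW//; first exact: h1.
    by rewrite distrC; apply: h1 => //; exact: ty.
by rewrite prim0 subr0.
Qed.

(** Same comparison as for products: with u = 1/f, the increment of u on [a, b] is exactly minus the
    integral of u(a) u(b) F. *)
Lemma AC_V f F : abs_cont f F -> (forall x, 0 <= x -> 0 < f x) ->
  abs_cont (fun x => (f x)^-1) (fun x => - (F x * (f x) ^- 2)).
Proof.
move=> fF f0; have fc := AC_cont fF; have [Fi _] := fF.
pose u x := (f x)^-1.
have uc : cont0 u by exact: cont0V.
have Hi : locint (fun x => F x * (f x) ^- 2).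
  apply: locintM => //; apply: (@cont0_ext _ (fun x => u x * u x)); last exact: cont0M.
  by move=> x x0; rewrite /u -expr2 exprVn.
split=> [|x x0]; first exact: locintN.
rewrite primN//; apply/eqP; rewrite -subr_eq opprK; apply/eqP.
rewrite [RHS](_ : _ = u 0 + prim (fun x => F x * (f x) ^- 2) 0); last by rewrite prim0 addr0.
pose r x := u x + prim (fun x => F x * (f x) ^- 2) x.
apply: (@int_const r (fun x => `|F x|)) => //; first exact: locint_abs.
move=> {x0}y y0 e e0.
pose K := `|u y| + 1; have K0 : 0 < K by rewrite ltr_wpDl.
(* The bound 1 keeps |u| below [K] near [y]. The bound e / (4 K) makes each of the two terms of
   u(t)^2 - u(a) u(b) = u(t) (u(t) - u(a)) + u(a) (u(t) - u(b)) at most K e / (2 K). *)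
have e2 : 0 < Num.min 1 (e / (4 * K)) by rewrite lt_min ltr01 divr_gt0// mulr_gt0.
have [d d0 hd] := uc y y0 _ e2; exists d => // a b a0 ab ay yb.
have b0 : 0 <= b by exact: le_trans ab.
have FI : intg `]a, b[ F by exact: locintS.
have HI := locintS b Hi a0.
exists (fun t => F t * (f t) ^- 2 - (u a * u b) * F t); split.
- by apply: intgB => //; exact: intgZ.
- rewrite RintegralB//; last exact: intgZ.
  rewrite RintegralZl// -(AC_sub fF)// -primB// /r /u.
  have fa := f0 _ a0; have fb := f0 _ b0.
  by field; rewrite !gt_eqF.
- move=> t /andP[at_ tb]; have t0 : 0 <= t by rewrite (le_trans a0)// ltW.
  have ty : `|t - y| < d.
    move: ay yb; rewrite !ltr_distl => /andP[ac _] /andP[_ bc].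
    by rewrite (lt_trans ac at_) (lt_trans tb bc).
  have H s : 0 <= s -> `|s - y| < d -> `|u s - u y| <= e / (4 * K) /\ `|u s| <= K.
    move=> s0 sy; have := hd s s0 sy; rewrite lt_min => /andP[/ltW h1 /ltW h2].
    by split=> //; rewrite -(subrK (u y) (u s)) addrC (le_trans (ler_normD _ _))// lerD.
  have [ta Ka] := H _ a0 ay; have [tb' Kb] := H _ b0 yb; have [tt Kt] := H _ t0 ty.
  rewrite (_ : _ - _ = F t * (u t * ((u t - u y) - (u a - u y)) + u a * ((u t - u y) - (u b - u y)))); last first.
    by rewrite -exprVn -/(u t); ring.
  rewrite normrM mulrC ler_wpM2r// (le_trans (ler_normD _ _))// !normrM.
  have B c : `|c| <= e / (4 * K) -> `|u t - u y - c| <= e / (2 * K).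
    move=> hc; rewrite (le_trans (ler_normB _ _))// (le_trans (lerD tt hc))//.
    by rewrite le_eqVlt; apply/orP; left; apply/eqP; field; rewrite gt_eqF.
  rewrite (_ : e = K * (e / (2 * K)) + K * (e / (2 * K))); last by field; rewrite gt_eqF.
  by apply: lerD; apply: ler_pM => //; exact: B.
Qed.

(** Lebesgue's differentiation theorem: cut to ]0, n+1[ and extended by 0, F is integrable on the
    line and its primitive from -oo vanishes identically, while the derivative of that primitive is
    almost everywhere the truncated F. *)
Lemma prim_eq0_ae F : locint F -> (forall x, 0 <= x -> prim F x = 0) ->
  ae_eq mu half_line F (fun=> 0).
Proof.
move=> Fi F0.
have key n : {ae mu, forall x, `]0, n.+1%:R[%classic x -> F x = 0}.
  pose Fn := F \_ `]0, n.+1%:R[.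
  have Fni : mu.-integrable setT (EFin \o Fn).
    by rewrite -restrict_EFin; apply/integrable_restrict => //=; rewrite setTI.
  have Fnl : locally_integrable setT Fn by apply: integrable_locally.
  have Fy y : intg `]-oo, y] Fn by exact: intgS Fni.
  have := FTC1Ny Fy Fnl.
  have -> : (fun x => \int[mu]_(t in `]-oo, x]) Fn t) = (fun=> 0).
    apply/funext => y; rewrite /Fn -Rintegral_mkcondr.
    have [y0|y0] := leP y 0.
      rewrite (_ : _ `&` _ = set0) ?Rintegral_set0//.
      rewrite -subset0 => x /= []; rewrite !in_itv/= => xy /andP[x0 _].
      by have := lt_le_trans x0 (le_trans xy y0); rewrite ltxx.
    have [ny|yn] := leP n.+1%:R y.
      rewrite (_ : _ `&` _ = `]0, n.+1%:R[%classic); first exact: F0.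
      apply/seteqP; split => x /=; rewrite !in_itv/=; first by case.
      by move=> /andP[-> xn]; split => //; rewrite (le_trans _ ny)// ltW.
    rewrite (_ : _ `&` _ = `]0, y]%classic).
      by rewrite -Rintegral_itv_bndo_bndc; [exact/F0/ltW|exact: Fi].
    apply/seteqP; split => x /=; rewrite !in_itv/=; first by case=> -> /andP[->].
    by move=> /andP[-> xy]; split => //; exact: le_lt_trans yn.
  apply: filterS; first exact: (ae_filter_ringOfSetsType mu).
  by move=> x [_ +] xn; rewrite derive1_cst /Fn patchE ifT ?inE// => <-.
have /ae_foralln : forall n, {ae mu, forall x, `]0, n.+1%:R[%classic x -> F x = 0} by [].
apply: filterS => x H; rewrite half_lineE => x0.
apply: (H (Num.bound x)); rewrite /= in_itv/= x0/=.
by rewrite (lt_le_trans (archi_boundP (ltW x0)))// ler_nat.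
Qed.

Lemma AC_uniq f g F G : (forall x, 0 <= x -> f x = g x) -> abs_cont f F -> abs_cont g G ->
  ae_eq mu half_line F G.
Proof.
move=> fg [Fi fF] [Gi gG].
have : ae_eq mu half_line (fun x => F x - G x) (fun=> 0).
  apply: prim_eq0_ae; first exact: locintB.
  move=> x x0; rewrite primD ?primN//; last exact: locintN.
  have := fF x x0; rewrite fg// fg// gG// => /addrI ->.
  by rewrite subrr.
by apply: filterS => x h hx; apply/eqP; rewrite -subr_eq0 h.
Qed.

Lemma Rdominated_cvg (fn : nat -> R -> R) f g :
  (forall n, measurable_fun (@half_line R) (fn n)) ->
  measurable_fun (@half_line R) f ->
  (forall x, half_line x -> fn^~ x @ \oo --> f x) ->
  intg half_line g ->
  (forall n x, half_line x -> `|fn n x| <= g x) ->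
  \int[mu]_(x in half_line) (fn n x) @[n --> \oo] --> \int[mu]_(x in half_line) (f x).
Proof.
move=> mfn mf fnf gi fg.
have [] := @dominated_convergence _ _ _ mu half_line measurable_half_line
  (fun n => EFin \o fn n) (EFin \o f) (EFin \o g).
- by move=> n; apply/measurable_EFinP; exact: mfn.
- exact/measurable_EFinP.
- apply: aeW => x hx; apply/cvg_EFin; first exact: nearW.
  exact: fnf.
- exact: gi.
- by apply: aeW => x n hx; rewrite /= lee_fin; exact: fg.
- move=> fi _ h; apply: fine_cvg; rewrite fineK; [exact: h|].
  exact: integrable_fin_num.
Qed.

Lemma prim_cvgn F : intg (@half_line R) F ->
  prim F n%:R @[n --> \oo] --> \int[mu]_(x in half_line) F x.
Proof.
move=> Fi.
rewrite (_ : (fun n : nat => prim F n%:R) = (fun n : nat =>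
   \int[mu]_(x in half_line) (F \_ (`]0, n%:R[%classic : set R)) x)); last first.
  apply/funext => n; rewrite -Rintegral_mkcondr /prim; congr Rintegral.
  apply/seteqP; split => x; rewrite /= half_lineE in_itv/=; last by case.
  by move=> h; split => //; case/andP: h.
apply: (@Rdominated_cvg _ _ (fun x => `|F x|)).
- move=> n; apply/measurable_restrict => //; first exact: measurable_half_line.
  apply: (@measurable_funS _ _ _ _ half_line); first exact: measurable_half_line.
    by move=> x [].
  exact: intg_measurable.
- exact: intg_measurable.
- move=> x; rewrite half_lineE => x0; apply: cvg_near_cst.
  exists (Num.bound x).+1 => // n /= xn; rewrite patchE ifT// inE/= in_itv/= x0/=.
  by rewrite (lt_trans (archi_boundP (ltW x0)))// ltr_nat.
- exact: integrable_norm.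
- by move=> n x _; rewrite patchE; case: ifP; rewrite ?normr0.
Qed.

Lemma locint_half F : intg (@half_line R) F -> locint F.
Proof.
move=> Fi a; apply: intgS Fi => // x /=; rewrite half_lineE in_itv/=.
by case/andP.
Qed.

Lemma half_primB F x : intg (@half_line R) F -> 0 <= x ->
  \int[mu]_(t in half_line) F t - prim F x = \int[mu]_(t in `]x, +oo[) F t.
Proof.
move=> Fi x0; rewrite /prim (Rintegral_itv_bndo_bndc (locint_half Fi x)).
by rewrite /half_line Rintegral_itvB.
Qed.

(** [prim_cvgn] runs along integers only. The remainder of the integral of |F| decreases with its
    endpoint, so smallness at one integer extends to all later real endpoints. *)
Lemma half_prim_small F : intg (@half_line R) F -> forall e, 0 < e ->
  exists2 a, 0 < a & forall x, a <= x ->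
    `|\int[mu]_(t in half_line) F t - prim F x| < e.
Proof.
move=> Fi e e0.
have Ai : intg (@half_line R) (fun x => `|F x|) by exact: integrable_norm.
have := prim_cvgn Ai => /cvgrPdist_lt /(_ e e0) [N _ hN].
(* [N.+1] instead of [N] makes the threshold positive. *)
exists N.+1%:R => // x Nx.
have x0 : 0 <= x by rewrite (le_trans _ Nx).
have itS y z : 0 <= y -> y <= z -> `]z, +oo[%classic `<=` `]y, +oo[%classic.
  by move=> y0 yz t; rewrite /= !in_itv/= !andbT; exact: le_lt_trans.
have xi y g : 0 <= y -> intg (@half_line R) g -> intg `]y, +oo[ g.
  move=> y0; apply: intgS => //; exact: itS.
rewrite half_primB// (le_lt_trans (le_normr_Rintegral _ _))//; first exact: xi.
have := hN N.+1 (leqnSn N); rewrite /= half_primB// => /(le_lt_trans (ler_norm _)).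
apply: le_lt_trans.
rewrite -(half_primB Ai x0) -(half_primB Ai (ler0n R N.+1)) lerD2l lerN2.
by apply: prim_le => //; exact: locint_half.
Qed.

End AbsoluteContinuity.

(** * Positive bounded operators on a Hilbert space *)

Lemma quadratic_ge0 (R : realFieldType) (a b c : R) :
  (forall t, 0 <= a + 2 * t * b + t ^+ 2 * c) -> 0 <= c -> b ^+ 2 <= a * c.
Proof.
move=> H; rewrite le_eqVlt => /predU1P[c0|c0].
  rewrite -c0 mulr0; have [->|b0] := eqVneq b 0; first by rewrite expr0n.
  (* Without a quadratic term, this [t] gives the affine function the value -1. *)
  have := H (- (a + 1) / (2 * b)); rewrite -c0 mulr0 addr0.
  rewrite (_ : a + _ = -1); last by field.
  by rewrite oppr_ge0 ler10.
have := H (- b / c); rewrite (_ : a + _ + _ = (a * c - b ^+ 2) / c); last first.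
  by field; rewrite gt_eqF.
by rewrite pmulr_lge0 ?invr_gt0// subr_ge0.
Qed.

Lemma subrBB (V : zmodType) (a b c d : V) : (a - b) - (c - d) = (a - c) - (b - d).
Proof. by rewrite !opprD addrACA. Qed.

Lemma subrBr (V : zmodType) (a b c : V) : (a - c) - (b - c) = a - b.
Proof. by rewrite subrBB subrr subr0. Qed.

Section SemiInnerProduct.
Context {R : realType} {V : lmodType R[i]} (S : V -> Prop) (ip : V -> V -> R[i]).
Context (S0 : S 0) (SL : forall a u v, S u -> S v -> S (a *: u + v)).
Context (ipl : forall a u v w, S u -> S v -> S w ->
  ip (a *: u + v) w = a * ip u w + ip v w).
Context (ipc : forall u v, S u -> S v -> ip v u = conjc (ip u v)).
Context (ip_ge0 : forall u, S u -> 0 <= complex.Re (ip u u)).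

Definition rip u v : R := complex.Re (ip u v).
Definition nsq u : R := rip u u.
Definition nrm u : R := Num.sqrt (nsq u).

Lemma SD u v : S u -> S v -> S (u + v).
Proof. by move=> Su Sv; rewrite -(scale1r u); exact: SL. Qed.

Lemma SZ a u : S u -> S (a *: u).
Proof. by move=> Su; rewrite -(addr0 (a *: u)); exact: SL. Qed.

Lemma SB u v : S u -> S v -> S (u - v).
Proof. by move=> Su Sv; rewrite -scaleN1r; apply: SD => //; exact: SZ. Qed.

Hint Resolve S0 SD SZ SB : core.

Lemma ripC u v : S u -> S v -> rip v u = rip u v.
Proof. by move=> Su Sv; rewrite /rip ipc//; case: (ip u v). Qed.

Lemma ripDl u v w : S u -> S v -> S w -> rip (u + v) w = rip u w + rip v w.
Proof.
move=> Su Sv Sw; rewrite /rip -{1}(scale1r u) ipl// mul1r.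
by case: (ip u w) (ip v w) => ? ? [].
Qed.

Lemma ipZl a u w : S u -> S w -> ip (a *: u) w = a * ip u w.
Proof.
move=> Su Sw; have h0 : ip 0 w = 0.
  have := ipl 1 S0 S0 Sw; rewrite scaler0 addr0 mul1r => /eqP.
  by rewrite -subr_eq0 opprD addNKr oppr_eq0 => /eqP.
by rewrite -(addr0 (a *: u)) ipl// h0 addr0.
Qed.

Lemma ripZl (r : R) u w : S u -> S w -> rip (r%:C *: u) w = r * rip u w.
Proof.
by move=> Su Sw; rewrite /rip ipZl//; case: (ip u w) => x y /=; rewrite mul0r subr0.
Qed.

Lemma ripNl u w : S u -> S w -> rip (- u) w = - rip u w.
Proof.
move=> Su Sw; rewrite -mulN1r -ripZl//; congr rip.
by rewrite rmorphN1 scaleN1r.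
Qed.

Lemma ripBl u v w : S u -> S v -> S w -> rip (u - v) w = rip u w - rip v w.
Proof.
move=> Su Sv Sw; rewrite ripDl// ?ripNl//.
by rewrite -scaleN1r; exact: SZ.
Qed.

Lemma ripDr u v w : S u -> S v -> S w -> rip w (u + v) = rip w u + rip w v.
Proof. by move=> Su Sv Sw; rewrite ripC ?ripDl ?(ripC Sw)//; exact: SD. Qed.

Lemma ripBr u v w : S u -> S v -> S w -> rip w (u - v) = rip w u - rip w v.
Proof. by move=> Su Sv Sw; rewrite ripC ?ripBl ?(ripC Sw)//; exact: SB. Qed.

Lemma ripZr (r : R) u w : S u -> S w -> rip w (r%:C *: u) = r * rip w u.
Proof. by move=> Su Sw; rewrite ripC ?ripZl ?(ripC Sw)//; exact: SZ. Qed.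

Lemma nsqB u v : S u -> S v -> nsq (u - v) = nsq u - 2 * rip u v + nsq v.
Proof.
move=> Su Sv; rewrite /nsq ripBl ?ripBr//; last exact: SB.
rewrite (ripC Su Sv); ring.
Qed.

Lemma nsqD u v : S u -> S v -> nsq (u + v) = nsq u + 2 * rip u v + nsq v.
Proof.
move=> Su Sv; rewrite /nsq ripDl ?ripDr//; last exact: SD.
rewrite (ripC Su Sv); ring.
Qed.

Lemma nsqZ (a : R[i]) u : S u ->
  nsq (a *: u) = (complex.Re a ^+ 2 + complex.Im a ^+ 2) * nsq u.
Proof.
move=> Su; rewrite /nsq /rip ipZl ?(ipc (SZ a Su) Su)// ?ipZl//; last exact: SZ.
have := ipc Su Su; case: (ip u u) => p q; case: a => x y /= [] /eqP.
rewrite -subr_eq0 opprK -mulr2n mulrn_eq0/= => /eqP ->.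
by ring.
Qed.

Lemma nsqZr (r : R) u : S u -> nsq (r%:C *: u) = r ^+ 2 * nsq u.
Proof. by move=> Su; rewrite nsqZ//= expr0n addr0. Qed.

Lemma nsq0 : nsq 0 = 0.
Proof. by have := nsqZr 0 S0; rewrite scaler0 expr0n/= mul0r. Qed.

Lemma nsq_ge0 u : S u -> 0 <= nsq u.
Proof. exact: ip_ge0. Qed.

Lemma cauchy_schwarz u v : S u -> S v -> rip u v ^+ 2 <= nsq u * nsq v.
Proof.
move=> Su Sv; apply: quadratic_ge0; last exact: nsq_ge0.
move=> t; have := @nsq_ge0 (u + t%:C *: v) (SD Su (SZ _ Sv)).
by rewrite nsqD ?nsqZr ?ripZr//; [rewrite mulrA | exact: SZ].
Qed.

Lemma nrm_ge0 u : 0 <= nrm u.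
Proof. exact: sqrtr_ge0. Qed.

Lemma sqr_nrm u : S u -> nrm u ^+ 2 = nsq u.
Proof. by move=> Su; rewrite sqr_sqrtr// nsq_ge0. Qed.

Lemma le_nrm u r : S u -> 0 <= r -> (nrm u <= r) = (nsq u <= r ^+ 2).
Proof.
by move=> Su r0; rewrite -sqr_nrm// ler_pXn2r// nnegrE nrm_ge0.
Qed.

Lemma rip_le u v : S u -> S v -> rip u v <= nrm u * nrm v.
Proof.
move=> Su Sv; rewrite (le_trans (ler_norm _))//.
have h : 0 <= nrm u * nrm v by rewrite mulr_ge0// nrm_ge0.
rewrite -(ler_pXn2r (n := 2))// ?nnegrE//.
by rewrite real_normK ?num_real// exprMn !sqr_nrm// cauchy_schwarz.
Qed.

Lemma nrmD u v : S u -> S v -> nrm (u + v) <= nrm u + nrm v.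
Proof.
move=> Su Sv; rewrite le_nrm; [|exact: SD|by rewrite addr_ge0// nrm_ge0].
rewrite nsqD// sqrrD !sqr_nrm//.
by have := rip_le Su Sv; rewrite -(mulr_natl (_ * _)); lra.
Qed.

Lemma nrmBC u v : S u -> S v -> nrm (u - v) = nrm (v - u).
Proof. by move=> Su Sv; rewrite /nrm !nsqB// (ripC Su Sv); congr Num.sqrt; ring. Qed.

Lemma nrm_dist u v w : S u -> S v -> S w ->
  nrm (u - w) <= nrm (u - v) + nrm (v - w).
Proof.
move=> Su Sv Sw; rewrite (_ : u - w = (u - v) + (v - w)).
  by apply: nrmD; exact: SB.
by rewrite addrA subrK.
Qed.

Definition cvg_seq (u : nat -> V) v := forall e : R, 0 < e ->
  exists N : nat, forall n, (N <= n)%N -> nrm (u n - v) < e.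

Definition cauchy_seq (u : nat -> V) := forall e : R, 0 < e ->
  exists N : nat, forall m n, (N <= n)%N -> (n <= m)%N -> nrm (u m - u n) < e.

(** Only nonexpansiveness is asked, because the lemma serves both the contraction of [lax_milgram]
    and the map 1 - r G of [dense_range], for which no contraction factor is available. *)
Lemma iter_fixpoint (T : V -> V) f v : (forall u, S u -> S (T u)) ->
  (forall u w, S u -> S w -> nrm (T u - T w) <= nrm (u - w)) ->
  S f -> S v -> cvg_seq (fun n => iter n T f) v -> nrm (T v - v) = 0.
Proof.
move=> TS Tn Sf Sv uv.
have Su n : S (iter n T f) by elim: n => //= n; exact: TS.
apply/eqP; rewrite eq_le nrm_ge0 andbT; apply/ler_addgt0Pl => e e0; rewrite addr0.
have e2 : 0 < e / 2 by exact: divr_gt0.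
have [N hN] := uv _ e2.
have := hN N.+1 (leqnSn N); have := hN N (leqnn N) => /=; set u := iter N T f.
have Sx : S u := Su N; have STu := TS _ Sx; have STv := TS _ Sv.
move=> h1 h2; apply: (le_trans (nrm_dist STv STu Sv)).
rewrite (splitr e) lerD// ?(ltW h2)//.
by rewrite (le_trans (Tn _ _ Sv Sx))// nrmBC// ltW.
Qed.

Context (complete : forall u : nat -> V, (forall n, S (u n)) -> cauchy_seq u ->
  exists2 v, S v & cvg_seq u v).

Lemma lax_milgram (L : V -> V) (c K : R) (k : V) :
  (forall u, S u -> S (L u)) ->
  (forall u v, S u -> S v -> L (u - v) = L u - L v) ->
  0 < c -> (forall u, S u -> c * nsq u <= rip (L u) u) ->
  (forall u, S u -> nsq (L u) <= K * nsq u) ->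
  S k -> exists2 u, S u & nsq (L u - k) = 0.
Proof.
move=> LS LB c0 Lc LK Sk.
(* With step [c / K1], expanding the square gives the factor 1 - 2 c^2 / K1 + c^2 / K1 = [kappa].
   The summand [c ^+ 2] in [K1] keeps [kappa] nonnegative, so that it has a square root; the 1 keeps
   [K1] positive. *)
pose K1 := `|K| + c ^+ 2 + 1.
have K10 : 0 < K1 by rewrite ltr_wpDl// addr_ge0// sqr_ge0.
have KK1 : K <= K1.
  by have := ler_norm K; have := sqr_ge0 c; rewrite /K1; lra.
pose rho := c / K1; have rho0 : 0 < rho by exact: divr_gt0.
pose kappa := 1 - c ^+ 2 / K1.
have k1 : kappa < 1 by rewrite gtrDl oppr_lt0 divr_gt0// exprn_gt0.
have k0 : 0 <= kappa.
  rewrite subr_ge0 ler_pdivrMr// mul1r.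
  by have := normr_ge0 K; rewrite /K1; lra.
pose T u := u - rho%:C *: (L u - k).
have TS u : S u -> S (T u) by move=> Su; apply: SB => //; apply: SZ; apply: SB => //; exact: LS.
have Tk u v : S u -> S v -> nsq (T u - T v) <= kappa * nsq (u - v).
  move=> Su Sv; have Sw : S (u - v) by exact: SB.
  have -> : T u - T v = (u - v) - rho%:C *: L (u - v).
    by rewrite LB// /T subrBB -scalerBr subrBr.
  have SLw := LS _ Sw; move: Sw SLw; set w := u - v => Sw SLw.
  rewrite nsqB//; last exact: SZ.
  rewrite ripZr// nsqZr// (ripC SLw Sw).
  have h1 := Lc _ Sw; have h2 := LK _ Sw; have h3 := nsq_ge0 Sw.
  have h4 : nsq (L w) <= K1 * nsq w.
    by rewrite (le_trans h2)// ler_wpM2r.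
  have h5 : rho * (c * nsq w) <= rho * rip (L w) w.
    by rewrite ler_wpM2l// ltW.
  have h6 : rho ^+ 2 * nsq (L w) <= rho ^+ 2 * (K1 * nsq w).
    by rewrite ler_wpM2l// sqr_ge0.
  have h7 : rho ^+ 2 * (K1 * nsq w) = rho * (c * nsq w).
    by rewrite /rho; field; rewrite gt_eqF.
  have h8 : kappa * nsq w = nsq w - rho * (c * nsq w).
    by rewrite /rho /kappa; field; rewrite gt_eqF.
  lra.
pose q := Num.sqrt kappa.
have q1 : q < 1 by rewrite -sqrtr1 ltr_sqrt.
have q0 : 0 <= q by exact: sqrtr_ge0.
have Tq u v : S u -> S v -> nrm (T u - T v) <= q * nrm (u - v).
  move=> Su Sv; rewrite le_nrm ?mulr_ge0 ?nrm_ge0//; last by apply: SB; exact: TS.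
  by rewrite exprMn sqr_sqrtr// sqr_nrm; [exact: Tk|exact: SB].
pose u n := iter n T 0.
have Su n : S (u n) by rewrite /u; elim: n => //= n; exact: TS.
(* The solution of D = q D + |T 0|, hence a bound for all iterates starting from 0. *)
pose D := nrm (T 0) / (1 - q).
have D0 : 0 <= D by rewrite divr_ge0 ?nrm_ge0// subr_ge0 ltW.
have uD n : nrm (u n - 0) <= D.
  elim: n => [|n IH].
    by rewrite subr0 /nrm /u/= nsq0 sqrtr0.
  rewrite (le_trans (@nrm_dist _ (T 0) _ _ _ _))//; first exact: TS.
  rewrite (le_trans (lerD (Tq _ _ (Su n) S0) (lexx _)))//.
  rewrite (le_trans (lerD (ler_wpM2l q0 IH) (lexx _)))// subr0.
  rewrite le_eqVlt; apply/orP; left; apply/eqP; rewrite /D.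
  by field; rewrite subr_eq0 gt_eqF.
have cauchy n p : nrm (u (n + p)%N - u n) <= q ^+ n * D.
  elim: n => [|n IH]; first by rewrite add0n expr0 mul1r uD.
  by rewrite addSn /= (le_trans (Tq _ _ _ _))// exprS -mulrA ler_wpM2l.
have uc : cauchy_seq u.
  move=> e e0; have D1 : 0 < D + 1 by rewrite ltr_wpDl.
  have /cvgrPdist_lt : q ^+ n @[n --> \oo] --> (0 : R).
    by apply: cvg_expr; rewrite ger0_norm.
  move=> /(_ (e / (D + 1))) []; first exact: divr_gt0.
  move=> N _ hN; exists N => m n Nn nm.
  rewrite -(subnKC nm) (le_lt_trans (cauchy _ _))//.
  have := hN n Nn; rewrite /= sub0r normrN ger0_norm ?exprn_ge0// => h.
  rewrite (le_lt_trans (y := q ^+ n * (D + 1)))//; last by rewrite -ltr_pdivlMr.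
  by rewrite ler_wpM2l ?exprn_ge0// lerDl.
have [v Sv uv] := complete Su uc.
have Tn w w' : S w -> S w' -> nrm (T w - T w') <= nrm (w - w').
  move=> Sw Sw'; rewrite (le_trans (Tq _ _ _ _))//.
  by rewrite ler_piMl ?nrm_ge0// ltW.
have := iter_fixpoint TS Tn S0 Sv uv.
move=> /(congr1 (fun x => x ^+ 2)); rewrite sqr_nrm ?expr0n/=; last by apply: SB => //; exact: TS.
rewrite /T addrAC subrr add0r => h; exists v => //.
have SLk : S (L v - k) by apply: SB => //; exact: LS.
move: h; rewrite -scaleNr -rmorphN nsqZr// => /eqP.
by rewrite mulf_eq0 sqrf_eq0 oppr_eq0 gt_eqF//= => /eqP.
Qed.

(** * Bounded symmetric nonnegative operators: resolvents and density of the range *)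

Section PositiveOperator.
Context (G : V -> V) (N : R).
Context (GS : forall u, S u -> S (G u)).
Context (GL : forall a u v, S u -> S v -> G (a *: u + v) = a *: G u + G v).
Context (Gsym : forall u v, S u -> S v -> ip (G u) v = ip u (G v)).
Context (Gpos : forall u, S u -> 0 <= rip (G u) u).
Context (N0 : 0 <= N) (Gbd : forall u, S u -> nsq (G u) <= N ^+ 2 * nsq u).

Hint Resolve GS : core.

Lemma GD u v : S u -> S v -> G (u + v) = G u + G v.
Proof. by move=> Su Sv; rewrite -{1}(scale1r u) GL// scale1r. Qed.

Lemma GZ a u : S u -> G (a *: u) = a *: G u.
Proof.
move=> Su; have G0 : G 0 = 0.
  have := GL 1 S0 S0; rewrite scaler0 addr0 scale1r => /eqP.
  by rewrite -subr_eq0 opprD addNKr oppr_eq0 => /eqP.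
by rewrite -{1}(addr0 (a *: u)) GL// G0 addr0.
Qed.

Lemma GB u v : S u -> S v -> G (u - v) = G u - G v.
Proof. by move=> Su Sv; rewrite -(scaleN1r v) GD ?GZ ?scaleN1r//; rewrite -scaleN1r; exact: SZ. Qed.

Lemma Gform_le u : S u -> rip (G u) u <= N * nsq u.
Proof.
move=> Su; rewrite (le_trans (rip_le _ _))//; first exact: GS.
rewrite -sqr_nrm// expr2 mulrA ler_wpM2r ?nrm_ge0// le_nrm ?mulr_ge0 ?nrm_ge0//; last exact: GS.
by rewrite exprMn sqr_nrm// Gbd.
Qed.

(** Cauchy-Schwarz for the nonnegative form (Gu, v), at u and Gu, gives |Gu|^4 <= (Gu, u) (GGu, Gu)
    <= (Gu, u) N |Gu|^2. *)
Lemma Gnsq_le u : S u -> nsq (G u) <= N * rip (G u) u.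
Proof.
move=> Su; have SGu := GS Su.
have rs v w : S v -> S w -> rip (G v) w = rip v (G w) by move=> Sv Sw; rewrite /rip Gsym.
have h : nsq (G u) ^+ 2 <= rip (G u) u * rip (G (G u)) (G u).
  apply: quadratic_ge0 => [t|]; last exact: Gpos.
  have St : S (t%:C *: G u) by exact: SZ.
  have := Gpos (SD Su St); rewrite GD// GZ//.
  have SGG := GS SGu; have StG : S (t%:C *: G (G u)) by exact: SZ.
  rewrite ripDl ?ripDr//; last exact: SD.
  rewrite !ripZl// !ripZr// (rs _ _ SGu Su) -/(nsq (G u)) => H.
  rewrite (le_trans H)// le_eqVlt; apply/orP; left; apply/eqP; ring.
have [->|n0] := eqVneq (nsq (G u)) 0; first by rewrite mulr_ge0// Gpos.
have np : 0 < nsq (G u) by rewrite lt_def n0 nsq_ge0.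
rewrite -(ler_pM2l np) -expr2 (le_trans h)//.
have := ler_wpM2l (Gpos Su) (Gform_le SGu); lra.
Qed.

(* With [m = 1 - z N], the multiplier [|m| + conj m] turns [m] and [1], hence
   the whole segment between them, into numbers of positive real part. *)
Lemma coercive_shift (z : R[i]) :
  ~ (complex.Im (1 - z * N%:C) = 0 /\ complex.Re (1 - z * N%:C) <= 0) ->
  exists a : R[i], exists2 c : R, 0 < c & 0 < complex.Re a /\
    forall u, S u -> c * nsq u <= rip (a *: (u - z *: G u)) u.
Proof.
case: z => p q.
have -> : 1 - (p +i* q) * N%:C = (1 - p * N) +i* (- (q * N)).
  by apply/eqP; rewrite eq_complex /=; apply/andP; split; apply/eqP; ring.
rewrite /=; set x : R := 1 - p * N; set y : R := - (q * N) => hm.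
have ye : y = - (q * N) by [].
have xe : x = 1 - p * N by [].
clearbody x y.
pose s : R := Num.sqrt (x ^+ 2 + y ^+ 2).
have s2 : s ^+ 2 = x ^+ 2 + y ^+ 2 by rewrite sqr_sqrtr// addr_ge0// sqr_ge0.
have s0 : 0 <= s by exact: sqrtr_ge0.
have A0 : 0 < s + x.
  (* If s + x <= 0 then x^2 + y^2 <= x^2, so y = 0 and x <= 0: the excluded case. *)
  rewrite ltNge; apply/negP => h; apply: hm.
  have x0 : x <= 0 by lra.
  have : (- x) ^+ 2 >= s ^+ 2.
    by rewrite ler_pXn2r ?nnegrE ?oppr_ge0// -subr_le0 opprK.
  rewrite s2 sqrrN gerDl => y2; split=> //; apply/eqP.
  by rewrite -sqrf_eq0 eq_le y2 sqr_ge0.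
have sp : 0 < s.
  rewrite lt_def s0 andbT; apply/eqP => sz; move: s2 A0; rewrite sz add0r => h x0.
  have := sqr_ge0 y; have : 0 < x ^+ 2 by rewrite exprn_gt0.
  by move: h; rewrite expr0n/=; lra.
exists ((s + x) +i* (- y)), (Num.min (s + x) (s * (s + x))).
  by rewrite lt_min A0 mulr_gt0.
split=> // u Su; have SGu := GS Su.
have imG : complex.Im (ip (G u) u) = 0.
  have := ipc SGu Su; rewrite -Gsym//; case: (ip (G u) u) => g h [] /eqP.
  by rewrite -subr_eq0 opprK -mulr2n mulrn_eq0/= => /eqP.
have imu : complex.Im (ip u u) = 0.
  have := ipc Su Su; case: (ip u u) => g h [] /eqP.
  by rewrite -subr_eq0 opprK -mulr2n mulrn_eq0/= => /eqP.
have -> : rip (((s + x) +i* (- y)) *: (u - (p +i* q) *: G u)) u =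
   (s + x) * nsq u - ((s + x) * p + y * q) * rip (G u) u.
  rewrite /rip ipZl; [|by apply: SB => //; exact: SZ|by []].
  rewrite [u - _]addrC -scaleNr ipl// /nsq /rip.
  case: (ip u u) imu => a b /= ->; case: (ip (G u) u) imG => c d /= ->; ring.
have g0 := Gpos Su; have gN := Gform_le Su; have n0 := nsq_ge0 Su.
(* The function r |-> (s + x) - r ((s + x) p + y q) is affine, with value s + x at 0 and, by this
   identity, s (s + x) at N. Since (Gu, u) lies between 0 and N |u|^2, the smaller endpoint value is
   a coercivity constant. *)
have hB : s * (s + x) = (s + x) - N * ((s + x) * p + y * q).
  have -> : s * (s + x) = s ^+ 2 + s * x by ring.
  rewrite s2 ye xe; ring.
have [h|h] := leP ((s + x) * p + y * q) 0.
  have h1 : Num.min (s + x) (s * (s + x)) * nsq u <= (s + x) * nsq u.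
    by rewrite ler_wpM2r// ge_min lexx.
  have h2 : 0 <= (- ((s + x) * p + y * q)) * rip (G u) u by rewrite mulr_ge0// oppr_ge0.
  lra.
have h1 : Num.min (s + x) (s * (s + x)) * nsq u <= s * (s + x) * nsq u.
  by rewrite ler_wpM2r// ge_min lexx orbT.
have h2 : ((s + x) * p + y * q) * rip (G u) u <= ((s + x) * p + y * q) * (N * nsq u).
  by rewrite ler_wpM2l// ltW.
move: h1; rewrite hB => h1; lra.
Qed.

Lemma nsq_shift_le (z : R[i]) u : S u ->
  nsq (u - z *: G u) <=
  2 * (1 + (complex.Re z ^+ 2 + complex.Im z ^+ 2) * N ^+ 2) * nsq u.
Proof.
move=> Su; have SGu := GS Su; have Sz : S (z *: G u) by exact: SZ.
(* Nonnegativity of |u + z Gu|^2 bounds the cross term in |u - z Gu|^2. *)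
have h := nsq_ge0 (SD Su Sz); rewrite nsqD// in h.
rewrite nsqB//; have h2 := Gbd Su; rewrite nsqZ// in h *.
have h3 : (complex.Re z ^+ 2 + complex.Im z ^+ 2) * nsq (G u) <=
  (complex.Re z ^+ 2 + complex.Im z ^+ 2) * (N ^+ 2 * nsq u).
  by rewrite ler_wpM2l// addr_ge0// sqr_ge0.
lra.
Qed.

(** The hypothesis says that 1 - z N is off the half line (-oo, 0]; in this form it needs no
    division by N, which may be 0. Existence comes from [lax_milgram] for a (1 - z G), and the bound
    from coercivity of the same operator. *)
Lemma resolvent_solve (z : R[i]) :
  ~ (complex.Im (1 - z * N%:C) = 0 /\ complex.Re (1 - z * N%:C) <= 0) ->
  (forall k, S k -> exists2 u, S u & nsq (u - z *: G u - k) = 0) /\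
  exists2 K, 0 <= K & forall u, S u -> nrm u <= K * nrm (u - z *: G u).
Proof.
move=> hz; have [a [c c0 [a0 hc]]] := coercive_shift hz.
pose M u := u - z *: G u.
have MS u : S u -> S (M u) by move=> Su; apply: SB => //; apply: SZ; exact: GS.
pose A := complex.Re a ^+ 2 + complex.Im a ^+ 2.
have A0 : 0 < A by rewrite ltr_wpDr ?sqr_ge0// exprn_gt0.
split.
  move=> k Sk.
  have [||||||u Su hu] := @lax_milgram (fun u => a *: M u) c
    (A * (2 * (1 + (complex.Re z ^+ 2 + complex.Im z ^+ 2) * N ^+ 2))) (a *: k).
  - by move=> u Su; apply: SZ; exact: MS.
  - by move=> u v Su Sv; rewrite -scalerBr; congr (_ *: _); rewrite /M GB// scalerBr subrBB.
  - exact: c0.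
  - exact: hc.
  - move=> u Su; have SM := MS _ Su; rewrite nsqZ// -[leRHS]mulrA.
    exact: (ler_wpM2l (ltW A0) (nsq_shift_le z Su)).
  - exact: SZ.
  exists u => //; move: hu; rewrite -scalerBr nsqZ; last by apply: SB => //; exact: MS.
  by move=> /eqP; rewrite mulf_eq0 gt_eqF//= => /eqP.
exists (Num.sqrt A / c); first by rewrite divr_ge0 ?sqrtr_ge0// ltW.
move=> u Su; have SM := MS _ Su.
have [->|n0] := eqVneq (nrm u) 0.
  by rewrite mulr_ge0 ?nrm_ge0// divr_ge0 ?sqrtr_ge0// ltW.
have np : 0 < nrm u by rewrite lt_def n0 nrm_ge0.
rewrite mulrAC ler_pdivlMr// -(ler_pM2r np) mulrAC -expr2 sqr_nrm// mulrC.
rewrite (le_trans (hc _ Su))// (le_trans (rip_le _ _))//; first exact: SZ.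
rewrite ler_wpM2r ?nrm_ge0//; rewrite /nrm nsqZ// sqrtrM// ltW//.
Qed.

(** Each f - u_n, with u_n = (1 - rho G)^n f, is in the range of G, so it suffices that u_n tends to
    0. By symmetry (u_i, u_j) depends on i + j only; call it b(i + j). Then |u_m - u_n|^2 = b(2m) -
    2 b(m + n) + b(2n), and convergence of the monotone sequence b makes u a Cauchy sequence. *)
Lemma dense_range (Ginj : forall u, S u -> nsq (G u) = 0 -> nsq u = 0) f e :
  S f -> 0 < e -> exists2 h, S h & nrm (f - G h) < e.
Proof.
(* Chosen so that rho N <= 1, also when N is 0. *)
move=> Sf e0; pose rho := (N + 1)^-1.
have N1 : 0 < N + 1 by rewrite ltr_wpDl.
have rho0 : 0 < rho by rewrite invr_gt0.
have rhoN : rho * N <= 1 by rewrite mulrC ler_pdivrMr// mul1r lerDl.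
pose T u := u - rho%:C *: G u.
have TS u : S u -> S (T u) by move=> Su; apply: SB => //; apply: SZ; exact: GS.
pose u n := iter n T f.
have Su n : S (u n) by rewrite /u; elim: n => //= n; exact: TS.
have rs v w : S v -> S w -> rip (G v) w = rip v (G w) by move=> Sv Sw; rewrite /rip Gsym.
have Tsym v w : S v -> S w -> rip (T v) w = rip v (T w).
  move=> Sv Sw; have SGv := GS Sv; have SGw := GS Sw.
  rewrite /T ripBl ?ripBr ?ripZl ?ripZr ?rs//; exact: SZ.
pose b n := rip (u n) f.
have bE i j : rip (u i) (u j) = b (i + j)%N.
  elim: j i => [i|j IH i]; first by rewrite addn0.
  by rewrite /= -Tsym// -[T (u i)]/(u i.+1) IH addnS addSn.
have Gn v : S v -> rho * nsq (G v) <= rip (G v) v.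
  move=> Sv; have h := Gnsq_le Sv; have g0 := Gpos Sv.
  rewrite (le_trans (ler_wpM2l (ltW rho0) h))// mulrA.
  by rewrite ler_piMl.
have Tn1 v : S v -> nsq (T v) <= nsq v.
  move=> Sv; have SGv := GS Sv; rewrite nsqB//; last exact: SZ.
  rewrite ripZr// nsqZr// -(rs _ _ Sv Sv).
  have := ler_wpM2l (ltW rho0) (Gn _ Sv).
  have := mulr_ge0 (ltW rho0) (Gpos Sv); rewrite expr2; lra.
have Tn v w : S v -> S w -> nrm (T v - T w) <= nrm (v - w).
  move=> Sv Sw; have -> : T v - T w = T (v - w).
    by rewrite /T GB// scalerBr subrBB.
  by have h := Tn1 _ (SB Sv Sw); rewrite /nrm ler_wsqrtr.
(* The parity of n matters. From an even index the drop is rho (Gu, u); from an odd one it is rho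
   (Gu, u) - rho^2 |Gu|^2, which is nonnegative by [Gn]. *)
have b2 n : b n.+1 <= b n.
  have e1 k : b (k + k)%N = nsq (u k) by rewrite -bE.
  have e2 k : b (k + k).+1 = rip (T (u k)) (u k) by rewrite -addSn -bE.
  have e3 k v : v = u k -> S v -> nsq v - rho * rip (G v) v = rip (T v) v.
    move=> _ Sv; have SGv := GS Sv; rewrite /T ripBl ?ripZl//; exact: SZ.
  rewrite -(odd_double_half n) -addnn; set k := n./2; have Sv := Su k.
  have SGv := GS Sv; have g0 := mulr_ge0 (ltW rho0) (Gpos Sv).
  case: (odd n) => /=; last by rewrite add0n e1 e2 -(e3 k)// gerBl.
  rewrite add1n e2 (_ : (k + k).+2 = (k.+1 + k.+1)%N); last by rewrite addSn addnS.
  rewrite e1 -(e3 k)//= /T nsqB//; last exact: SZ.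
  rewrite ripZr// nsqZr// -(rs _ _ Sv Sv).
  by have := ler_wpM2l (ltW rho0) (Gn _ Sv); rewrite expr2; lra.
(* Monotonicity gives b(n) >= b(2n) = |u_n|^2. *)
have b0 n : 0 <= b n.
  rewrite (le_trans (y := b (n + n)%N))//; first by rewrite -bE nsq_ge0.
  elim: {1}n => [|m IH]; first by rewrite add0n.
  by rewrite addSn (le_trans (b2 _)).
have bcvg : cvgn b.
  apply: nonincreasing_is_cvgn; first by apply/nonincreasing_seqP.
  by exists 0 => _ [n _ <-].
have uc : cauchy_seq u.
  (* Four values of b, counted with multiplicity, enter |u_m - u_n|^2, each within [d4] of the
     limit. *)
  move=> d d0; pose d4 := d ^+ 2 / 4.
  have d40 : 0 < d4 by rewrite divr_gt0// exprn_gt0.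
  have /cvgrPdist_lt /(_ _ d40) [M _ hM] := bcvg.
  exists M => m n Mn nm; have Mm := leq_trans Mn nm.
  have SB' := SB (Su m) (Su n).
  rewrite ltNge -(ler_pXn2r (n := 2)) ?nnegrE ?nrm_ge0 ?(ltW d0)// -ltNge sqr_nrm//.
  rewrite nsqB// /nsq !bE.
  have h1 := hM _ (leq_trans Mm (leq_addl m m)).
  have h2 := hM _ (leq_trans Mn (leq_addl n n)).
  have h3 := hM _ (leq_trans Mn (leq_addl m n)).
  move: h1 h2 h3; rewrite /= !ltr_distl => /andP[h1 h1'] /andP[h2 h2'] /andP[h3 h3'].
  have : d4 * 4 = d ^+ 2 by rewrite /d4; field.
  lra.
have [v Sv uv] := complete Su uc.
have STv := TS _ Sv; have SGv := GS Sv.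
have v0 : nrm v = 0.
  have := iter_fixpoint TS Tn Sf Sv uv.
  move=> /(congr1 (fun x => x ^+ 2)); rewrite sqr_nrm ?expr0n/=; last exact: SB.
  rewrite /T addrAC subrr add0r -scaleNr -rmorphN nsqZr// => /eqP.
  rewrite mulf_eq0 sqrf_eq0 oppr_eq0 gt_eqF//= => /eqP /(Ginj _ Sv).
  by rewrite /nrm => ->; rewrite sqrtr0.
have [M hM] := uv e e0.
have Gu n : exists2 h, S h & f - u n = G h.
  elim: n => [|n [h Sh hE]]; first by exists 0 => //; rewrite subrr -(scale0r 0) GZ// !scale0r.
  exists (h + rho%:C *: u n); first by apply: SD => //; exact: SZ.
  rewrite GD ?GZ//; last exact: SZ.
  by rewrite -hE /= /T opprB addrA addrAC.
have [h Sh hE] := Gu M; exists h => //.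
rewrite -hE opprB addrC subrK -[u M](subrK v) (le_lt_trans (nrmD _ _))//; first exact: SB.
by rewrite v0 addr0 hM.
Qed.

End PositiveOperator.
End SemiInnerProduct.

(** * Square integrable real functions *)

Section SquareIntegrable.
Context {R : realType}.
Local Notation mu := (@lebesgue_measure R).
Local Notation hl := (@half_line R).
Implicit Types (A : set R) (f g h : R -> R).

Definition rL2 A f := measurable_fun A f /\ intg A (fun x => f x ^+ 2).

Lemma measurable_sqr A f : measurable A -> measurable_fun A f ->
  measurable_fun A (fun x => f x ^+ 2).
Proof. by move=> mA mf; apply: (@measurable_funM _ _ _ _ f f). Qed.

Lemma rL2_le A f g : measurable A -> measurable_fun A f ->
  (forall x, A x -> `|f x| <= g x) -> rL2 A g -> rL2 A f.
Proof.
move=> mA mf fg [mg gi]; split=> //; apply: intg_le gi => //.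
  exact: measurable_sqr.
move=> x Ax; rewrite normrX ler_pXn2r ?nnegrE//; first exact: fg.
exact: le_trans (fg _ Ax).
Qed.

Lemma rL2_M A f g : measurable A -> rL2 A f -> rL2 A g ->
  intg A (fun x => f x * g x).
Proof.
move=> mA [mf fi] [mg gi].
apply: (@intg_le _ A _ (fun x => f x ^+ 2 + g x ^+ 2)) => //.
- exact: measurable_funM.
- move=> x _; rewrite normrM.
  have := sqr_ge0 (`|f x| - `|g x|); rewrite sqrrB !real_normK ?num_real//.
  rewrite -(mulr_natl (_ * _)) => h.
  have := mulr_ge0 (normr_ge0 (f x)) (normr_ge0 (g x)); lra.
- exact: intgD.
Qed.

Lemma rL2_Z A k f : measurable A -> rL2 A f -> rL2 A (fun x => k * f x).
Proof.
move=> mA [mf fi]; split; first exact: measurable_funM.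
under [X in intg A X]eq_fun do rewrite exprMn.
exact: intgZ.
Qed.

Lemma rL2_D A f g : measurable A -> rL2 A f -> rL2 A g ->
  rL2 A (fun x => f x + g x).
Proof.
move=> mA Lf Lg; have [mf fi] := Lf; have [mg gi] := Lg.
split; first exact: measurable_funD.
rewrite (_ : (fun _ => _) = (fun x => f x ^+ 2 + 2 * (f x * g x) + g x ^+ 2)).
  by apply: intgD => //; apply: intgD => //; apply: intgZ => //; exact: rL2_M.
by apply/funext => x; ring.
Qed.

Lemma rL2_B A f g : measurable A -> rL2 A f -> rL2 A g ->
  rL2 A (fun x => f x - g x).
Proof.
move=> mA Lf Lg; rewrite (_ : (fun _ => _) = (fun x => f x + -1 * g x)).
  by apply: rL2_D => //; exact: rL2_Z.
by apply/funext => x; rewrite mulN1r.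
Qed.

Lemma rL2_N A f : measurable A -> rL2 A f -> rL2 A (fun x => - f x).
Proof.
move=> mA Lf; rewrite (_ : (fun _ => _) = (fun x => -1 * f x)); first exact: rL2_Z.
by apply/funext => x; rewrite mulN1r.
Qed.

Lemma rL2_0 A : measurable A -> rL2 A (fun=> 0).
Proof.
move=> mA; split; first exact: measurable_cst.
rewrite (_ : (fun _ => _) = (fun=> 0)); first exact: integrable0.
by apply/funext => x; rewrite expr0n.
Qed.

Lemma rL2_abs A f : measurable A -> rL2 A f -> rL2 A (fun x => `|f x|).
Proof.
move=> mA [mf fi]; split; first exact: measurableT_comp.
by under [X in intg A X]eq_fun do rewrite real_normK ?num_real//.
Qed.

Lemma rL2_bounded_mul A f h K : measurable A -> measurable_fun A h ->
  (forall x, A x -> `|h x| <= K) -> rL2 A f -> rL2 A (fun x => f x * h x).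
Proof.
move=> mA mh hK Lf; have [mf _] := Lf.
apply: (@rL2_le _ _ (fun x => K * `|f x|)) => //.
- exact: measurable_funM.
- by move=> x Ax; rewrite normrM mulrC ler_wpM2r//; exact: hK.
- by apply: rL2_Z => //; exact: rL2_abs.
Qed.

Lemma rL2_ae A f g : measurable A -> measurable_fun A g -> ae_eq mu A f g ->
  rL2 A f -> rL2 A g.
Proof.
move=> mA mg fg [mf fi]; split=> //; apply: intg_ae fi => //.
  exact: measurable_sqr.
by apply: filterS fg => x h Ax; rewrite h.
Qed.

Lemma rL2_S A B f : measurable A -> measurable B -> B `<=` A -> rL2 A f -> rL2 B f.
Proof.
move=> mA mB BA [mf fi]; split; last exact: intgS fi.
exact: measurable_funS mf.
Qed.

Lemma limn_einf_le (u : (\bar R)^nat) (c : \bar R) :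
  (forall n, (u n <= c)%E) -> (limn_einf u <= c)%E.
Proof.
move=> uc; rewrite limn_einf_lim; apply: lime_le; first exact: is_cvg_einfs.
apply: nearW => n; apply: le_trans (uc n); apply: ereal_inf_lbound.
by exists n => //=.
Qed.

Lemma sum_half n : \sum_(0 <= k < n) (2^-1 : R) ^+ k <= 2.
Proof.
suff -> : \sum_(0 <= k < n) (2^-1 : R) ^+ k = 2 - 2 * 2^-1 ^+ n.
  by rewrite gerBl mulr_ge0// exprn_ge0// invr_ge0.
elim: n => [|n IH]; first by rewrite big_geq// expr0; ring.
by rewrite big_nat_recr//= IH exprS; field.
Qed.

(** The integrals of 2^n d_n^2 are at most 2^-n, so their sum is finite and the sum of 2^n d_n^2 is
    finite almost everywhere. Absolute convergence follows from |d_n| <= 2^-n + 2^n d_n^2. *)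
Lemma rL2_fast_cvg (d : nat -> R -> R) : (forall n, rL2 hl (d n)) ->
  (forall n, \int[mu]_(x in hl) (d n x ^+ 2) <= 4^-1 ^+ n) ->
  {ae mu, forall x, hl x -> cvgn (series (d^~ x))}.
Proof.
move=> Ld d4; pose h n x : R := 2 ^+ n * d n x ^+ 2.
have h0 n x : 0 <= h n x by apply: mulr_ge0; [exact: exprn_ge0|exact: sqr_ge0].
have hi n : intg hl (h n).
  by apply: intgZ; [exact: measurable_half_line|case: (Ld n)].
have mh n : measurable_fun hl (EFin \o h n).
  by apply/measurable_EFinP; exact: intg_measurable (hi n).
have h0' n x : hl x -> (0 <= (EFin \o h n) x)%E by move=> _; rewrite lee_fin.
pose Hs x := (\sum_(0 <= k <oo) (h k x)%:E)%E.
have Hint : (\int[mu]_(x in hl) Hs x <= 2%:E)%E.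
  have -> := integral_nneseries mu measurable_half_line mh h0'.
  apply: lime_le.
    by apply: is_cvg_nneseries => n _ _; apply: integral_ge0 => x hx; exact: h0'.
  apply: nearW => n; apply: (@le_trans _ _ (\sum_(0 <= k < n) (2^-1 : R) ^+ k)%:E); last first.
    by rewrite lee_fin sum_half.
  rewrite -sumEFin; apply: lee_sum => k _.
  have fk := integrable_fin_num (@lebesgue_measurable_half_line R) (hi k).
  rewrite -(fineK fk) lee_fin -/(Rintegral mu hl (h k)) /h RintegralZl//; last first.
    by case: (Ld k).
  rewrite (le_trans (ler_wpM2l _ (d4 k)))//.
  by rewrite -exprMn (_ : 2 * 4^-1 = 2^-1)//; field.
have Hs0 x : hl x -> (0 <= Hs x)%E by move=> _; apply: nneseries_ge0 => n _ _; rewrite lee_fin.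
have mHs : measurable_fun hl Hs.
  apply: (@ge0_emeasurable_sum _ _ R hl (fun k x => (h k x)%:E) xpredT) => //.
    by move=> n x hx _; rewrite lee_fin.
  by move=> k _; exact: mh.
have Hsi : mu.-integrable hl Hs.
  apply/integrableP; split; first exact: mHs.
  apply: (@le_lt_trans _ _ 2%:E); last exact: ltry.
  apply: le_trans Hint.
  rewrite le_eqVlt; apply/orP; left; apply/eqP; apply: eq_integral => x.
  by rewrite inE => hx; rewrite gee0_abs// Hs0.
have := integrable_ae (@lebesgue_measurable_half_line R) Hsi.
apply: filterS => x + hx => /(_ hx) fx.
have ch : cvgn (series (h^~ x)).
  by apply: nnseries_is_cvg => // ; rewrite -ge0_fin_numE// Hs0.
have cg : cvgn (series (geometric (1 : R) (2^-1))).
  by apply: is_cvg_geometric_series; rewrite ger0_norm ?invr_ge0// invf_lt1// ltr1n.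
apply: normed_cvg.
apply: (@series_le_cvg _ _ (fun n => geometric (1 : R) 2^-1 n + h n x)) => //.
- by move=> n /=.
- by move=> n; rewrite addr_ge0 ?h0// /geometric/= mul1r exprn_ge0// invr_ge0.
- move=> n; rewrite /geometric/= mul1r /h.
  have p0 : 0 < (2 : R) ^+ n by exact: exprn_gt0.
  rewrite exprVn; set p := 2 ^+ n in p0 *; set a := d n x.
  have : 0 <= p^-1 * ((1 - p * `|a|) ^+ 2).
    by rewrite mulr_ge0 ?sqr_ge0// invr_ge0 ltW.
  have -> : p^-1 * (1 - p * `|a|) ^+ 2 = p^-1 + p * `|a| ^+ 2 - 2 * `|a|.
    by field; rewrite gt_eqF.
  by rewrite real_normK ?num_real//; have := normr_ge0 a; lra.
- have -> : series (fun n => geometric (1 : R) 2^-1 n + h n x) =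
      series (geometric (1 : R) (2^-1)) \+ series (h^~ x).
    by apply/funext => n; rewrite /series/= big_split.
  exact: is_cvgD.
Qed.

(** Riesz-Fischer: a rapidly Cauchy subsequence converges almost everywhere, and Fatou's lemma along
    it bounds the distance of f_n to the limit. *)
Lemma rL2_complete (f : nat -> R -> R) : (forall n, rL2 hl (f n)) ->
  (forall e, 0 < e -> exists N : nat, forall m n, (N <= m)%N -> (N <= n)%N ->
     \int[mu]_(x in hl) ((f m x - f n x) ^+ 2) < e) ->
  exists2 g, rL2 hl g & forall e, 0 < e -> exists N : nat, forall n, (N <= n)%N ->
     \int[mu]_(x in hl) ((f n x - g x) ^+ 2) < e.
Proof.
move=> Lf fc; have mh := @lebesgue_measurable_half_line R.
have q0 k : 0 < (4^-1 : R) ^+ k by rewrite exprn_gt0// invr_gt0.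
have /choice[s hs] : forall k, exists N, forall m n, (N <= m)%N -> (N <= n)%N ->
  \int[mu]_(x in hl) ((f m x - f n x) ^+ 2) < 4^-1 ^+ k by move=> k; exact: fc.
(* Partial sums of [s] are nondecreasing and dominate [s k]. *)
pose idx k := (\sum_(i < k.+1) s i)%N.
have sidx k : (s k <= idx k)%N by rewrite /idx big_ord_recr /= leq_addl.
have idxS k : (idx k <= idx k.+1)%N by rewrite /idx [leqRHS]big_ord_recr /= leq_addr.
have idxm k j : (idx k <= idx (j + k))%N.
  by elim: j => // j IH; rewrite addSn (leq_trans IH).
pose g k := f (idx k).
pose d k x := g k.+1 x - g k x.
have Ld k : rL2 hl (d k) by apply: rL2_B => //; exact: Lf.
have d4 k : \int[mu]_(x in hl) (d k x ^+ 2) <= 4^-1 ^+ k.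
  by apply/ltW/hs => //; exact: leq_trans (idxS k).
have gae := rL2_fast_cvg Ld d4.
(* An upper limit is defined and measurable everywhere; off a null set it is the limit, and
   elsewhere its value is irrelevant. *)
pose F x := fine (limn_esup (fun k => (g k x)%:E)).
have mF : measurable_fun hl F.
  apply: (measurableT_comp (fine_measurable measurableT)).
  apply: measurable_fun_limn_esup => k; apply/measurable_EFinP.
  by case: (Lf (idx k)).
have gF : {ae mu, forall x, hl x -> g^~ x @ \oo --> F x}.
  apply: aeS gae => x H hx; have cd := H hx.
  have cg : cvgn (g^~ x).
    rewrite (_ : g^~ x = fun n => g 0%N x + series (d^~ x) n).
      by apply: is_cvgD => //; exact: is_cvg_cst.
    by apply/funext => n; exact: (eq_sum_telescope (g^~ x) n).
  have /cvg_ex[l gl] := cg.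
  have el : (fun k => (g k x)%:E) @ \oo --> l%:E by apply/cvg_EFin; [exact: nearW|].
  by rewrite /F (cvg_limn_einf_sup el).2.
have key k n : (s k <= n)%N ->
    (\int[mu]_(x in hl) ((f n x - F x) ^+ 2)%:E <= (4^-1 ^+ k)%:E)%E.
  move=> kn.
  pose u j x := ((f n x - g (j + k)%N x) ^+ 2)%:E.
  have Lu j : rL2 hl (fun x => f n x - g (j + k)%N x) by apply: rL2_B => //; exact: Lf.
  have mu_ j : measurable_fun hl (u j).
    by apply/measurable_EFinP; apply: measurable_sqr => //; case: (Lu j).
  have u0 j x : hl x -> (0 <= u j x)%E by move=> _; rewrite lee_fin sqr_ge0.
  have fat := fatou mu mh mu_ u0.
  have le_c : (limn_einf (fun j => \int[mu]_(x in hl) u j x) <= (4^-1 ^+ k)%:E)%E.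
    apply: limn_einf_le => j; have [_ ij] := Lu j.
    have fj := integrable_fin_num mh ij.
    rewrite -(fineK fj) lee_fin; apply/ltW/hs => //.
    exact: leq_trans (sidx k) (idxm k j).
  apply: le_trans (le_trans fat le_c).
  rewrite le_eqVlt; apply/orP; left; apply/eqP; apply: ge0_ae_eq_integral => //.
  - apply/measurable_EFinP; apply: measurable_sqr => //; apply: measurable_funB => //.
    by case: (Lf n).
  - rewrite /limn_einf; apply: measurableT_comp => //=.
    apply: measurable_fun_limn_esup => j; apply/measurable_EFinP.
    apply: measurableT_comp => //; apply: measurable_sqr => //.
    by case: (Lu j).
  - by move=> x _; rewrite lee_fin sqr_ge0.
  - move=> x hx; rewrite limn_einf_lim; apply: lime_ge; first exact: is_cvg_einfs.
    by apply: nearW => j; apply: le_ereal_inf_tmp => _ [i _ <-]; exact: u0.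
  apply: aeS gF => x H hx; have gl := H hx.
  have ul : u^~ x @ \oo --> ((f n x - F x) ^+ 2)%:E.
    apply/cvg_EFin; first exact: nearW.
    have gk : (fun j => g (j + k)%N x) @ \oo --> F x.
      by have := cvg_shiftn k (g^~ x) (nbhs (F x)) => ->.
    have ct : (fun j => f n x - g (j + k)%N x) @ \oo --> f n x - F x.
      by apply: cvgB => //; exact: cvg_cst.
    exact: (cvgM ct ct).
  by rewrite (cvg_limn_einf_sup ul).1.
have LFn n : (s 0%N <= n)%N -> rL2 hl (fun x => f n x - F x).
  move=> n0; have mfF : measurable_fun hl (fun x => f n x - F x).
    by apply: measurable_funB => //; case: (Lf n).
  split=> //; apply/integrableP; split.
    by apply/measurable_EFinP; exact: measurable_sqr.
  apply: le_lt_trans (ltry (4^-1 ^+ 0)); apply: le_trans (key 0%N n n0).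
  rewrite le_eqVlt; apply/orP; left; apply/eqP; apply: eq_integral => x _ /=.
  by rewrite ger0_norm// sqr_ge0.
exists F.
  rewrite (_ : F = fun x => f (s 0%N) x - (f (s 0%N) x - F x)).
    by apply: rL2_B => //; exact: LFn.
  by apply/funext => x; rewrite subKr.
move=> e e0.
have /cvgrPdist_lt /(_ e e0) [k _ hk] : (4^-1 : R) ^+ n @[n --> \oo] --> (0 : R).
  by apply: cvg_expr; rewrite ger0_norm ?invr_ge0// invf_lt1// ltr1n.
exists (maxn (s 0%N) (s k)) => n; rewrite geq_max => /andP[n0 nk].
have := hk k (leqnn k); rewrite /= sub0r normrN gtr0_norm//; apply: le_lt_trans.
have [_ ii] := LFn n n0; have fi := integrable_fin_num mh ii.
by rewrite -lee_fin fineK//; exact: key.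
Qed.

End SquareIntegrable.

(** * The Green kernel on real functions *)

Lemma min_lipschitz (R : realDomainType) (x y z : R) :
  `|Num.min x z - Num.min x y| <= `|z - y|.
Proof.
have h1 := ler_norm (z - y); have h2 := ler_norm (- (z - y)); rewrite normrN in h2.
case: (leP x z) => xz; case: (leP x y) => xy; rewrite ?subrr ?normr0//.
  by rewrite [leLHS]gtr0_norm ?subr_gt0//; lra.
by rewrite [leLHS]ltr0_norm ?subr_lt0//; lra.
Qed.

Section GreenKernel.
Context {R : realType} (phi dphi : R -> R).
Local Notation mu := (@lebesgue_measure R).
Local Notation hl := (@half_line R).
Context (phi_AC : abs_cont phi dphi) (phi_gt0 : forall x, 0 <= x -> 0 < phi x)
  (phi_L2 : rL2 hl phi).
Implicit Types f g : R -> R.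

Definition Psi := prim (fun s => phi s ^- 2).

(** [tail] and [quot] are the A and q of the overview. Writing A as a constant minus a primitive
    makes its absolute continuity down to 0 immediate. *)
Definition tail f x := \int[mu]_(y in hl) (phi y * f y) - prim (fun y => phi y * f y) x.

Definition quot f := prim (fun s => tail f s * phi s ^- 2).

Let mh : measurable hl := @measurable_half_line R.
Let mhL := @lebesgue_measurable_half_line R.

Lemma phi_cont : cont0 phi. Proof. exact: AC_cont phi_AC. Qed.

Lemma phiVn_cont : cont0 (fun s => phi s ^- 2).
Proof.
have uc : cont0 (fun x => (phi x)^-1) by apply: cont0V => //; exact: phi_cont.
apply: (@cont0_ext _ (fun x => (phi x)^-1 * (phi x)^-1)); last exact: cont0M.
by move=> x x0; rewrite -expr2 exprVn.
Qed.

Lemma phiVn_int : locint (fun s => phi s ^- 2).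
Proof. exact/locint_cont0/phiVn_cont. Qed.

Lemma Psi_AC : abs_cont Psi (fun s => phi s ^- 2).
Proof. exact/AC_prim/phiVn_int. Qed.

Lemma phiV_ge0 s : 0 <= phi s ^- 2.
Proof. by rewrite invr_ge0 sqr_ge0. Qed.

Lemma Psi_le x y : 0 <= x -> x <= y -> Psi x <= Psi y.
Proof. by move=> x0 xy; apply: prim_le => //; [exact: phiVn_int|move=> t _; exact: phiV_ge0]. Qed.

Lemma Psi_ge0 x : 0 <= x -> 0 <= Psi x.
Proof. by move=> x0; rewrite -(prim0 (fun s => phi s ^- 2)); exact: Psi_le. Qed.

Lemma phif_int f : rL2 hl f -> intg hl (fun y => phi y * f y).
Proof. by move=> Lf; exact: rL2_M. Qed.

Lemma phif_locint f : rL2 hl f -> locint (fun y => phi y * f y).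
Proof. by move=> Lf; exact/locint_half/phif_int. Qed.

Lemma tail_AC f : rL2 hl f -> abs_cont (tail f) (fun x => - (phi x * f x)).
Proof.
move=> Lf; have Fi := phif_locint Lf; split; first exact: locintN.
by move=> x x0; rewrite /tail prim0 subr0 primN.
Qed.

Lemma tail_cont f : rL2 hl f -> cont0 (tail f).
Proof. by move=> Lf; exact: AC_cont (tail_AC Lf). Qed.

Lemma quot_AC f : rL2 hl f -> abs_cont (quot f) (fun s => tail f s * phi s ^- 2).
Proof.
move=> Lf; apply/AC_prim/locint_cont0/cont0M; last exact: phiVn_cont.
exact: tail_cont.
Qed.

Lemma quot0 f : quot f 0 = 0. Proof. exact: prim0. Qed.

(** Integration by parts of Psi A on [0, x]; the boundary term at 0 vanishes with Psi. *)
Lemma green_tail f x : rL2 hl f -> 0 <= x ->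
  quot f x = prim (fun y => phi y * f y * Psi y) x + Psi x * tail f x.
Proof.
move=> Lf x0; have Fi := phif_locint Lf.
have [_ h] := AC_M Psi_AC (tail_AC Lf); have := h x x0.
rewrite {2}/Psi prim0 mul0r add0r => ->.
have i1 : locint (fun y => phi y * f y * Psi y).
  by apply: locintM => //; exact: AC_cont Psi_AC.
have [i2 _] := AC_M Psi_AC (tail_AC Lf).
by rewrite -primD//; apply: eq_prim => t _; ring.
Qed.

Lemma green_repr f x : rL2 hl f -> 0 <= x ->
  intg hl (fun y => green phi x y * f y) /\
  \int[mu]_(y in hl) (green phi x y * f y) = phi x * quot f x.
Proof.
(* Both branches of the kernel equal phi(x) phi(y) Psi(min(x, y)). For fixed x the factor [k] is
   continuous and bounded by its value for y >= x, so integrability holds at every x >= 0 and not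
   only almost everywhere. *)
move=> Lf x0; pose F y := phi y * f y; pose k y := phi x * Psi (Num.min x y).
have Fi := phif_int Lf; have Fl := phif_locint Lf.
have gE : (fun y => green phi x y * f y) = (fun y => F y * k y).
  apply/funext => y; rewrite /green /psi -/(prim (fun s => phi s ^- 2) x).
  rewrite -/(prim (fun s => phi s ^- 2) y) -/(Psi x) -/(Psi y) /F /k.
  by case: leP => _; ring.
have kc : cont0 k.
  apply: cont0M; first exact: cont0_cst.
  move=> y y0 e e0; have m0 : 0 <= Num.min x y by rewrite le_min x0.
  have [d d0 hd] := AC_cont Psi_AC m0 e0.
  exists d => // z z0 zy; apply: hd; first by rewrite le_min x0.
  exact: le_lt_trans (min_lipschitz x y z) zy.
have kb y : hl y -> `|k y| <= phi x * Psi x.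
  rewrite half_lineE => y0; have px := phi_gt0 x0.
  have m0 : 0 <= Num.min x y by rewrite le_min x0 ltW.
  rewrite /k ger0_norm; last by apply: mulr_ge0; [exact: ltW|exact: Psi_ge0].
  apply: ler_wpM2l; first exact: ltW.
  by apply: Psi_le => //; rewrite ge_min lexx.
have Hi : intg hl (fun y => F y * k y).
  exact: (intg_bounded_mul mh (cont0_measurable kc) kb Fi).
rewrite gE; split=> //.
have := half_primB Hi x0 => /eqP; rewrite subr_eq => /eqP ->.
have -> : prim (fun y => F y * k y) x = phi x * prim (fun y => F y * Psi y) x.
  rewrite -primMl; last by apply: locintM => //; exact: AC_cont Psi_AC.
  apply: eq_prim => t /andP[t0 tx]; rewrite /k min_r ?ltW//; ring.
have -> : \int[mu]_(t in `]x, +oo[) (F t * k t) = phi x * Psi x * tail f x.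
  rewrite /tail half_primB// -RintegralZl//; last first.
    apply: intgS Fi => // y /=; rewrite half_lineE in_itv/= andbT.
    exact: le_lt_trans.
  apply: eq_Rintegral => t; rewrite inE/= in_itv/= andbT => xt.
  by rewrite /k min_l ?ltW// /F; ring.
by rewrite (green_tail Lf x0) /F; ring.
Qed.

Lemma tail_small f e : rL2 hl f -> 0 < e ->
  exists2 a, 0 < a & forall x, a <= x -> `|tail f x| < e.
Proof. by move=> Lf; apply: half_prim_small; exact: phif_int. Qed.

Lemma prim_mono (F G : R -> R) x : locint F -> locint G ->
  (forall t, 0 < t -> F t <= G t) -> prim F x <= prim G x.
Proof.
move=> Fi Gi FG; apply: le_Rintegral => //.
by move=> t /=; rewrite in_itv/= => /andP[/FG].
Qed.

Lemma prim_le_half (F : R -> R) x : intg hl F -> (forall t, 0 < t -> 0 <= F t) ->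
  0 <= x -> prim F x <= \int[mu]_(t in hl) F t.
Proof.
move=> Fi F0 x0; rewrite -subr_ge0 half_primB//; apply: Rintegral_ge0 => t /=.
by rewrite in_itv/= andbT => xt; apply: F0; exact: le_lt_trans xt.
Qed.

(* [2 <= phi^2 + phi^-2], so [Psi] grows at least linearly. *)
Lemma Psi_unbounded K : exists2 a, 0 < a & forall x, a <= x -> K <= Psi x.
Proof.
have [mphi phi2] := phi_L2.
pose I := \int[mu]_(t in hl) (phi t ^+ 2).
have ge x : 0 <= x -> 2 * x - I <= Psi x.
  move=> x0.
  have c2 : locint (fun=> 2 : R) by exact/locint_cont0/cont0_cst.
  have p2 : locint (fun t => phi t ^+ 2) by exact: locint_half.
  have := @prim_mono (fun=> 2) (fun t => phi t ^+ 2 + phi t ^- 2) x c2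
    (locintD p2 phiVn_int).
  rewrite (primD x p2 phiVn_int).
  have -> : prim (fun=> 2) x = 2 * x.
    rewrite /prim Rintegral_cst//= lebesgue_measure_itv/= lte_fin.
    move: x0; rewrite le_eqVlt => /predU1P[<-|x0]; first by rewrite ltxx.
    by rewrite x0 -EFinD/= subr0.
  move=> H; have : 2 * x <= prim (fun t => phi t ^+ 2) x + Psi x.
    apply: H => t t0; have p0 := phi_gt0 (ltW t0).
    have : 0 <= (phi t - (phi t)^-1) ^+ 2 by exact: sqr_ge0.
    have -> : (phi t - (phi t)^-1) ^+ 2 = phi t ^+ 2 + phi t ^- 2 - 2.
      by field; rewrite gt_eqF.
    by rewrite subr_ge0.
  have : prim (fun t => phi t ^+ 2) x <= I.
    by apply: prim_le_half => // t _; exact: sqr_ge0.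
  lra.
exists (`|K + I| + 1); first by rewrite ltr_wpDl.
move=> x ax; have x0 : 0 <= x by rewrite (le_trans _ ax)// addr_ge0.
have := ge x x0; have := ler_norm (K + I); lra.
Qed.

(** A form of l'Hospital's rule: beyond a the increments of q are at most e/2 times those of Psi,
    and the unbounded Psi absorbs the value q(a). *)
Lemma quot_small f e : rL2 hl f -> 0 < e ->
  exists2 a, 0 < a & forall x, a <= x -> `|quot f x| <= e * Psi x.
Proof.
move=> Lf e0; have e2 : 0 < e / 2 by exact: divr_gt0.
have [a a0 ha] := tail_small Lf e2.
have [b b0 hb] := Psi_unbounded (`|quot f a| / (e / 2)).
have [qi _] := quot_AC Lf.
exists (Num.max a b); first by rewrite lt_max a0.
move=> x; rewrite ge_max => /andP[ax bx].
have h1 : `|quot f a| <= e / 2 * Psi x by rewrite mulrC -ler_pdivrMr// hb.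
have h2 : `|quot f x - quot f a| <= e / 2 * (Psi x - Psi a).
  have xi G : locint G -> intg `]a, x[ G by move=> Gi; apply: locintS => //; exact: ltW.
  rewrite (AC_sub Psi_AC (ltW a0) ax) (AC_sub (quot_AC Lf) (ltW a0) ax).
  rewrite -RintegralZl//; last exact/xi/phiVn_int.
  apply: (le_trans (le_normr_Rintegral _ (xi _ qi))) => //; apply: le_Rintegral => //.
  - exact/integrable_norm/xi.
  - by apply: intgZ => //; exact/xi/phiVn_int.
  - move=> t /=; rewrite in_itv/= => /andP[at_ _].
    rewrite normrM [X in _ * X]ger0_norm ?phiV_ge0// ler_wpM2r ?phiV_ge0//.
    by apply/ltW/ha/ltW.
have := Psi_ge0 (ltW a0); have := ler_normD (quot f x - quot f a) (quot f a).
rewrite subrK => h3 h4; have := mulr_ge0 (ltW e2) h4; lra.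
Qed.

Lemma cont0_ae_eq0 f : cont0 f -> ae_eq mu hl f (fun=> 0) ->
  forall x, 0 <= x -> f x = 0.
Proof.
move=> fc [N [mN N0 sN]] x x0; apply/eqP; apply/negP => /negP fx.
have e0 : 0 < `|f x| by rewrite normr_gt0.
have [d d0 hd] := fc x x0 _ e0.
(* If f(x) were nonzero, f would have no zero on this interval. It lies to the right of x so as to
   stay inside the half line when x = 0. *)
pose J : set R := `]x, x + d[%classic.
have : (mu J <= mu N)%E.
  apply: le_measure; rewrite ?inE//; first exact: measurable_itv.
  move=> y; rewrite /J /= in_itv/= => /andP[xy yd].
  apply: sN => /= H.
  have hy : hl y by rewrite half_lineE (le_lt_trans x0).
  have := hd y; rewrite (H hy) sub0r normrN ltxx => /(_ (le_trans x0 (ltW xy))).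
  rewrite ger0_norm ?subr_ge0 ?ltW// ltrBlDl => /(_ yd).
  by [].
rewrite N0 /J /= lebesgue_measure_itv/= lte_fin ltrDl d0 -EFinD lee_fin.
by rewrite addrAC subrr add0r leNgt d0.
Qed.

(** Uniqueness of densities is used twice, for q and then for A; in between, continuity of A turns
    vanishing almost everywhere into vanishing everywhere. *)
Lemma quot_inj f : rL2 hl f -> (forall x, 0 <= x -> quot f x = 0) ->
  ae_eq mu hl f (fun=> 0).
Proof.
move=> Lf q0.
have h1 := AC_uniq q0 (quot_AC Lf) (AC_cst 0).
have t0 : forall x, 0 <= x -> tail f x = 0.
  apply: cont0_ae_eq0; first exact: tail_cont.
  apply: aeS h1 => x H hx; have := H hx => /eqP; rewrite mulf_eq0 => /orP[/eqP//|].
  have px : 0 < phi x by apply: phi_gt0; move: hx; rewrite half_lineE; exact: ltW.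
  by rewrite invr_eq0 sqrf_eq0 gt_eqF.
have h2 := AC_uniq t0 (tail_AC Lf) (AC_cst 0).
apply: aeS h2 => x H hx; have := H hx => /eqP; rewrite oppr_eq0 mulf_eq0.
have px : 0 < phi x by apply: phi_gt0; move: hx; rewrite half_lineE; exact: ltW.
by rewrite gt_eqF//= => /eqP.
Qed.

Lemma quot_charac g dg W dW f : abs_cont g dg -> abs_cont W dW -> rL2 hl f ->
  ae_eq mu hl (fun x => phi x * dg x - dphi x * g x) W ->
  (forall x, hl x -> phi x * f x = - dW x) ->
  g 0 = 0 ->
  (forall e, 0 < e -> exists a, forall x, a <= x -> `|g x| <= e * (phi x * Psi x)) ->
  forall x, 0 <= x -> g x = phi x * quot f x /\ W x = tail f x.
Proof.
move=> gAC WAC Lf gW fW g0 gsmall.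
have Wc := AC_cont WAC.
(* The quotient rule gives (g / phi)' = W phi^-2, with the continuous representative [W] in place of
   the Wronskian. *)
pose q x := g x * (phi x)^-1.
have qAC : abs_cont q (fun x => W x * phi x ^- 2).
  apply: AC_ae (AC_M gAC (AC_V phi_AC phi_gt0)).
    move=> a; apply: measurable_itv0; apply: cont0_measurable.
    by apply: cont0M => //; exact: phiVn_cont.
  apply: aeS gW => x H hx; rewrite -(H hx).
  have px : 0 < phi x by apply: phi_gt0; move: hx; rewrite half_lineE; exact: ltW.
  by field; rewrite gt_eqF.
have cE x : 0 <= x -> W x - tail f x = W 0 - tail f 0.
  move=> x0; have [i h] := AC_B WAC (tail_AC Lf); rewrite (h x x0).
  rewrite (@eq_prim _ _ (fun=> 0)); last first.
    by move=> t /andP[t0 _]; rewrite opprK fW ?subrr// half_lineE.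
  by have [_ h0] := AC_cst (0 : R); have := h0 x x0; rewrite add0r => <-; rewrite addr0.
(* This constant is the coefficient of Psi in g / phi - q, as both quotients vanish at 0. *)
set c := W 0 - tail f 0 in cE.
have qE x : 0 <= x -> q x - quot f x = c * Psi x.
  move=> x0; have [_ h] := AC_B qAC (quot_AC Lf); rewrite (h x x0).
  rewrite quot0 /q g0 mul0r subr0 add0r /Psi -primMl; last exact: phiVn_int.
  apply: eq_prim => t /andP[t0 _]; rewrite -(cE t (ltW t0)); ring.
have c0 : c = 0.
  apply/eqP; rewrite -normr_le0; apply/ler_addgt0Pl => e e0; rewrite addr0.
  have e2 : 0 < e / 2 by exact: divr_gt0.
  have [a1 h1] := gsmall _ e2; have [a2 a20 h2] := quot_small Lf e2.
  have [a3 a30 h3] := Psi_unbounded 1.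
  (* Beyond [a1] and [a2] both quotients are at most e/2 Psi; beyond [a3], Psi >= 1 can be divided
     out. *)
  pose x := Num.max a1 (Num.max a2 a3).
  have xa1 : a1 <= x by rewrite le_max lexx.
  have xa2 : a2 <= x by rewrite !le_max lexx orbT.
  have xa3 : a3 <= x by rewrite !le_max lexx !orbT.
  have x0 : 0 <= x by rewrite (le_trans (ltW a20)).
  have P1 := h3 x xa3; have px := phi_gt0 x0.
  have P0 : 0 < Psi x by rewrite (lt_le_trans ltr01).
  have b1 : `|q x| <= e / 2 * Psi x.
    rewrite /q normrM normfV (gtr0_norm px) ler_pdivrMr//.
    by have := h1 x xa1; rewrite (mulrC (phi x)) mulrA.
  have b2 := h2 x xa2.
  rewrite -(ler_pM2r P0) -{1}(gtr0_norm P0) -normrM -qE//.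
  have := ler_normB (q x) (quot f x); lra.
move=> x x0; have px := phi_gt0 x0; split.
  have := qE x x0; rewrite c0 mul0r => /eqP; rewrite subr_eq0 => /eqP <-.
  by rewrite /q; field; rewrite gt_eqF.
by have := cE x x0; rewrite c0 => /eqP; rewrite subr_eq0 => /eqP.
Qed.

(** * The energy identity *)

Section Form.
Context (G_L2 : forall f, rL2 hl f -> rL2 hl (fun x => phi x * quot f x)).
Context (M : R) (M_ge0 : 0 <= M) (G_bd : forall f, rL2 hl f ->
  \int[mu]_(x in hl) ((phi x * quot f x) ^+ 2) <= M * \int[mu]_(x in hl) (f x ^+ 2)).

(** The integral of phi f over [x, n], which is the tail of f cut off at n. It vanishes at n. *)
Let part f (n : nat) x :=
  prim (fun y => phi y * f y) n%:R - prim (fun y => phi y * f y) x.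

Lemma part_AC f n : rL2 hl f -> abs_cont (part f n) (fun x => - (phi x * f x)).
Proof.
move=> Lf; have Fi := phif_locint Lf; split; first exact: locintN.
by move=> x x0; rewrite /part prim0 subr0 primN.
Qed.

(** Integration by parts on [0, n]; [part f1 n] vanishes at n and [quot f2] at 0. *)
Lemma form_part f1 f2 n : rL2 hl f1 -> rL2 hl f2 ->
  prim (fun x => f1 x * (phi x * quot f2 x)) n%:R =
  prim (fun x => part f1 n x * (tail f2 x * phi x ^- 2)) n%:R.
Proof.
move=> L1 L2; have AB := AC_M (part_AC n L1) (quot_AC L2).
have [i h] := AB; have := h n%:R (ler0n _ _).
rewrite quot0 mulr0 add0r {1}/part subrr mul0r.
have i1 : locint (fun x => f1 x * (phi x * quot f2 x)).
  by apply: locint_half; apply: rL2_M => //; exact: G_L2.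
move=> h0; rewrite -[LHS]add0r [X in X + _]h0 -primD//.
by apply: eq_prim => t _; ring.
Qed.

Let trunc f (n : nat) := f \_ (`]0, n%:R[%classic : set R).

Lemma trunc_L2 f n : rL2 hl f -> rL2 hl (trunc f n).
Proof.
move=> Lf; have [mf fi] := Lf; apply: (@rL2_le _ _ _ (fun x => `|f x|)) => //.
- apply/measurable_restrict => //.
  by apply: (@measurable_funS _ _ _ _ hl) => // x [].
- by move=> x _; rewrite /trunc patchE; case: ifP; rewrite ?normr0.
- exact: rL2_abs.
Qed.

Lemma truncE f n x : 0 < x < n%:R -> trunc f n x = f x.
Proof. by move=> xn; rewrite /trunc patchE ifT// inE/= in_itv. Qed.

Lemma Rintegral_trunc F n :
  \int[mu]_(x in hl) (F \_ (`]0, n%:R[%classic : set R)) x = prim F n%:R.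
Proof.
rewrite -Rintegral_mkcondr /prim; congr Rintegral.
apply/seteqP; split => x; rewrite /= half_lineE in_itv/=; first by case.
by move=> h; split => //; case/andP: h.
Qed.

Lemma tail_trunc f n x : rL2 hl f -> 0 <= x <= n%:R ->
  tail (trunc f n) x = part f n x.
Proof.
move=> Lf /andP[x0 xn]; rewrite /tail /part; congr (_ - _); last first.
  by apply: eq_prim => t /andP[t0 tx]; rewrite truncE// t0 (lt_le_trans tx).
rewrite -Rintegral_trunc; apply: eq_Rintegral => t _.
by rewrite /trunc !patchE; case: ifP => //; rewrite mulr0.
Qed.

(** The truncated energy is the pairing of f with G (trunc f) on ]0, n[. By a b <= a^2 + b^2 it is
    bounded by |f|^2, which gives the 1, plus |G (trunc f)|^2, which gives the [M]. The bound does
    not depend on n. *)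
Lemma part_energy f n : rL2 hl f ->
  prim (fun x => part f n x ^+ 2 * phi x ^- 2) n%:R <=
  (1 + M) * \int[mu]_(x in hl) (f x ^+ 2).
Proof.
move=> Lf; have Lt := trunc_L2 n Lf; have Gt := G_L2 Lt.
have -> : prim (fun x => part f n x ^+ 2 * phi x ^- 2) n%:R =
    prim (fun x => f x * (phi x * quot (trunc f n) x)) n%:R.
  rewrite form_part//; apply: eq_prim => t /andP[t0 tn].
  by rewrite tail_trunc ?ltW//; ring.
have [mf f2] := Lf; have [_ G2] := Gt; have [_ t2] := Lt.
apply: (@le_trans _ _ (prim (fun x => f x ^+ 2 + (phi x * quot (trunc f n) x) ^+ 2) n%:R)).
  apply: prim_mono.
  - by apply: locint_half; exact: rL2_M.
  - by apply: locintD; exact: locint_half.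
  - move=> t _; set a := f t; set b := _ * quot _ t.
    have := sqr_ge0 (a - b); have := sqr_ge0 a; have := sqr_ge0 b.
    rewrite sqrrB -(mulr_natl (a * b)); lra.
rewrite primD; [|exact: locint_half|exact: locint_half].
have h1 : prim (fun x => f x ^+ 2) n%:R <= \int[mu]_(x in hl) (f x ^+ 2).
  by apply: prim_le_half => // t _; exact: sqr_ge0.
have h2 : prim (fun x => (phi x * quot (trunc f n) x) ^+ 2) n%:R <=
    \int[mu]_(x in hl) ((phi x * quot (trunc f n) x) ^+ 2).
  by apply: prim_le_half => // t _; exact: sqr_ge0.
have h3 := G_bd Lt.
have h4 : \int[mu]_(x in hl) (trunc f n x ^+ 2) <= \int[mu]_(x in hl) (f x ^+ 2).
  apply: le_Rintegral => // x _; rewrite /trunc patchE; case: ifP => // _.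
  by rewrite expr0n/= sqr_ge0.
by rewrite mulrDl mul1r lerD// (le_trans h2)// (le_trans h3)// ler_wpM2l.
Qed.

Lemma part_cvg f x : rL2 hl f -> part f n x @[n --> \oo] --> tail f x.
Proof.
move=> Lf; apply: cvgB; last exact: cvg_cst.
exact/prim_cvgn/phif_int.
Qed.

Lemma patch_cvg (F : nat -> R -> R) (l : R) x : 0 < x ->
  F n x @[n --> \oo] --> l ->
  (F n \_ (`]0, n%:R[%classic : set R)) x @[n --> \oo] --> l.
Proof.
move=> x0; apply: cvg_trans; apply: near_eq_cvg.
exists (Num.bound x).+1 => // n /= xn; rewrite patchE ifT// inE/= in_itv/= x0/=.
by rewrite (lt_trans (archi_boundP (ltW x0)))// ltr_nat.
Qed.

Lemma measurable_patch (F : R -> R) (n : nat) : measurable_fun hl F ->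
  measurable_fun hl (F \_ (`]0, n%:R[%classic : set R)).
Proof.
move=> mF; apply/measurable_restrict => //.
by apply: (@measurable_funS _ _ _ _ hl) => // x [].
Qed.

(** Fatou's lemma turns the uniform bound of [part_energy] into square integrability of the
    pointwise limit A / phi. *)
Lemma tail_energy f : rL2 hl f -> rL2 hl (fun x => tail f x * (phi x)^-1).
Proof.
move=> Lf.
have uc : cont0 (fun x => (phi x)^-1) by apply: cont0V => //; exact: phi_cont.
have mE : measurable_fun hl (fun x => tail f x * (phi x)^-1).
  exact: (cont0_measurable (cont0M (tail_cont Lf) uc)).
split=> //.
pose u (n : nat) := (fun x => part f n x ^+ 2 * phi x ^- 2) \_ (`]0, n%:R[%classic : set R).
have pc n : cont0 (fun x => part f n x ^+ 2 * phi x ^- 2).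
  apply: cont0M; last exact: phiVn_cont.
  have pc1 := AC_cont (part_AC n Lf).
  by apply: (@cont0_ext _ (fun x => part f n x * part f n x)) => //; exact: cont0M.
have mu_ n : measurable_fun hl (fun x => (u n x)%:E).
  by apply/measurable_EFinP; apply: measurable_patch; exact: cont0_measurable.
have u0 n x : 0 <= u n x.
  rewrite /u patchE; case: ifP => // _; apply: mulr_ge0; [exact: sqr_ge0|exact: phiV_ge0].
have u0' n x : hl x -> (0 <= (u n x)%:E)%E by move=> _; rewrite lee_fin.
have ui n : intg hl (u n).
  have := locint_cont0 (pc n) n%:R.
  have E : `]0, n%:R[%classic = hl `&` (`]0, n%:R[%classic : set R).
    apply/seteqP; split => x /=; rewrite half_lineE in_itv/=; last by case.
    by move=> h; split => //; case/andP: h.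
  rewrite [X in mu.-integrable X _](_ : _ = hl `&` (`]0, n%:R[%classic : set R)); last by rewrite -E.
  by move=> H; rewrite /u -restrict_EFin; apply/integrable_restrict.
have fat := fatou mu mhL mu_ u0'.
have C : (limn_einf (fun n => \int[mu]_(x in hl) (u n x)%:E) <=
   ((1 + M) * \int[mu]_(x in hl) (f x ^+ 2))%:E)%E.
  apply: limn_einf_le => n; have fj := integrable_fin_num mhL (ui n).
  rewrite -(fineK fj) lee_fin -/(Rintegral mu hl (u n)) Rintegral_trunc.
  exact: part_energy.
apply/integrableP; split; first by apply/measurable_EFinP; exact: measurable_sqr.
apply: le_lt_trans (le_lt_trans (le_trans fat C) (ltry _)).
rewrite le_eqVlt; apply/orP; left; apply/eqP; apply: eq_integral => x.
rewrite inE half_lineE => x0.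
have ul : (fun n => (u n x)%:E) @ \oo --> ((tail f x * (phi x)^-1) ^+ 2)%:E.
  apply/cvg_EFin; first exact: nearW.
  rewrite exprMn exprVn.
  apply: (@patch_cvg (fun n x => part f n x ^+ 2 * phi x ^- 2)) => //.
  apply: cvgM; last exact: cvg_cst.
  exact: (cvgM (part_cvg (x := x) Lf) (part_cvg (x := x) Lf)).
by rewrite (cvg_limn_einf_sup ul).1 /= ger0_norm// sqr_ge0.
Qed.

(** The tail of |f| dominates all truncations at once, and since |f| is again in L^2 its own energy
    is finite. This feeds the dominated convergence in [green_form]. *)
Lemma part_le f n x : rL2 hl f -> 0 <= x <= n%:R ->
  `|part f n x| <= tail (fun y => `|f y|) x.
Proof.
move=> Lf /andP[x0 xn]; have Fi := phif_locint Lf.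
rewrite (le_trans (prim_abs Fi x0 xn))// /tail.
have E t : 0 < t -> `|phi t * f t| = phi t * `|f t|.
  by move=> t0; rewrite normrM gtr0_norm// phi_gt0// ltW.
have pE z : prim (fun t => `|phi t * f t|) z = prim (fun t => phi t * `|f t|) z.
  by apply: eq_prim => t /andP[t0 _]; exact: E.
rewrite !pE lerD2r; apply: prim_le_half => //.
  by apply: phif_int; exact: rL2_abs.
by move=> t t0; rewrite mulr_ge0// ltW// phi_gt0// ltW.
Qed.

Theorem green_form f1 f2 : rL2 hl f1 -> rL2 hl f2 ->
  intg hl (fun x => tail f1 x * tail f2 x * phi x ^- 2) /\
  \int[mu]_(x in hl) (f1 x * (phi x * quot f2 x)) =
  \int[mu]_(x in hl) (tail f1 x * tail f2 x * phi x ^- 2).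
Proof.
move=> L1 L2.
have La := rL2_abs mh L1; have Ea := rL2_abs mh (tail_energy La).
have E1 := tail_energy L1; have E2 := tail_energy L2.
have ii : intg hl (fun x => tail f1 x * tail f2 x * phi x ^- 2).
  have := rL2_M mh E1 E2; congr (is_true (mu.-integrable _ _)).
  by apply/funext => x /=; rewrite -exprVn; congr EFin; ring.
split=> //.
have c1 := prim_cvgn (rL2_M mh L1 (G_L2 L2)).
apply: (cvg_unique _ c1) => //.
pose F n x := part f1 n x * (tail f2 x * phi x ^- 2).
rewrite (_ : (fun n : nat => _) = (fun n : nat =>
   \int[mu]_(x in hl) (F n \_ (`]0, n%:R[%classic : set R)) x)); last first.
  by apply/funext => n; rewrite Rintegral_trunc form_part.
have Fc n : cont0 (F n).
  apply: cont0M; first exact: AC_cont (part_AC n L1).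
  by apply: cont0M; [exact: tail_cont|exact: phiVn_cont].
(* The dominating function is a product of two square integrable functions, by [tail_energy] for
   |f1| and for f2. *)
apply: (@Rdominated_cvg _ _ _ (fun x => `|tail (fun y => `|f1 y|) x * (phi x)^-1| *
    `|tail f2 x * (phi x)^-1|)).
- by move=> n; apply: measurable_patch; exact: cont0_measurable.
- by case/integrableP : ii => /measurable_EFinP.
- move=> x; rewrite half_lineE => x0; apply: patch_cvg => //.
  rewrite -mulrA; apply: cvgM; last exact: cvg_cst.
  exact: part_cvg.
- by apply: rL2_M => //; exact: rL2_abs.
- move=> n x; rewrite half_lineE => x0; rewrite patchE; case: ifPn => [|_]; last first.
    by rewrite normr0 mulr_ge0.
  rewrite inE/= in_itv/= => /andP[_ xn].
  have px : 0 < (phi x)^-1 by rewrite invr_gt0 phi_gt0// ltW.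
  rewrite /F !normrM -exprVn normrX (gtr0_norm px).
  rewrite [leRHS](_ : _ = `|tail (fun y => `|f1 y|) x| * (`|tail f2 x| * (phi x)^-1 ^+ 2)); last by ring.
  apply: ler_wpM2r; first by rewrite mulr_ge0// sqr_ge0.
  apply: le_trans (ler_norm _).
  by apply: part_le => //; rewrite !ltW.
Qed.

End Form.
End GreenKernel.

(** * Complex square integrable functions and weak derivatives *)

Local Notation Re := complex.Re.
Local Notation Im := complex.Im.

Section ComplexParts.
Context {R : rcfType}.
Implicit Types (a b z : R[i]) (k : R).

Lemma cReM a b : Re (a * b) = Re a * Re b - Im a * Im b.
Proof. by case: a b => ? ? [? ?]. Qed.

Lemma cImM a b : Im (a * b) = Re a * Im b + Im a * Re b.
Proof. by case: a b => ? ? [? ?]. Qed.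

Lemma ReD a b : Re (a + b) = Re a + Re b. Proof. by case: a b => ? ? [? ?]. Qed.
Lemma ImD a b : Im (a + b) = Im a + Im b. Proof. by case: a b => ? ? [? ?]. Qed.
Lemma ReN a : Re (- a) = - Re a. Proof. by case: a. Qed.
Lemma ImN a : Im (- a) = - Im a. Proof. by case: a. Qed.
Lemma ReJ a : Re (conjc a) = Re a. Proof. by case: a. Qed.
Lemma ImJ a : Im (conjc a) = - Im a. Proof. by case: a. Qed.

Lemma ReZ k z : Re (k%:C * z) = k * Re z.
Proof. by rewrite cReM /= mul0r subr0. Qed.

Lemma ImZ k z : Im (k%:C * z) = k * Im z.
Proof. by rewrite cImM /= mul0r addr0. Qed.

Lemma complex_ext a b : Re a = Re b -> Im a = Im b -> a = b.
Proof. by case: a b => ? ? [? ?] /= -> ->. Qed.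

Lemma normc_le_parts z : `|z| <= (`|Re z| + `|Im z|)%:C.
Proof.
rewrite normc_def lecR.
have -> : `|Re z| + `|Im z| = Num.sqrt ((`|Re z| + `|Im z|) ^+ 2).
  by rewrite sqrtr_sqr [RHS]ger0_norm// addr_ge0.
rewrite ler_wsqrtr//.
rewrite sqrrD !real_normK ?num_real// -addrA lerD2l lerDr mulrn_wge0//.
Qed.

Lemma Re_le_normc z : `|Re z|%:C <= `|z|.
Proof. exact: normc_ge_Re. Qed.

Lemma Im_le_normc z : `|Im z|%:C <= `|z|.
Proof. by rewrite normc_def lecR -sqrtr_sqr ler_wsqrtr// lerDr sqr_ge0. Qed.

End ComplexParts.

Section ComplexFunctions.
Context {R : realType}.
Local Notation C := R[i].
Local Notation mu := (@lebesgue_measure R).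
Local Notation hl := (@half_line R).
Implicit Types (A : set R) (f g h u v : R -> C).

Let mh : measurable hl := @measurable_half_line R.
Let mhL := @lebesgue_measurable_half_line R.

Definition re f : R -> R := fun x => Re (f x).
Definition im f : R -> R := fun x => Im (f x).

Lemma L2onP A f : measurable A -> L2on A f <-> rL2 A (re f) /\ rL2 A (im f).
Proof.
move=> mA; split.
  move=> [mr mi fin].
  have mS : measurable_fun A (fun x => re f x ^+ 2 + im f x ^+ 2).
    by apply: measurable_funD; exact: measurable_sqr.
  have Si : intg A (fun x => re f x ^+ 2 + im f x ^+ 2).
    apply/integrableP; split; first exact/measurable_EFinP.
    apply: le_lt_trans fin; rewrite le_eqVlt; apply/orP; left; apply/eqP.
    by apply: eq_integral => x _ /=; rewrite ger0_norm// addr_ge0// sqr_ge0.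
  split; split=> //; apply: intg_le Si => //.
  - exact: measurable_sqr.
  - by move=> x _; rewrite ger0_norm ?sqr_ge0// lerDl sqr_ge0.
  - exact: measurable_sqr.
  - by move=> x _; rewrite ger0_norm ?sqr_ge0// lerDr sqr_ge0.
move=> [[mr ri] [mi ii]]; split=> //.
have /integrableP[_] := intgD mA ri ii; apply: le_lt_trans.
rewrite le_eqVlt; apply/orP; left; apply/eqP.
by apply: eq_integral => x _ /=; rewrite ger0_norm// addr_ge0// sqr_ge0.
Qed.

Lemma L2P f : L2 f <-> rL2 hl (re f) /\ rL2 hl (im f).
Proof. exact: L2onP. Qed.

Lemma aeqP f g : aeq f g <-> ae_eq mu hl (re f) (re g) /\ ae_eq mu hl (im f) (im g).
Proof.
split=> [fg|[h1 h2]].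
  by split; apply: aeS fg => x H hx; rewrite /re /im H.
by apply: aeS2 h1 h2 => x H1 H2 hx; apply: complex_ext; [exact: H1|exact: H2].
Qed.

Lemma aeq_refl f : aeq f f. Proof. exact: ae_eq_refl. Qed.

Lemma aeq_sym f g : aeq f g -> aeq g f. Proof. exact: ae_eq_sym. Qed.

Lemma aeq_trans g f h : aeq f g -> aeq g h -> aeq f h. Proof. exact: ae_eq_trans. Qed.

Lemma eq_aeq f g : (forall x, 0 < x -> f x = g x) -> aeq f g.
Proof. by move=> fg; apply: aeW => x; rewrite half_lineE; exact: fg. Qed.

Lemma L2_ae f g : measurable_fun hl (re g) -> measurable_fun hl (im g) ->
  aeq f g -> L2 f -> L2 g.
Proof.
move=> mr mi /aeqP[h1 h2] /L2P[Lr Li]; apply/L2P; split.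
  exact: rL2_ae mh mr h1 Lr.
exact: rL2_ae mh mi h2 Li.
Qed.

Lemma rL2_locint (F : R -> R) : (forall a, 0 < a -> rL2 (`]0, a[%classic : set R) F) ->
  locint F.
Proof.
move=> LF a; have [a0|a0] := leP a 0.
  by rewrite set_itv_ge ?bnd_simp -?leNgt//; exact: integrable_set0.
have mI : measurable (`]0, a[%classic : set R) by exact: measurable_itv.
have L1 : rL2 (`]0, a[%classic : set R) (fun=> 1).
  split; first exact: measurable_cst.
  have := @locint_cont0 _ (fun=> 1) (cont0_cst 1) a; congr (is_true (mu.-integrable _ _)).
  by apply/funext => x /=; rewrite expr1n.
have := rL2_M mI (LF a a0) L1; congr (is_true (mu.-integrable _ _)).
by apply/funext => x /=; rewrite mulr1.
Qed.

Lemma L2loc_parts g : L2loc g <->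
  (forall a, 0 < a -> rL2 (`]0, a[%classic : set R) (re g)) /\
  (forall a, 0 < a -> rL2 (`]0, a[%classic : set R) (im g)).
Proof.
have mI a : measurable (`]0, a[%classic : set R) by exact: measurable_itv.
split=> [Lg|[Lr Li] a a0].
  by split=> a a0; have [] := (L2onP g (mI a)).1 (Lg a a0).
by apply/(L2onP g (mI a)); split; [exact: Lr|exact: Li].
Qed.

Lemma L2loc_measurable g : L2loc g ->
  measurable_fun hl (re g) /\ measurable_fun hl (im g).
Proof.
by move=> /L2loc_parts[Lr Li]; split; apply: measurable_half => a a0;
  [case: (Lr a a0)|case: (Li a a0)].
Qed.

Lemma L2_L2loc g : L2 g -> L2loc g.
Proof.
move=> /L2P[Lr Li]; apply/L2loc_parts; split=> a a0.
  by apply: rL2_S Lr => // x /=; rewrite half_lineE in_itv/= => /andP[].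
by apply: rL2_S Li => // x /=; rewrite half_lineE in_itv/= => /andP[].
Qed.

Lemma rL2_locM (F h : R -> R) : cont0 h ->
  (forall a, 0 < a -> rL2 (`]0, a[%classic : set R) F) ->
  forall a, 0 < a -> rL2 (`]0, a[%classic : set R) (fun x => F x * h x).
Proof.
move=> hc LF a a0; have [K K0 hK] := cont0_bounded a hc.
apply: (rL2_bounded_mul (K := K)); [exact: measurable_itv|..|exact: LF].
  by apply: measurable_itv0; exact: cont0_measurable.
by move=> x /=; rewrite in_itv/= => /andP[x0 xa]; apply: hK; rewrite !ltW.
Qed.

Lemma cont0_rL2loc (h : R -> R) : cont0 h ->
  forall a, 0 < a -> rL2 (`]0, a[%classic : set R) h.
Proof.
move=> hc a a0; split; first by apply: measurable_itv0; exact: cont0_measurable.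
exact: (locint_cont0 (cont0M hc hc) a).
Qed.

Lemma has_wderivP f g : has_wderiv f g <->
  [/\ L2loc g, abs_cont (re f) (re g) & abs_cont (im f) (im g)].
Proof.
split=> [[Lg fg]|[Lg [_ fr] [_ fi]]].
  have [Lr Li] := (L2loc_parts g).1 Lg.
  split=> //; split; try exact: rL2_locint.
    by move=> x x0; rewrite /re fg// ReD.
  by move=> x x0; rewrite /im fg// ImD.
split=> // x x0; apply: complex_ext; rewrite ?ReD ?ImD; [exact: fr|exact: fi].
Qed.

Lemma has_wderiv_Wloc f g : has_wderiv f g -> Wloc f.
Proof.
move=> fg; split; last by exists g.
have /has_wderivP[_ fr fi] := fg.
apply/(@within_cont0P R R[i] R[i]^o) => x x0 [e e'] /=.
(* In the order of [R[i]] a positive number has zero imaginary part. *)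
rewrite ltcE /= => /andP[/eqP-> e0].
have e2 : 0 < e / 2 by exact: divr_gt0.
have [d1 d10 h1] := AC_cont fr x0 e2; have [d2 d20 h2] := AC_cont fi x0 e2.
exists (Num.min d1 d2); first by rewrite lt_min d10.
move=> y y0; rewrite lt_min => /andP[y1 y2].
apply: (le_lt_trans (normc_le_parts (f y - f x))).
rewrite ltcR (splitr e) ltrD// ?ReD ?ReN ?ImD ?ImN; [exact: h1|exact: h2].
Qed.

Lemma Wloc_cont0 f : Wloc f -> cont0 (re f) /\ cont0 (im f).
Proof.
by move=> [_ [g /has_wderivP[_ fr fi]]]; split; [exact: AC_cont fr|exact: AC_cont fi].
Qed.

Lemma cont0_ae_eq (F G : R -> R) : cont0 F -> cont0 G -> ae_eq mu hl F G ->
  forall x, 0 <= x -> F x = G x.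
Proof.
move=> Fc Gc FG x x0; apply/eqP; rewrite -subr_eq0; apply/eqP.
apply: (@cont0_ae_eq0 _ (fun x => F x - G x)) => //.
  by apply: cont0D => //; exact: cont0N.
by apply: aeS FG => y H hy; rewrite H// subrr.
Qed.

Lemma Wloc_aeq u v : Wloc u -> Wloc v -> aeq u v -> forall x, 0 <= x -> u x = v x.
Proof.
move=> /Wloc_cont0[ur ui] /Wloc_cont0[vr vi] /aeqP[h1 h2] x x0.
by apply: complex_ext; [exact: (cont0_ae_eq ur vr h1)|exact: (cont0_ae_eq ui vi h2)].
Qed.

(** The choice behind [wderiv] may use another representative u' of f; u and u' are continuous and
    agree almost everywhere, hence on [0, oo), and [AC_uniq] compares their densities. *)
Lemma wderiv_uniq f u g : aeq f u -> has_wderiv u g ->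
  aeq (wderiv f) g /\ L2loc (wderiv f).
Proof.
move=> fu ug.
have [u' [Wu' fu' ug']] : [set d | exists u, [/\ Wloc u, aeq f u & has_wderiv u d]] (wderiv f).
  by apply: xgetPex; exists g, u; split=> //; exact: has_wderiv_Wloc ug.
have uu' := Wloc_aeq Wu' (has_wderiv_Wloc ug) (aeq_trans (aeq_sym fu') fu).
have /has_wderivP[Ld ur' ui'] := ug'; have /has_wderivP[_ ur ui] := ug.
split=> //; apply/aeqP; split.
  by apply: AC_uniq ur' ur => x x0; rewrite /re uu'.
by apply: AC_uniq ui' ui => x x0; rewrite /im uu'.
Qed.

Lemma wderiv_W f g : has_wderiv f g -> aeq (wderiv f) g /\ L2loc (wderiv f).
Proof. by apply: wderiv_uniq; exact: aeq_refl. Qed.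

Definition dotr (F G : R -> R) := \int[mu]_(x in hl) (F x * G x).

Lemma dotrC F G : dotr F G = dotr G F.
Proof. by apply: eq_Rintegral => x _; rewrite mulrC. Qed.

Lemma Rintegral3 (F G H : R -> R) (p q : R) : intg hl F -> intg hl G -> intg hl H ->
  \int[mu]_(x in hl) (p * F x + q * G x + H x) =
  p * \int[mu]_(x in hl) F x + q * \int[mu]_(x in hl) G x + \int[mu]_(x in hl) H x.
Proof.
move=> Fi Gi Hi.
have pF : intg hl (fun x => p * F x) by exact: intgZ.
have qG : intg hl (fun x => q * G x) by exact: intgZ.
rewrite RintegralD//; last exact: intgD.
by rewrite RintegralD// !RintegralZl.
Qed.

Lemma dotr3 (F G H K : R -> R) p q : rL2 hl F -> rL2 hl G -> rL2 hl H -> rL2 hl K ->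
  dotr (fun x => p * F x + q * G x + H x) K = p * dotr F K + q * dotr G K + dotr H K.
Proof.
move=> LF LG LH LK; rewrite /dotr -Rintegral3; try exact: rL2_M.
by apply: eq_Rintegral => x _; ring.
Qed.

Lemma dotr_ge0 F : 0 <= dotr F F.
Proof. by apply: Rintegral_ge0 => x _; rewrite -expr2 sqr_ge0. Qed.

Lemma dotr_eq0 F : rL2 hl F -> dotr F F = 0 <-> ae_eq mu hl F (fun=> 0).
Proof.
move=> [mF Fi].
have mF2 : measurable_fun hl (fun x => (F x ^+ 2)%:E).
  by apply/measurable_EFinP; exact: measurable_sqr.
have E : (\int[mu]_(x in hl) `|(F x ^+ 2)%:E|)%E = (dotr F F)%:E.
  rewrite /dotr /Rintegral fineK; last exact: (integrable_fin_num mhL Fi).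
  by apply: eq_integral => x _ /=; rewrite ger0_norm// sqr_ge0.
have := ae_eq_integral_abs mu mhL mF2; rewrite E => H; split=> [F0|F0].
  have /H h : (dotr F F)%:E = 0%E by rewrite F0.
  by apply: aeS h => x h hx; have [/eqP] := h hx; rewrite sqrf_eq0 => /eqP.
have [] // : (dotr F F)%:E = 0%E; apply/H.
by apply: aeS F0 => x h hx; rewrite h// expr0n.
Qed.

Lemma Rintegral_innerD (F G H K : R -> R) (s : R) : rL2 hl F -> rL2 hl G ->
  rL2 hl H -> rL2 hl K ->
  \int[mu]_(x in hl) (F x * G x + s * (H x * K x)) = dotr F G + s * dotr H K.
Proof.
move=> LF LG LH LK; have i1 := rL2_M mh LF LG; have i2 := rL2_M mh LH LK.
by rewrite RintegralD// ?RintegralZl//; exact: intgZ.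
Qed.

Lemma innerE f g : L2 f -> L2 g -> inner f g =
  (dotr (re f) (re g) + dotr (im f) (im g)) +i*
  (dotr (im f) (re g) - dotr (re f) (im g)).
Proof.
move=> /L2P[fr fi] /L2P[gr gi]; rewrite /inner /cintegral.
have -> : \int[mu]_(x in hl) Re (f x * conjc (g x)) =
    dotr (re f) (re g) + dotr (im f) (im g).
  rewrite -[X in _ + X]mul1r -Rintegral_innerD//; apply: eq_Rintegral => x _.
  by rewrite cReM ReJ ImJ /re /im; ring.
have -> : \int[mu]_(x in hl) Im (f x * conjc (g x)) =
    dotr (im f) (re g) - dotr (re f) (im g).
  rewrite -mulN1r -Rintegral_innerD//; apply: eq_Rintegral => x _.
  by rewrite cImM ReJ ImJ /re /im; ring.
by [].
Qed.

Local Notation V := (R -> C^o).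

Lemma L2_lin (a : C) (u v : V) : L2 u -> L2 v -> L2 (a *: u + v).
Proof.
move=> /L2P[ur ui] /L2P[vr vi]; apply/L2P; split.
  rewrite (_ : re _ = fun x => Re a * re u x + - Im a * im u x + re v x).
    by apply: rL2_D => //; apply: rL2_D => //; exact: rL2_Z.
  by apply/funext => x; rewrite /re ReD cReM /im mulNr.
rewrite (_ : im _ = fun x => Re a * im u x + Im a * re u x + im v x).
  by apply: rL2_D => //; apply: rL2_D => //; exact: rL2_Z.
by apply/funext => x; rewrite /im ImD cImM.
Qed.

Lemma L2_0 : L2 (0 : V).
Proof. by apply/L2P; split; exact: rL2_0. Qed.

Lemma inner_lin (a : C) (u v w : V) : L2 u -> L2 v -> L2 w ->
  inner (a *: u + v) w = a * inner u w + inner v w.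
Proof.
move=> Lu Lv Lw; have La := L2_lin a Lu Lv.
rewrite !innerE//; move: Lu Lv Lw => /L2P[ur ui] /L2P[vr vi] /L2P[wr wi].
have -> : re (a *: u + v) = fun x => Re a * re u x + - Im a * im u x + re v x.
  by apply/funext => x; rewrite /re ReD cReM /im mulNr.
have -> : im (a *: u + v) = fun x => Re a * im u x + Im a * re u x + im v x.
  by apply/funext => x; rewrite /im ImD cImM.
by rewrite !dotr3//; apply: complex_ext; rewrite ?ReD ?ImD ?cReM ?cImM /=; ring.
Qed.

Lemma inner_conj (u v : V) : L2 u -> L2 v -> inner v u = conjc (inner u v).
Proof.
move=> Lu Lv; rewrite !innerE//; apply: complex_ext => /=.
  by rewrite (dotrC (re v)) (dotrC (im v)).
by rewrite (dotrC (re v)) (dotrC (im v)) opprB.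
Qed.

Lemma nsqE (u : V) : L2 u ->
  nsq inner u = dotr (re u) (re u) + dotr (im u) (im u).
Proof. by move=> Lu; rewrite /nsq /rip innerE. Qed.

Lemma inner_ge0 (u : V) : L2 u -> 0 <= Re (inner u u).
Proof. by move=> Lu; rewrite innerE//= addr_ge0// dotr_ge0. Qed.

Lemma L2_B (u v : V) : L2 u -> L2 v -> L2 (u - v).
Proof. exact: (SB L2_0 L2_lin). Qed.

Lemma nsq_eq0 (u : V) : L2 u -> nsq inner u = 0 <-> aeq u (fun=> 0).
Proof.
move=> Lu; rewrite nsqE//; have [ur ui] := (L2P u).1 Lu; split.
  move=> /eqP; rewrite paddr_eq0 ?dotr_ge0// => /andP[/eqP h1 /eqP h2].
  by apply/aeqP; split; [exact/(dotr_eq0 ur).1|exact/(dotr_eq0 ui).1].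
move=> /aeqP[h1 h2].
by rewrite (dotr_eq0 ur).2 ?(dotr_eq0 ui).2 ?addr0.
Qed.

Lemma nsqB_eq0 (u v : V) : L2 u -> L2 v -> nsq inner (u - v) = 0 <-> aeq u v.
Proof.
move=> Lu Lv; rewrite nsq_eq0; last exact: L2_B.
split=> h; apply: aeS h => x h hx.
  by apply/eqP; rewrite -subr_eq0; apply/eqP; exact: h.
by rewrite /GRing.add /GRing.opp /= h// subrr.
Qed.

Lemma L2_complete (u : nat -> V) : (forall n, L2 (u n)) -> cauchy_seq inner u ->
  exists2 v, L2 v & cvg_seq inner u v.
Proof.
move=> Lu uc.
have nE (v w : V) : L2 v -> L2 w -> nsq inner (v - w) =
    \int[mu]_(x in hl) ((re v x - re w x) ^+ 2) +
    \int[mu]_(x in hl) ((im v x - im w x) ^+ 2).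
  move=> Lv Lw; rewrite nsqE; last exact: L2_B.
  by congr (_ + _); apply: eq_Rintegral => x _; rewrite expr2 /re /im ?ReD ?ReN ?ImD ?ImN.
have I0 (F : R -> R) : 0 <= \int[mu]_(x in hl) (F x ^+ 2).
  by apply: Rintegral_ge0 => x _; exact: sqr_ge0.
have uc2 e : 0 < e -> exists N : nat, forall m n, (N <= m)%N -> (N <= n)%N ->
    nsq inner (u m - u n) < e.
  move=> e0; have [|N hN] := uc (Num.sqrt e); first by rewrite sqrtr_gt0.
  exists N => m n Nm Nn.
  have H i j : (N <= j)%N -> (j <= i)%N -> nsq inner (u i - u j) < e.
    move=> Nj ji; have := hN i j Nj ji; rewrite /nrm ltr_sqrt//.
  have [mn|nm] := leqP n m; first exact: H.
  have := H n m Nm (ltnW nm); rewrite !nE//; congr (_ + _ < _);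
    by apply: eq_Rintegral => x _; ring.
have Lr n : rL2 hl (re (u n)) by have [] := (L2P (u n)).1 (Lu n).
have Li n : rL2 hl (im (u n)) by have [] := (L2P (u n)).1 (Lu n).
have [|gr Lgr hr] := rL2_complete Lr.
  move=> e e0; have [N hN] := uc2 e e0; exists N => m n Nm Nn.
  by apply: le_lt_trans (hN m n Nm Nn); rewrite nE// lerDl.
have [|gi Lgi hi] := rL2_complete Li.
  move=> e e0; have [N hN] := uc2 e e0; exists N => m n Nm Nn.
  by apply: le_lt_trans (hN m n Nm Nn); rewrite nE// lerDr.
have Lg : L2 (fun x => gr x +i* gi x) by apply/L2P.
exists (fun x => gr x +i* gi x) => // e e0.
have e2 : 0 < e ^+ 2 / 2 by rewrite divr_gt0// exprn_gt0.
have [N1 h1] := hr _ e2; have [N2 h2] := hi _ e2.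
exists (maxn N1 N2) => n; rewrite geq_max => /andP[n1 n2].
rewrite /nrm -[ltRHS]gtr0_norm// -sqrtr_sqr ltr_sqrt ?exprn_gt0// nE//.
by rewrite (splitr (e ^+ 2)) ltrD//; [exact: h1|exact: h2].
Qed.

End ComplexFunctions.

(** * The operator and its spectrum *)

Section MeasurableParts.
Context {R : realType}.
Local Notation mu := (@lebesgue_measure R).
Local Notation hl := (@half_line R).
Implicit Types f g : R -> R[i].

Let mh : measurable hl := @measurable_half_line R.

Lemma AC_wderiv f g h : has_wderiv f g -> aeq g h -> L2loc h -> has_wderiv f h.
Proof.
move=> /has_wderivP[_ fr fi] /aeqP[gr gi] Lh; have [mr mi] := L2loc_measurable Lh.
apply/has_wderivP; split=> //.
  by apply: AC_ae fr => // a; exact: measurable_itv0.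
by apply: AC_ae fi => // a; exact: measurable_itv0.
Qed.

Lemma wderiv_has f : Wloc f -> has_wderiv f (wderiv f).
Proof.
move=> [_ [g fg]]; have [h L] := wderiv_W fg.
exact: (AC_wderiv fg (aeq_sym h) L).
Qed.

Lemma has_wderivN f g : has_wderiv f g ->
  has_wderiv (fun x => - f x) (fun x => - g x).
Proof.
move=> /has_wderivP[/L2loc_parts[Lr Li] fr fi].
have rE (h : R -> R[i]) : re (fun x => - h x) = fun x => - re h x.
  by apply/funext => x; rewrite /re ReN.
have iE (h : R -> R[i]) : im (fun x => - h x) = fun x => - im h x.
  by apply/funext => x; rewrite /im ImN.
apply/has_wderivP; rewrite (rE f) (rE g) (iE f) (iE g).
split; [|exact: (AC_N fr)|exact: (AC_N fi)].
apply/L2loc_parts; rewrite (rE g) (iE g); split=> a a0.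
  by apply: rL2_N; [exact: measurable_itv|exact: Lr].
by apply: rL2_N; [exact: measurable_itv|exact: Li].
Qed.

Definition cmeas f := measurable_fun hl (re f) /\ measurable_fun hl (im f).

Lemma cmeasM f g : cmeas f -> cmeas g -> cmeas (fun x => f x * g x).
Proof.
move=> [fr fi] [gr gi]; split.
  rewrite (_ : re _ = fun x => re f x * re g x - im f x * im g x).
    by apply: measurable_funB; exact: measurable_funM.
  by apply/funext => x; rewrite /re cReM.
rewrite (_ : im _ = fun x => re f x * im g x + im f x * re g x).
  by apply: measurable_funD; exact: measurable_funM.
by apply/funext => x; rewrite /im cImM.
Qed.

Lemma cmeasB f g : cmeas f -> cmeas g -> cmeas (fun x => f x - g x).
Proof.
move=> [fr fi] [gr gi]; split.
  rewrite (_ : re _ = fun x => re f x - re g x); first exact: measurable_funB.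
  by apply/funext => x; rewrite /re ReD ReN.
rewrite (_ : im _ = fun x => im f x - im g x); first exact: measurable_funB.
by apply/funext => x; rewrite /im ImD ImN.
Qed.

Lemma cmeasJ f : cmeas f -> cmeas (fun x => conjc (f x)).
Proof.
move=> [fr fi]; split.
  by rewrite (_ : re _ = re f)//; apply/funext => x; rewrite /re ReJ.
rewrite (_ : im _ = fun x => - im f x); first exact: measurableT_comp.
by apply/funext => x; rewrite /im ImJ.
Qed.

Lemma cmeas_real (F : R -> R) : measurable_fun hl F -> cmeas (fun x => (F x)%:C).
Proof. by move=> mF; split=> //; exact: measurable_cst. Qed.

Lemma cmeas_wderiv f : Wloc f -> cmeas (wderiv f).
Proof. by move=> /wderiv_has[L _]; exact: L2loc_measurable. Qed.

Lemma cmeas_Wloc f : Wloc f -> cmeas f.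
Proof. by move=> /Wloc_cont0[fr fi]; split; exact: cont0_measurable. Qed.

Lemma cintegral_aeq f g : cmeas f -> aeq f g -> cintegrable hl g ->
  cintegrable hl f /\ cintegral hl f = cintegral hl g.
Proof.
move=> [fr fi] /aeqP[hr hi] [gr gi].
have [hr' hi'] := (ae_eq_sym hr, ae_eq_sym hi).
split; first by split; [exact: (intg_ae mh fr hr' gr)|exact: (intg_ae mh fi hi' gi)].
apply: complex_ext => /=.
  by rewrite (ae_Rintegral mh gr fr hr').
by rewrite (ae_Rintegral mh gi fi hi').
Qed.

Lemma dotr_ae (F F' G G' : R -> R) : rL2 hl F -> rL2 hl F' -> rL2 hl G -> rL2 hl G' ->
  ae_eq mu hl F F' -> ae_eq mu hl G G' -> dotr F G = dotr F' G'.
Proof.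
move=> LF LF' LG LG' h1 h2; apply: ae_Rintegral => //; first exact: rL2_M.
  by apply: intg_measurable; exact: rL2_M.
by apply: aeS2 h1 h2 => x H1 H2 hx; rewrite H1// H2.
Qed.

Lemma inner_aeq f f' g g' : L2 f -> L2 f' -> L2 g -> L2 g' -> aeq f f' -> aeq g g' ->
  inner f g = inner f' g'.
Proof.
move=> Lf Lf' Lg Lg' /aeqP[fr fi] /aeqP[gr gi]; rewrite !innerE//.
have [[? ?] [? ?]] := ((L2P f).1 Lf, (L2P f').1 Lf').
have [[? ?] [? ?]] := ((L2P g).1 Lg, (L2P g').1 Lg').
by rewrite (dotr_ae _ _ _ _ fr gr)// (dotr_ae _ _ _ _ fi gi)//
  (dotr_ae _ _ _ _ fi gr)// (dotr_ae _ _ _ _ fr gi).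
Qed.

Lemma toC_V (k : R) : (k%:C)^-1 = (k^-1)%:C.
Proof. by rewrite fmorphV. Qed.

Lemma toC_Vn (k : R) : (k%:C) ^- 2 = (k ^- 2)%:C.
Proof. by rewrite -rmorphXn fmorphV. Qed.

Lemma cvg0P (F : R -> R[i]) : (F : R -> R[i]^o) @ +oo --> (0 : R[i]^o) <->
  (forall e : R, 0 < e -> exists a : R, forall x, a <= x -> `|F x| <= e%:C).
Proof.
split.
  move=> /cvgrPdist_lt H e e0; have e0' : 0 < e%:C :> R[i] by rewrite ltcR.
  have [M [_ hM]] := H _ e0'; exists (M + 1) => x Mx.
  have := hM x (lt_le_trans _ Mx); rewrite sub0r normrN ltrDl => h.
  by apply: ltW; exact: h.
move=> H; apply/cvgrPdist_lt => -[e e'] /=; rewrite ltcE /= => /andP[/eqP-> e0].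
have e2 : 0 < e / 2 by exact: divr_gt0.
have [a ha] := H _ e2; exists a; split; first exact: num_real.
move=> x ax; rewrite sub0r normrN; apply: le_lt_trans (ha x (ltW ax)) _.
by rewrite ltcR ltr_pdivrMr// ltr_pMr// ltr1n.
Qed.

End MeasurableParts.

(** * The Green operator on complex functions, its inverse and the domain *)

Section GreenOperator.
Context {R : realType} (phi : R -> R).
Context (phi_L2 : L2 (toC phi)) (phi_W : Wloc (toC phi))
  (phi_gt0 : forall x : R, 0 <= x -> 0 < phi x)
  (G_bounded : kernel_of_bounded_op (green phi)).
Local Notation C := R[i].
Local Notation mu := (@lebesgue_measure R).
Local Notation hl := (@half_line R).
Local Notation V := (R -> C^o).
Local Notation phiC := (toC phi).
Local Notation G := (integral_op (green phi)).

Let mh : measurable hl := @measurable_half_line R.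

(** The chosen weak derivative of the real function phi is complex valued and real only almost
    everywhere; its real part is a density on which real calculus applies. *)
Definition phi' := re (wderiv phiC).

Lemma phi_AC : abs_cont phi phi'.
Proof. by have /has_wderivP[_ h _] := wderiv_has phi_W. Qed.

Lemma wderiv_phi_im : ae_eq mu hl (im (wderiv phiC)) (fun=> 0).
Proof.
have /has_wderivP[_ _ h] := wderiv_has phi_W.
by apply: AC_uniq h (AC_cst 0) => x _.
Qed.

Lemma phi_rL2 : rL2 hl phi.
Proof. by have [h _] := (L2P _).1 phi_L2. Qed.

Lemma re_G f x : L2 f -> 0 <= x -> re (G f) x = phi x * quot phi (re f) x.
Proof.
move=> /L2P[fr fi] x0; rewrite -(green_repr phi_AC phi_gt0 phi_rL2 fr x0).2.
by apply: eq_Rintegral => y _; rewrite ReZ.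
Qed.

Lemma im_G f x : L2 f -> 0 <= x -> im (G f) x = phi x * quot phi (im f) x.
Proof.
move=> /L2P[fr fi] x0; rewrite -(green_repr phi_AC phi_gt0 phi_rL2 fi x0).2.
by apply: eq_Rintegral => y _; rewrite ImZ.
Qed.

(** For negative x the integral defining psi(x) is over an empty interval. Together with
    integrability at every x >= 0 this makes [G_lin] an identity of functions, as the abstract
    lemmas require. *)
Lemma G_neg f x : x < 0 -> G f x = 0.
Proof.
move=> x0; have k0 y : hl y -> green phi x y = 0.
  rewrite half_lineE => y0; rewrite /green ifT; last by rewrite ltW// (lt_trans x0).
  rewrite /psi set_itv_ge ?Rintegral_set0 ?mulr0 ?mul0r//.
  by rewrite bnd_simp -leNgt ltW.
have z : \int[mu]_(y in hl) (0 : R) = 0 by rewrite Rintegral_cst// mul0r.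
apply: complex_ext => /=; rewrite -[RHS]z; apply: eq_Rintegral => y; rewrite inE => hy.
  by rewrite ReZ k0// mul0r.
by rewrite ImZ k0// mul0r.
Qed.

Lemma G_lin (a : C) (u v : V) : L2 u -> L2 v ->
  G (a *: u + v) = (a *: (G u : V) + (G v : V) : V).
Proof.
move=> Lu Lv; apply/funext => x; have [x0|x0] := ltP x 0.
  rewrite -[RHS]/(a * G u x + G v x).
  by rewrite !G_neg// mulr0 addr0.
have [ur ui] := (L2P u).1 Lu; have [vr vi] := (L2P v).1 Lv.
have [i1 _] := green_repr phi_AC phi_gt0 phi_rL2 ur x0.
have [i2 _] := green_repr phi_AC phi_gt0 phi_rL2 ui x0.
have [i3 _] := green_repr phi_AC phi_gt0 phi_rL2 vr x0.
have [i4 _] := green_repr phi_AC phi_gt0 phi_rL2 vi x0.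
have rE f : Re (G f x) = \int[mu]_(y in hl) (green phi x y * re f y).
  by apply: eq_Rintegral => y _; rewrite ReZ.
have iE f : Im (G f x) = \int[mu]_(y in hl) (green phi x y * im f y).
  by apply: eq_Rintegral => y _; rewrite ImZ.
rewrite -[RHS]/(a * G u x + G v x).
apply: complex_ext.
  rewrite ReD cReM !rE !iE -mulNr -Rintegral3//; apply: eq_Rintegral => y _.
  by rewrite /re /im ReD cReM; ring.
rewrite ImD cImM !rE !iE -Rintegral3//; apply: eq_Rintegral => y _.
by rewrite /re /im ImD cImM; ring.
Qed.

Lemma G_L2 f : L2 f -> L2 (G f).
Proof. by have [_ [h _ _]] := G_bounded; exact: h. Qed.

Lemma rG_ae_re f : L2 f -> ae_eq mu hl (re (G f)) (fun x => phi x * quot phi (re f) x).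
Proof. by move=> Lf; apply: aeW => x; rewrite half_lineE => /ltW x0; exact: re_G. Qed.

Lemma rG_ae_im f : L2 f -> ae_eq mu hl (im (G f)) (fun x => phi x * quot phi (im f) x).
Proof. by move=> Lf; apply: aeW => x; rewrite half_lineE => /ltW x0; exact: im_G. Qed.

Lemma phi_quot_cont F : rL2 hl F -> cont0 (fun x => phi x * quot phi F x).
Proof.
move=> LF; apply: cont0M; first exact: (AC_cont phi_AC).
exact: (AC_cont (quot_AC phi_AC phi_gt0 phi_rL2 LF)).
Qed.

Lemma toC_L2 F : rL2 hl F -> L2 (toC F).
Proof. by move=> LF; apply/L2P; split=> //; exact: rL2_0. Qed.

Lemma rG_L2 F : rL2 hl F -> rL2 hl (fun x => phi x * quot phi F x).
Proof.
move=> LF; have L := toC_L2 LF; have /L2P[h _] := G_L2 L.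
apply: rL2_ae mh _ (rG_ae_re L) h.
exact: (cont0_measurable (phi_quot_cont LF)).
Qed.

Lemma rG_bound : exists2 M : R, 0 <= M & forall F, rL2 hl F ->
  \int[mu]_(x in hl) ((phi x * quot phi F x) ^+ 2) <= M * \int[mu]_(x in hl) (F x ^+ 2).
Proof.
(* The operator bound carries no sign, hence the square here and the absolute value below. *)
have [_ [_ _ [M hM]]] := G_bounded; exists (M ^+ 2); first exact: sqr_ge0.
move=> F LF; have L := toC_L2 LF; have LG := G_L2 L.
have /L2P[Gr Gi] := LG.
have h1 : \int[mu]_(x in hl) ((phi x * quot phi F x) ^+ 2) <= nsq inner (G (toC F)).
  rewrite nsqE//; apply: (@le_trans _ _ (dotr (re (G (toC F))) (re (G (toC F))))).
    rewrite le_eqVlt; apply/orP; left; apply/eqP.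
    by rewrite (dotr_ae Gr (rG_L2 LF) Gr (rG_L2 LF) (rG_ae_re L) (rG_ae_re L)).
  by rewrite lerDl dotr_ge0.
have h2 : nsq inner (toC F) = \int[mu]_(x in hl) (F x ^+ 2).
  rewrite nsqE// (dotr_eq0 (rL2_0 mh)).2 ?addr0//.
  exact: ae_eq_refl.
apply: (le_trans h1); rewrite -h2.
have n1 := @nsq_ge0 _ _ _ _ (@inner_ge0 R) _ LG.
have n2 := @nsq_ge0 _ _ _ _ (@inner_ge0 R) _ L.
have := hM _ L; rewrite -/(nrm inner (G (toC F))) -/(nrm inner (toC F)) => h.
have h' : nrm inner (G (toC F)) <= `|M| * nrm inner (toC F).
  by apply: (le_trans h); apply: ler_wpM2r; [exact: sqrtr_ge0|exact: ler_norm].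
rewrite -(sqr_sqrtr n1) -(sqr_sqrtr n2) -(real_normK (num_real M)) -exprMn.
by rewrite ler_pXn2r ?nnegrE ?mulr_ge0// ?sqrtr_ge0.
Qed.

(** The weighted Dirichlet form: since A = phi^2 q', the integrand is q_F' q_K' phi^2. *)
Definition energy F K := \int[mu]_(x in hl) (tail phi F x * tail phi K x * phi x ^- 2).

Lemma energyP F K : rL2 hl F -> rL2 hl K ->
  intg hl (fun x => tail phi F x * tail phi K x * phi x ^- 2) /\
  dotr F (fun x => phi x * quot phi K x) = energy F K.
Proof.
move=> LF LK; have [M M0 hM] := rG_bound.
exact: (green_form phi_AC phi_gt0 phi_rL2 (@rG_L2) M0 hM LF LK).
Qed.

Lemma energyC F K : energy F K = energy K F.
Proof. by apply: eq_Rintegral => x _; rewrite (mulrC (tail phi F x)). Qed.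

Lemma energy_ge0 F : 0 <= energy F F.
Proof.
by apply: Rintegral_ge0 => x _; rewrite -expr2 mulr_ge0 ?sqr_ge0// invr_ge0 sqr_ge0.
Qed.

Lemma inner_G u v : L2 u -> L2 v -> inner u (G v) =
  (energy (re u) (re v) + energy (im u) (im v)) +i*
  (energy (im u) (re v) - energy (re u) (im v)).
Proof.
move=> Lu Lv; have LG := G_L2 Lv; rewrite innerE//.
have [ur ui] := (L2P u).1 Lu; have [vr vi] := (L2P v).1 Lv.
have [Gr Gi] := (L2P _).1 LG.
rewrite -(energyP ur vr).2 -(energyP ui vi).2 -(energyP ui vr).2 -(energyP ur vi).2.
rewrite (dotr_ae ur ur Gr (rG_L2 vr) (ae_eq_refl _ _ _) (rG_ae_re Lv)).
rewrite (dotr_ae ui ui Gr (rG_L2 vr) (ae_eq_refl _ _ _) (rG_ae_re Lv)).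
rewrite (dotr_ae ui ui Gi (rG_L2 vi) (ae_eq_refl _ _ _) (rG_ae_im Lv)).
by rewrite (dotr_ae ur ur Gi (rG_L2 vi) (ae_eq_refl _ _ _) (rG_ae_im Lv)).
Qed.

Lemma G_sym (u v : V) : L2 u -> L2 v -> inner (G u) v = inner u (G v).
Proof.
move=> Lu Lv; rewrite (inner_conj Lv (G_L2 Lu)) !inner_G//.
apply: complex_ext => /=; first by rewrite energyC (energyC (im v)).
by rewrite opprB energyC (energyC (im v)).
Qed.

Lemma G_pos (u : V) : L2 u -> 0 <= rip inner (G u) u.
Proof. by move=> Lu; rewrite /rip G_sym// inner_G//= addr_ge0// energy_ge0. Qed.

Lemma G_inj0 (u : V) : L2 u -> nsq inner (G u) = 0 -> nsq inner u = 0.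
Proof.
move=> Lu; have LG := G_L2 Lu; move=> /(nsq_eq0 LG).1 /aeqP[h1 h2].
have [ur ui] := (L2P u).1 Lu.
have q0 F : rL2 hl F -> ae_eq mu hl (fun x => phi x * quot phi F x) (fun=> 0) ->
    ae_eq mu hl F (fun=> 0).
  move=> LF H; apply: (quot_inj phi_AC phi_gt0 phi_rL2 LF) => x x0.
  have := cont0_ae_eq0 (phi_quot_cont LF) H x0 => /eqP.
  by rewrite mulf_eq0 gt_eqF ?phi_gt0//= => /eqP.
apply/(nsq_eq0 Lu)/aeqP; split.
  by apply: q0 => //; exact: (ae_eq_trans (ae_eq_sym (rG_ae_re Lu)) h1).
by apply: q0 => //; exact: (ae_eq_trans (ae_eq_sym (rG_ae_im Lu)) h2).
Qed.

Local Notation N := (opnorm G).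

Lemma G_normP : 0 <= N /\ forall u : V, L2 u -> nrm inner (G u) <= N * nrm inner u.
Proof.
have [_ [_ _ [M hM]]] := G_bounded.
have n0 : nrm inner (0 : V) = 0.
  by rewrite /nrm (nsq0 L2_0 L2_lin inner_lin inner_conj) sqrtr0.
(* [opnorm] is a genuine supremum only once its set is known to be nonempty and bounded. *)
have sU : has_sup [set L2norm (G f) | f in [set f | L2 f /\ L2norm f <= 1]].
  split.
    exists (L2norm (G (0 : V))); exists (0 : V) => //; split; first exact: L2_0.
    by change (nrm inner (0 : V) <= 1); rewrite n0.
  exists `|M| => _ [f [Lf f1] <-]; rewrite (le_trans (hM f Lf))//.
  rewrite (le_trans (ler_norm _))// normrM ler_piMr// ger0_norm// sqrtr_ge0//.
have ub (u : V) : L2 u -> nrm inner u <= 1 -> nrm inner (G u) <= N.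
  by move=> Lu u1; apply: sup_upper_bound => //; exists u.
have N0 : 0 <= N.
  by apply: (le_trans (sqrtr_ge0 _)); apply: (ub (0 : V)); [exact: L2_0|rewrite n0].
split=> // u Lu; have LG := G_L2 Lu.
have [u0|u0] := eqVneq (nrm inner u) 0.
  (* A null vector cannot be normalised; the a priori bound shows that its image is null. *)
  have uz : L2norm u = 0 := u0.
  by rewrite u0 mulr0; have := hM u Lu; rewrite uz mulr0.
have up : 0 < nrm inner u by rewrite lt_def u0 nrm_ge0.
pose k := (nrm inner u)^-1; have k0 : 0 < k by rewrite invr_gt0.
have nZ (w : V) : L2 w -> nrm inner (k%:C *: w) = k * nrm inner w.
  move=> Lw; rewrite /nrm (nsqZr L2_0 L2_lin inner_lin inner_conj)//.
  by rewrite sqrtrM ?sqr_ge0// sqrtr_sqr gtr0_norm.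
have := ub (k%:C *: u) (SZ L2_0 L2_lin _ Lu).
rewrite (GZ L2_0 (@G_lin)) // !nZ// mulVf// => /(_ (lexx _)).
by rewrite /k mulrC ler_pdivrMr.
Qed.

Lemma G_bd (u : V) : L2 u -> nsq inner (G u) <= N ^+ 2 * nsq inner u.
Proof.
move=> Lu; have [N0 h] := G_normP; have LG := G_L2 Lu.
rewrite -!(sqr_nrm (@inner_ge0 R))// -exprMn ler_pXn2r ?nnegrE ?mulr_ge0 ?nrm_ge0//.
exact: h.
Qed.

Lemma G_aeq (u v : V) : L2 u -> L2 v -> aeq u v -> aeq (G u) (G v).
Proof.
move=> Lu Lv /(nsqB_eq0 Lu Lv) h; apply/(nsqB_eq0 (G_L2 Lu) (G_L2 Lv)).
rewrite -(GB L2_0 L2_lin (@G_lin))//; apply/eqP; rewrite eq_le.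
have LB := L2_B Lu Lv.
rewrite (nsq_ge0 (@inner_ge0 R) (G_L2 LB)) andbT.
by rewrite (le_trans (G_bd LB))// h mulr0.
Qed.

Lemma G_inj (u v : V) : L2 u -> L2 v -> aeq (G u) (G v) -> aeq u v.
Proof.
move=> Lu Lv /(nsqB_eq0 (G_L2 Lu) (G_L2 Lv)) h; apply/(nsqB_eq0 Lu Lv).
by apply: G_inj0; [exact: L2_B|rewrite (GB L2_0 L2_lin (@G_lin))].
Qed.

Definition tailC (f : R -> C) : R -> C :=
  fun x => tail phi (re f) x +i* tail phi (im f) x.

Lemma L2_divphi (h f : R -> C) : L2loc h -> aeq h (fun x => phiC x * f x) -> L2 f ->
  L2 (fun x => (phiC x)^-1 * h x) /\ aeq (fun x => (phiC x)^-1 * h x) f.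
Proof.
move=> Lh hf Lf.
have e : aeq (fun x => (phiC x)^-1 * h x) f.
  apply: aeS hf => x H hx; rewrite (H hx) mulKf//.
  have px : 0 < phi x by apply: phi_gt0; move: hx; rewrite half_lineE => /ltW.
  by apply/eqP => /(congr1 (@complex.Re R)) /= /eqP; rewrite gt_eqF.
split=> //; apply: L2_ae (aeq_sym e) Lf.
  have [] // := @cmeasM _ (fun x => (phiC x)^-1) h _ (L2loc_measurable Lh).
  rewrite (_ : (fun _ => _) = fun x => ((phi x)^-1)%:C).
    exact: (cmeas_real (cont0_measurable (cont0V (AC_cont phi_AC) phi_gt0))).
  by apply/funext => x; rewrite toC_V.
have [] // := @cmeasM _ (fun x => (phiC x)^-1) h _ (L2loc_measurable Lh).
rewrite (_ : (fun _ => _) = fun x => ((phi x)^-1)%:C).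
  exact: (cmeas_real (cont0_measurable (cont0V (AC_cont phi_AC) phi_gt0))).
by apply/funext => x; rewrite toC_V.
Qed.

Lemma G_wderiv f : L2 f -> has_wderiv (G f) (fun x =>
  (phi' x * quot phi (re f) x + phi x * (tail phi (re f) x * phi x ^- 2)) +i*
  (phi' x * quot phi (im f) x + phi x * (tail phi (im f) x * phi x ^- 2))).
Proof.
move=> Lf; have [fr fi] := (L2P f).1 Lf.
have pc := AC_cont phi_AC; have vc := phiVn_cont phi_AC phi_gt0.
have Lp : forall a, 0 < a -> rL2 (`]0, a[%classic : set R) phi'.
  by have [/L2loc_parts[h _] _] := wderiv_has phi_W.
have Lc F : rL2 hl F -> forall a, 0 < a -> rL2 (`]0, a[%classic : set R)
    (fun x => phi' x * quot phi F x + phi x * (tail phi F x * phi x ^- 2)).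
  move=> LF a a0; apply: rL2_D; first exact: measurable_itv.
    by apply: rL2_locM Lp _ a0; exact: (AC_cont (quot_AC phi_AC phi_gt0 phi_rL2 LF)).
  apply: cont0_rL2loc a0; apply: cont0M => //; apply: cont0M => //.
  exact: (tail_cont phi_rL2 LF).
apply/has_wderivP; split.
- by apply/L2loc_parts; split; exact: Lc.
- apply: (AC_ext _ (AC_M phi_AC (quot_AC phi_AC phi_gt0 phi_rL2 fr))) => x x0.
  by rewrite re_G.
- apply: (AC_ext _ (AC_M phi_AC (quot_AC phi_AC phi_gt0 phi_rL2 fi))) => x x0.
  by rewrite im_G.
Qed.

Lemma tailC_wderiv f : L2 f -> has_wderiv (tailC f) (fun x => - (phiC x * f x)).
Proof.
move=> Lf; have [fr fi] := (L2P f).1 Lf; have pc := AC_cont phi_AC.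
have rE : re (fun x => - (phiC x * f x)) = fun x => - (phi x * re f x).
  by apply/funext => x; rewrite /re ReN ReZ.
have iE : im (fun x => - (phiC x * f x)) = fun x => - (phi x * im f x).
  by apply/funext => x; rewrite /im ImN ImZ.
have [Lr Li] := (L2loc_parts f).1 (L2_L2loc Lf).
have LN F : (forall a, 0 < a -> rL2 (`]0, a[%classic : set R) F) ->
    forall a, 0 < a -> rL2 (`]0, a[%classic : set R) (fun x => - (phi x * F x)).
  move=> LF a a0; apply: rL2_N; first exact: measurable_itv.
  by have := rL2_locM pc LF a0; under [X in rL2 _ X]eq_fun do rewrite mulrC.
apply/has_wderivP; split.
- by apply/L2loc_parts; rewrite rE iE; split; exact: LN.
- by rewrite rE; exact: (tail_AC phi_rL2 fr).
- by rewrite iE; exact: (tail_AC phi_rL2 fi).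
Qed.

Lemma wronskian_parts g : aeq (wronskian phi g)
  (fun x => (phi x * re (wderiv g) x - phi' x * re g x) +i*
            (phi x * im (wderiv g) x - phi' x * im g x)).
Proof.
apply: aeS wderiv_phi_im => x H hx; rewrite /wronskian.
have H0 : Im (wderiv phiC x) = 0 by exact: H.
apply: complex_ext; rewrite /= ?ReD ?ImD ?ReN ?ImN ?cReM ?cImM /= H0.
  by rewrite /phi' /re /im; ring.
by rewrite /phi' /re /im; ring.
Qed.

(** With Gf = phi q, the Wronskian phi (phi q)' - phi' phi q collapses to phi^2 q' = A. *)
Lemma wronskian_G f : L2 f -> aeq (wronskian phi (G f)) (tailC f).
Proof.
move=> Lf; have [/aeqP[h1 h2] _] := wderiv_W (G_wderiv Lf).
apply: aeq_trans (wronskian_parts _) _.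
apply: aeS2 h1 h2 => x H1 H2 hx; rewrite (H1 hx) (H2 hx).
have x0 : 0 <= x by move: hx; rewrite half_lineE => /ltW.
have px := phi_gt0 x0; rewrite re_G// im_G// /tailC.
by apply: complex_ext; rewrite /re /im /=; field; rewrite gt_eqF.
Qed.

Lemma psi_Psi x : psi phi x = phi x * Psi phi x. Proof. by []. Qed.

Lemma calD_G f : L2 f -> calD phi (G f).
Proof.
move=> Lf; have [fr fi] := (L2P f).1 Lf; have tw := tailC_wderiv Lf.
have wt := wronskian_G Lf.
split.
- by split; [exact: G_L2|exact: (has_wderiv_Wloc (G_wderiv Lf))].
- by apply: complex_ext; [have := re_G Lf (lexx 0)|have := im_G Lf (lexx 0)];
    rewrite /re /im => ->; rewrite quot0 mulr0.
- by exists (tailC f) => //; exact: (has_wderiv_Wloc tw).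
- have [h1 h2] := wderiv_uniq wt tw.
  have LN : L2 (fun x => - f x).
    have -> : (fun x => - f x) = (fun x => -1 * f x + 0).
      by apply/funext => x; rewrite mulN1r addr0.
    exact: (L2_lin (-1) Lf (@L2_0 R)).
  have [] // := L2_divphi h2 _ LN.
  by apply: aeS h1 => x H hx; rewrite (H hx) mulrN.
(* Here (Gf) / psi = q / Psi, so (D5) is [quot_small] for the real and imaginary parts, with e/2
   each. *)
- apply/cvg0P => e e0; have e2 : 0 < e / 2 by exact: divr_gt0.
  have [a1 a10 h1] := quot_small phi_AC phi_gt0 phi_rL2 fr e2.
  have [a2 a20 h2] := quot_small phi_AC phi_gt0 phi_rL2 fi e2.
  have [a3 a30 h3] := Psi_unbounded phi_AC phi_gt0 phi_rL2 1.
  exists (Num.max a1 (Num.max a2 a3)) => x.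
  rewrite !ge_max => /andP[x1 /andP[x2 x3]].
  have x0 : 0 <= x by rewrite (le_trans (ltW a10)).
  have px := phi_gt0 x0; have P0 : 0 < Psi phi x by rewrite (lt_le_trans ltr01)// h3.
  rewrite (le_trans (normc_le_parts _))// lecR (splitr e).
  rewrite psi_Psi toC_V mulrC ReZ ImZ.
  have := re_G Lf x0; have := im_G Lf x0; rewrite /re /im => -> ->.
  have E (q : R) : `|(phi x * Psi phi x)^-1 * (phi x * q)| = `|q| / Psi phi x.
    have -> : (phi x * Psi phi x)^-1 * (phi x * q) = q / Psi phi x.
      by field; rewrite !gt_eqF.
    by rewrite normrM normfV (gtr0_norm P0).
  by rewrite !E; apply: lerD; (rewrite ler_pdivrMr; last exact: P0);
    [exact: h1|exact: h2].
Qed.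

Definition source (g : R -> C) : R -> C :=
  fun x => - ((phiC x)^-1 * wderiv (wronskian phi g) x).

Lemma calD_source g : calD phi g ->
  [/\ L2 (source g), forall x, 0 <= x -> g x = G (source g) x &
      aeq (wronskian phi g) (tailC (source g))].
Proof.
move=> [[Lg Wg] g0 [u Wu wu] D4 D5]; set f := source g.
have Lf : L2 f.
  have -> : f = (fun x => -1 * ((phiC x)^-1 * wderiv (wronskian phi g) x) + 0).
    by apply/funext => x; rewrite mulN1r addr0.
  exact: (L2_lin (-1) D4 (@L2_0 R)).
have [fr fi] := (L2P f).1 Lf.
have uu := wderiv_has Wu; have [h1 h2] := wderiv_uniq wu uu.
have /has_wderivP[_ ur ui] := AC_wderiv uu (aeq_sym h1) h2.
have /has_wderivP[_ gr gi] := wderiv_has Wg.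
have /aeqP[wr wi] := aeq_trans (aeq_sym (wronskian_parts g)) wu.
(* (D5) in the form needed by [quot_charac], for [p] the real or the imaginary part. *)
have small (p : C -> R) : (forall z, `|p z|%:C <= `|z|) ->
    (forall k z, p (k%:C * z) = k * p z) ->
    forall e, 0 < e -> exists a, forall x, a <= x -> `|p (g x)| <= e * (phi x * Psi phi x).
  move=> pn pZ e e0; have [a ha] := (cvg0P _).1 D5 e e0.
  have [a3 a30 h3] := Psi_unbounded phi_AC phi_gt0 phi_rL2 1.
  exists (Num.max a a3) => x; rewrite ge_max => /andP[xa x3].
  have x0 : 0 <= x by rewrite (le_trans (ltW a30)).
  have px := phi_gt0 x0; have P0 : 0 < Psi phi x by rewrite (lt_le_trans ltr01)// h3.
  have pP : 0 < phi x * Psi phi x by exact: mulr_gt0.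
  have := le_trans (pn _) (ha x xa); rewrite psi_Psi toC_V mulrC pZ lecR.
  rewrite normrM normfV (gtr0_norm pP) mulrC ler_pdivrMr//.
have px x : hl x -> phi x != 0.
  by rewrite half_lineE => /ltW x0; rewrite gt_eqF// phi_gt0.
have fE x : f x = - ((phi x)^-1%:C * wderiv (wronskian phi g) x) by rewrite /f /source toC_V.
have Qr := quot_charac phi_AC phi_gt0 phi_rL2 gr ur fr wr.
have Qi := quot_charac phi_AC phi_gt0 phi_rL2 gi ui fi wi.
have {}Qr x : 0 <= x -> re g x = phi x * quot phi (re f) x /\ re u x = tail phi (re f) x.
  apply: Qr.
  - by move=> y hy; rewrite {1}/re fE ReN ReZ mulrN mulVKf ?px.
  - by rewrite /re g0.
  - by apply: small; [exact: Re_le_normc|exact: ReZ].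
have {}Qi x : 0 <= x -> im g x = phi x * quot phi (im f) x /\ im u x = tail phi (im f) x.
  apply: Qi.
  - by move=> y hy; rewrite {1}/im fE ImN ImZ mulrN mulVKf ?px.
  - by rewrite /im g0.
  - by apply: small; [exact: Im_le_normc|exact: ImZ].
split=> //.
  move=> x x0; apply: complex_ext.
    by rewrite -[LHS]/(re g x) -[RHS]/(re (G f) x) re_G// (Qr x x0).1.
  by rewrite -[LHS]/(im g x) -[RHS]/(im (G f) x) im_G// (Qi x x0).1.
apply: aeq_trans wu _; apply: eq_aeq => x /ltW x0.
by apply: complex_ext => /=; [exact: (Qr x x0).2|exact: (Qi x x0).2].
Qed.

Lemma Hformula_source g : calD phi g ->
  L2 (Hformula phi g) /\ aeq (Hformula phi g) (source g).
Proof.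
move=> Dg; have [Lf gf wf] := calD_source Dg.
have tw := tailC_wderiv Lf.
have nt : has_wderiv (fun x => - tailC (source g) x) (fun x => phiC x * source g x).
  have -> : (fun x => phiC x * source g x) = (fun x => - - (phiC x * source g x)).
    by apply/funext => x; rewrite opprK.
  exact: has_wderivN.
have ae : aeq (fun y => wderiv phiC y * g y - phiC y * wderiv g y)
    (fun x => - tailC (source g) x).
  by apply: aeS wf => x H hx; rewrite -(H hx) /wronskian opprB.
have [h1 h2] := wderiv_uniq ae nt.
exact: (L2_divphi h2 h1 Lf).
Qed.

Local Notation H := (op_inverse (op_graph G)).

Lemma H_formula g : calD phi g -> H g (Hformula phi g).
Proof.
move=> Dg; have [Lf gf _] := calD_source Dg; have [LH Hf] := Hformula_source Dg.
have [[Lg _] _ _ _ _] := Dg; split=> //.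
apply: (@aeq_trans _ (G (source g))); first by apply: eq_aeq => x /ltW; exact: gf.
exact: (G_aeq Lf LH (aeq_sym Hf)).
Qed.

Lemma H_domain g : op_dom H g <-> L2 g /\ exists2 g0, calD phi g0 & aeq g g0.
Proof.
split.
  by move=> [h [Lh Lg gh]]; split=> //; exists (G h) => //; exact: calD_G.
move=> [Lg [g0 D0 gg0]]; exists (Hformula phi g0).
by have [LH L0 h] := H_formula D0; split=> //; exact: (aeq_trans gg0 h).
Qed.

Lemma H_self_adjoint : self_adjoint H.
Proof.
split.
- split.
  + by move=> f h [].
  + move=> f h f' h' [Lh Lf fh] Lf' Lh' ff' hh'; split=> //.
    exact: (aeq_trans (aeq_sym ff') (aeq_trans fh (G_aeq Lh Lh' hh'))).
  + move=> f h h' [Lh Lf fh] [Lh' _ fh']; apply: (G_inj Lh Lh').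
    exact: (aeq_trans (aeq_sym fh) fh').
  + split; [exact: L2_0|exact: L2_0|].
    have /(nsq_eq0 (G_L2 (@L2_0 R))).1 h : nsq inner (G (0 : V)) = 0.
      apply/eqP; rewrite eq_le (nsq_ge0 (@inner_ge0 R) (G_L2 (@L2_0 R))) andbT.
      rewrite (le_trans (G_bd (@L2_0 R)))//.
      by rewrite (nsq0 (@L2_0 R) (@L2_lin R) (@inner_lin R) (@inner_conj R)) mulr0.
    exact: (aeq_sym h).
  + move=> a f g h k [Lh Lf fh] [Lk Lg gk].
    split; [exact: (L2_lin a Lh Lk)|exact: (L2_lin a Lf Lg)|].
    have -> : G (fun x => a * h x + k x) = (fun x => a * G h x + G k x) := G_lin a Lh Lk.
    by apply: aeS2 fh gk => x H1 H2 hx; rewrite H1// H2.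
- move=> f Lf e e0.
  have [N0 _] := G_normP.
  have [h Lh hf] := dense_range (@L2_0 R) (@L2_lin R) (@inner_lin R) (@inner_conj R)
    (@inner_ge0 R) (@L2_complete R) (@G_L2) (@G_lin) G_sym G_pos N0 G_bd G_inj0 Lf e0.
  exists (G h); last exact: hf.
  by exists h; split=> //; [exact: G_L2|exact: aeq_refl].
- move=> u v; split.
    move=> [Lu Lv huv].
    (* Every element of the domain is some Gh up to null sets, so the adjoint relation tested on Gh
       reads (h, u) = (Gh, v) = (h, Gv); then h = u - Gv gives u = Gv. *)
    have key (h : V) : L2 h -> inner h u = inner h (G v).
      move=> Lh; have := huv (G h) h; rewrite G_sym// => ->//.
      by split=> //; [exact: G_L2|exact: aeq_refl].
    split=> //; apply/(nsqB_eq0 Lu (G_L2 Lv)).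
    have LB := L2_B Lu (G_L2 Lv); have LG := G_L2 Lv.
    rewrite /nsq (ripBr (@L2_0 R) (@L2_lin R) (@inner_lin R) (@inner_conj R))//.
    by rewrite /rip key// subrr.
  move=> [Lv Lu uv]; split=> // f h [Lh Lf fh].
  rewrite (inner_aeq Lh Lh Lu (G_L2 Lv) (aeq_refl _) uv).
  by rewrite -G_sym// (inner_aeq (G_L2 Lh) Lf Lv Lv (aeq_sym fh) (aeq_refl _)).
Qed.

(** The resolvent of H at z is G (1 - z G)^-1, of norm at most N K. *)
Lemma spectrum_H : spectrum H `<=` [set t%:C | t in `[N^-1, +oo[].
Proof.
have [N0 GN] := G_normP.
move=> z hz; apply: contrapT => nz; apply: hz.
have hm : ~ (Im (1 - z * N%:C) = 0 /\ Re (1 - z * N%:C) <= 0).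
  case: z nz => p q nz.
  have -> : 1 - (p +i* q) * N%:C = (1 - p * N) +i* (- (q * N)).
    by apply: complex_ext; rewrite ?ImD ?ReD ?ImN ?ReN ?cReM ?cImM /=; ring.
  (* The inequality 1 <= p N excludes N = 0, so q = 0 and p >= 1/N. *)
  move=> /= [/eqP]; rewrite oppr_eq0 mulf_eq0 subr_le0 => qN pN.
  have Np : 0 < N.
    rewrite lt_def N0 andbT; apply/eqP => NE.
    by move: pN; rewrite NE mulr0 leNgt ltr01.
  move: qN; rewrite (gt_eqF Np) orbF => /eqP q0; apply: nz; exists p.
    by rewrite /= in_itv/= andbT -[N^-1]mul1r ler_pdivrMr.
  by rewrite q0.
have [solve [K K0 hK]] := resolvent_solve (@L2_0 R) (@L2_lin R) (@inner_lin R)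
  (@inner_conj R) (@inner_ge0 R) (@L2_complete R) (@G_L2) (@G_lin) G_sym G_pos N0 G_bd hm.
pose M (u : V) : V := u - z *: (G u : V).
have LM u : L2 u -> L2 (M u).
  by move=> Lu; apply: L2_B => //; apply: (SZ (@L2_0 R) (@L2_lin R)); exact: G_L2.
(* [s] picks a solution of (1 - z G) u = k, with 0 as default outside L^2. Being a choice, it is
   linear only up to null sets, by [uniq]. *)
have /choice[s hs] : forall k : V, exists u : V, L2 k -> L2 u /\ aeq (M u) k.
  move=> k; have [Lk|nk] := pselect (L2 k); last by exists 0.
  by have [u Lu hu] := solve k Lk; exists u => _; split=> //; apply/(nsqB_eq0 (LM u Lu) Lk).
have MB u v : L2 u -> L2 v -> M (u - v) = M u - M v.
  move=> Lu Lv; rewrite /M (GB (@L2_0 R) (@L2_lin R) (@G_lin))// scalerBr subrBB//.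
have uniq u v : L2 u -> L2 v -> aeq (M u) (M v) -> aeq u v.
  move=> Lu Lv /(nsqB_eq0 (LM u Lu) (LM v Lv)) h; apply/(nsqB_eq0 Lu Lv).
  have LB := L2_B Lu Lv; have := hK _ LB; rewrite -/(M (u - v)) MB// /nrm h sqrtr0 mulr0.
  move=> h0; have : nrm inner (u - v) = 0 by apply/eqP; rewrite eq_le h0 nrm_ge0.
  by move=> /(congr1 (fun t => t ^+ 2)); rewrite (sqr_nrm (@inner_ge0 R))// expr0n.
have sP k : L2 k -> L2 (s k) /\ aeq (M (s k)) k := hs k.
exists (fun k => G (s k)).
  split.
  - by move=> f Lf; apply: G_L2; case: (sP f Lf).
  - move=> a f g Lf Lg; have [Lsf hf] := sP f Lf; have [Lsg hg] := sP g Lg.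
    have Lfg : L2 (fun x => a * f x + g x) := L2_lin a Lf Lg.
    have [Ls h] := sP _ Lfg.
    have Lc : L2 (a *: s f + s g) := L2_lin a Lsf Lsg.
    have E : aeq (s (fun x => a * f x + g x)) (a *: s f + s g).
      apply: uniq => //; apply: aeq_trans h _; apply: aeq_sym.
      have -> : M (a *: s f + s g) = a *: M (s f) + M (s g).
        rewrite /M (G_lin a Lsf Lsg) scalerDr scalerBr opprD addrACA.
        by rewrite !scalerA (mulrC z a).
      by apply: aeS2 hf hg => x H1 H2 hx; rewrite -(H1 hx) -(H2 hx).
    have := G_aeq Ls Lc E; rewrite (G_lin a Lsf Lsg); exact.
  - exists (N * K) => f Lf; have [Ls h] := sP f Lf; have LMs := LM _ Ls.
    have E : nrm inner (M (s f)) <= nrm inner f.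
      have /(nsqB_eq0 LMs Lf) h0 := h.
      have := nrm_dist (@L2_0 R) (@L2_lin R) (@inner_lin R) (@inner_conj R)
        (@inner_ge0 R) LMs Lf (@L2_0 R).
      by rewrite !subr0 /nrm h0 sqrtr0 add0r.
    rewrite -mulrA; apply: (le_trans (GN _ Ls)); apply: ler_wpM2l => //.
    by apply: (le_trans (hK _ Ls)); exact: ler_wpM2l.
(* If f = Gh and k = h - z f, then h solves (1 - z G) h = k, so it agrees with [s k]. *)
move=> k f; split.
  move=> [Lk [h [Lh Lf fh] kh]]; have [Ls hsk] := sP k Lk.
  have hE : aeq (M h) k.
    by apply: aeq_sym; apply: aeS2 kh fh => x H1 H2 hx; rewrite (H1 hx) (H2 hx).
  split=> //; apply: (aeq_trans fh); apply: G_aeq => //.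
  by apply: uniq => //; exact: (aeq_trans hE (aeq_sym hsk)).
move=> [Lk Lf fk]; have [Ls hsk] := sP k Lk; split=> //; exists (s k); first by [].
by apply: aeS2 hsk fk => x H1 H2 hx; rewrite -(H1 hx) (H2 hx).
Qed.

End GreenOperator.

(** * The Dirichlet form *)

Lemma has_wderiv_conj (R : realType) (f g : R -> R[i]) : has_wderiv f g ->
  has_wderiv (fun x => conjc (f x)) (fun x => conjc (g x)).
Proof.
move=> /has_wderivP[/L2loc_parts[Lr Li] fr fi].
have rE h : re (fun x : R => conjc (h x)) = re h.
  by apply/funext => x; rewrite /re ReJ.
have iE h : im (fun x : R => conjc (h x)) = fun x => - im h x.
  by apply/funext => x; rewrite /im ImJ.
apply/has_wderivP; rewrite !rE !iE; split=> //; last exact: AC_N.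
apply/L2loc_parts; rewrite rE iE; split=> // a a0; apply: rL2_N.
  exact: measurable_itv.
exact: Li.
Qed.

Section DirichletForm.
Context {R : realType} (phi : R -> R).
Context (phi_L2 : L2 (toC phi)) (phi_W : Wloc (toC phi))
  (phi_gt0 : forall x : R, 0 <= x -> 0 < phi x)
  (G_bounded : kernel_of_bounded_op (green phi)).
Local Notation C := R[i].
Local Notation mu := (@lebesgue_measure R).
Local Notation hl := (@half_line R).
Local Notation phiC := (toC phi).
Local Notation G := (integral_op (green phi)).
Local Notation tailC := (tailC phi).

Let mh : measurable hl := @measurable_half_line R.
Let phi_AC' := phi_AC phi_W.
Let phi_rL2' := phi_rL2 phi_L2.

Lemma quot_wderiv f g : L2 f -> (forall x, 0 <= x -> g x = G f x) ->
  has_wderiv (fun x => g x / phiC x) (fun x => (phi x ^- 2)%:C * tailC f x).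
Proof.
move=> Lf gG; have [fr fi] := (L2P f).1 Lf.
have E : (fun x => g x / phiC x) = (fun x => ((phi x)^-1)%:C * g x).
  by apply/funext => x; rewrite toC_V mulrC.
have rT : re (fun x => (phi x ^- 2)%:C * tailC f x) =
    (fun x => tail phi (re f) x * phi x ^- 2).
  by apply/funext => x; rewrite /re ReZ mulrC.
have iT : im (fun x => (phi x ^- 2)%:C * tailC f x) =
    (fun x => tail phi (im f) x * phi x ^- 2).
  by apply/funext => x; rewrite /im ImZ mulrC.
have qr := quot_AC phi_AC' phi_gt0 phi_rL2' fr.
have qi := quot_AC phi_AC' phi_gt0 phi_rL2' fi.
have Lc F : rL2 hl F -> forall a, 0 < a ->
    rL2 (`]0, a[%classic : set R) (fun x => tail phi F x * phi x ^- 2).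
  move=> LF a a0; apply: cont0_rL2loc a0; apply: cont0M.
    exact: (tail_cont phi_rL2' LF).
  exact: (phiVn_cont phi_AC' phi_gt0).
rewrite E; apply/has_wderivP; split.
- by apply/L2loc_parts; rewrite rT iT; split; exact: Lc.
- rewrite rT; apply: (AC_ext _ qr) => x x0; rewrite /re ReZ gG//.
  have := re_G phi_L2 phi_W phi_gt0 Lf x0; rewrite /re => ->.
  by rewrite mulKf// gt_eqF// phi_gt0.
- rewrite iT; apply: (AC_ext _ qi) => x x0; rewrite /im ImZ gG//.
  have := im_G phi_L2 phi_W phi_gt0 Lf x0; rewrite /im => ->.
  by rewrite mulKf// gt_eqF// phi_gt0.
Qed.

(** The common value, almost everywhere, of the two integrands of the quadratic form. *)
Definition form_density f1 f2 : R -> C :=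
  fun x => (phi x ^- 2)%:C * (tailC f1 x * conjc (tailC f2 x)).

Lemma form_densityP f1 f2 : L2 f1 -> L2 f2 ->
  cintegrable hl (form_density f1 f2) /\
  cintegral hl (form_density f1 f2) = inner f1 (G f2).
Proof.
move=> L1 L2'; have [r1 i1] := (L2P f1).1 L1; have [r2 i2] := (L2P f2).1 L2'.
have [rr _] := energyP phi_L2 phi_W phi_gt0 G_bounded r1 r2.
have [ii _] := energyP phi_L2 phi_W phi_gt0 G_bounded i1 i2.
have [ir _] := energyP phi_L2 phi_W phi_gt0 G_bounded i1 r2.
have [ri _] := energyP phi_L2 phi_W phi_gt0 G_bounded r1 i2.
have rE : (fun x => Re (form_density f1 f2 x)) = (fun x =>
    tail phi (re f1) x * tail phi (re f2) x * phi x ^- 2 +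
    tail phi (im f1) x * tail phi (im f2) x * phi x ^- 2).
  by apply/funext => x; rewrite ReZ cReM ReJ ImJ /=; ring.
have iE : (fun x => Im (form_density f1 f2 x)) = (fun x =>
    tail phi (im f1) x * tail phi (re f2) x * phi x ^- 2 -
    tail phi (re f1) x * tail phi (im f2) x * phi x ^- 2).
  by apply/funext => x; rewrite ImZ cImM ReJ ImJ /=; ring.
split.
  split.
    by have := intgD mh rr ii; rewrite -rE.
  by have := intgB mh ir ri; rewrite -iE.
rewrite (inner_G phi_L2 phi_W phi_gt0 G_bounded)// /cintegral rE iE.
by rewrite RintegralD// RintegralB.
Qed.

(** Conjugation passes through because the chosen derivative of phi is real almost everywhere. *)
Lemma tailC_conj_wronskian g : aeq (fun x =>
  phiC x * conjc (wderiv g x) - wderiv phiC x * conjc (g x))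
  (fun x => conjc (wronskian phi g x)).
Proof.
apply: aeS (wderiv_phi_im phi_W) => x H hx; rewrite /wronskian.
have H0 : Im (wderiv phiC x) = 0 by exact: H.
by apply: complex_ext; rewrite ?ReJ ?ImJ ?ReD ?ImD ?ReN ?ImN ?cReM ?cImM ?ReJ ?ImJ /= H0; ring.
Qed.

Lemma dirichlet_form g1 g2 : calD phi g1 -> calD phi g2 ->
  let I1 := fun x => (phiC x * wderiv g1 x - wderiv phiC x * g1 x) *
    (phiC x * conjc (wderiv g2 x) - wderiv phiC x * conjc (g2 x)) *
    (phiC x) ^- 2 in
  let q1 := fun x => g1 x / phiC x in
  let q2 := fun x => conjc (g2 x) / phiC x in
  let I2 := fun x => wderiv q1 x * wderiv q2 x * (phiC x) ^+ 2 in
  [/\ Wloc q1, Wloc q2, cintegrable half_line I1,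
      cintegrable half_line I2 &
      forall h : R -> R[i], op_inverse (op_graph G) g1 h ->
        inner h g2 = cintegral half_line I1 /\
        cintegral half_line I1 = cintegral half_line I2].
Proof.
move=> D1 D2 I1 q1 q2 I2.
have [Lf1 gf1 w1] := calD_source phi_L2 phi_W phi_gt0 D1.
have [Lf2 gf2 w2] := calD_source phi_L2 phi_W phi_gt0 D2.
have [[Lg1 Wg1] _ _ _ _] := D1; have [[Lg2 Wg2] _ _ _ _] := D2.
set f1 := source phi g1 in Lf1 gf1 w1; set f2 := source phi g2 in Lf2 gf2 w2.
have d1 := quot_wderiv Lf1 gf1.
have d2 : has_wderiv q2 (fun x => conjc ((phi x ^- 2)%:C * tailC f2 x)).
  have -> : q2 = (fun x => conjc (g2 x / phiC x)).
    apply/funext => x; rewrite /q2 toC_V ![_ * ((phi x)^-1)%:C]mulrC.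
    by apply: complex_ext; rewrite ?ReJ ?ImJ ?ReZ ?ImZ ?ReJ ?ImJ ?mulrN.
  exact: (has_wderiv_conj (quot_wderiv Lf2 gf2)).
have Wq1 := has_wderiv_Wloc d1; have Wq2 := has_wderiv_Wloc d2.
have [Ji JE] := form_densityP Lf1 Lf2.
have mphi : cmeas phiC by exact: cmeas_Wloc.
have mphi2 : cmeas (fun x => (phiC x) ^+ 2).
  by rewrite (_ : (fun _ => _) = fun x => phiC x * phiC x); [exact: cmeasM|].
have mphiV : cmeas (fun x => (phiC x) ^- 2).
  rewrite (_ : (fun _ => _) = fun x => (phi x ^- 2)%:C).
    exact: (cmeas_real (cont0_measurable (phiVn_cont phi_AC' phi_gt0))).
  by apply/funext => x; rewrite toC_Vn.
(* Agreement almost everywhere with [form_density] does not yield measurability, which is therefore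
   checked on the formulas themselves. *)
have mI1 : cmeas I1.
  apply: cmeasM => //; apply: cmeasM; apply: cmeasB; apply: cmeasM => //;
    try exact: cmeas_wderiv; try exact: cmeas_Wloc; apply: cmeasJ.
    exact: cmeas_wderiv.
  exact: cmeas_Wloc.
have mI2 : cmeas I2 by apply: cmeasM => //; apply: cmeasM; exact: cmeas_wderiv.
have e1 : aeq I1 (form_density f1 f2).
  have h := aeq_trans (tailC_conj_wronskian g2) (aeS (fun x H hx => congr1 conjc (H hx)) w2).
  apply: aeS2 w1 h => x H1 H2 hx; rewrite /I1 (H2 hx) -/(wronskian phi g1 x) (H1 hx).
  by rewrite toC_Vn mulrC.
have e2 : aeq I2 (form_density f1 f2).
  have [h1 _] := wderiv_W d1; have [h2 _] := wderiv_W d2.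
  apply: aeS2 h1 h2 => x H1 H2 hx; rewrite /I2 (H1 hx) (H2 hx) /form_density.
  have px : phi x != 0 by move: hx; rewrite half_lineE => /ltW x0; rewrite gt_eqF// phi_gt0.
  have cE : conjc ((phi x ^- 2)%:C * tailC f2 x) = (phi x ^- 2)%:C * conjc (tailC f2 x).
    by apply: complex_ext; rewrite ?ReJ ?ImJ ?ReZ ?ImZ ?ReJ ?ImJ ?mulrN.
  rewrite cE -[(phiC x) ^+ 2]rmorphXn.
  have k1 : (phi x ^- 2)%:C * (phi x ^+ 2)%:C = 1 :> C.
    by rewrite -rmorphM mulVf ?rmorph1// expf_neq0.
  rewrite [LHS](_ : _ = ((phi x ^- 2)%:C * (phi x ^+ 2)%:C) *
    ((phi x ^- 2)%:C * (tailC f1 x * conjc (tailC f2 x)))); last by rewrite /toC; ring.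
  by rewrite k1 mul1r.
have [i1 E1] := cintegral_aeq mI1 e1 Ji; have [i2 E2] := cintegral_aeq mI2 e2 Ji.
split=> // h [Lh _ gh]; split; last by rewrite E1 E2.
rewrite E1 JE.
have gG f g : (forall x, 0 <= x -> g x = G f x) -> aeq g (G f).
  by move=> E; apply: eq_aeq => x /ltW; exact: E.
(* [h] is any function related to [g1] by H; injectivity of G identifies it with the source up to a
   null set. *)
have hf : aeq h f1.
  apply: (G_inj phi_L2 phi_W phi_gt0 G_bounded Lh Lf1).
  exact: (aeq_trans (aeq_sym gh) (gG _ _ gf1)).
exact: (inner_aeq Lh Lf1 Lg2 (G_L2 G_bounded Lf2) hf (gG _ _ gf2)).
Qed.

End DirichletForm.

Theorem theorem14 (R : realType) (phi : R -> R)
    (phi_L2 : L2 (toC phi)) (phi_W : Wloc (toC phi))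
    (phi_gt0 : forall x : R, 0 <= x -> 0 < phi x)
    (G_bounded : kernel_of_bounded_op (green phi)) :
  let G := integral_op (green phi) in
  let H := op_inverse (op_graph G) in
  let phiC := toC phi in
  [/\ self_adjoint H /\
        (forall g : R -> R[i],
           op_dom H g <-> L2 g /\ exists2 g0, calD phi g0 & aeq g g0),
      forall g : R -> R[i], calD phi g -> H g (Hformula phi g),
      spectrum H `<=` [set t%:C | t in `[(opnorm G)^-1, +oo[],
      forall g : R -> R[i], calD phi g -> g 0 = 0 &
      forall g1 g2 : R -> R[i], calD phi g1 -> calD phi g2 ->
        let I1 := fun x => (phiC x * wderiv g1 x - wderiv phiC x * g1 x) *
          (phiC x * conjc (wderiv g2 x) - wderiv phiC x * conjc (g2 x)) *
          (phiC x) ^- 2 in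
        let q1 := fun x => g1 x / phiC x in
        let q2 := fun x => conjc (g2 x) / phiC x in
        let I2 := fun x => wderiv q1 x * wderiv q2 x * (phiC x) ^+ 2 in
        [/\ Wloc q1, Wloc q2, cintegrable half_line I1,
            cintegrable half_line I2 &
            forall h : R -> R[i], H g1 h ->
              inner h g2 = cintegral half_line I1 /\
              cintegral half_line I1 = cintegral half_line I2]].
Proof.
move=> G H phiC; split.
- split; first exact: H_self_adjoint.
  by move=> g; exact: H_domain.
- by move=> g; exact: H_formula.
- exact: spectrum_H.
- by move=> g [].
- by move=> g1 g2; exact: dirichlet_form.
Qed.
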